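(* Let $0<\beta<1$. Then for every nonempty open subset $\mathcal U\subset\mathcal N'$ one has $\mu_\beta(\mathcal U)>0$.
   Context: Nuclear triple: $\mathcal H$ is a real separable Hilbert space with inner product $(\cdot,\cdot)$ and norm $|\cdot|=|\cdot|_0$. For $p\in\mathbb N_0$, $\mathcal H_p$ is a real separable Hilbert space with norm $|\cdot|_p$, $\mathcal H_0=\mathcal H$, with continuous dense Hilbert–Schmidt inclusions $\mathcal H_{p+1}\subset\mathcal H_p$ and $|\cdot|_p\le|\cdot|_{p+1}$ on $\mathcal H_{p+1}$. $\mathcal N=\bigcap_p\mathcal H_p$ with the projective limit topology is a nuclear space, continuously and densely embedded in $\mathcal H$. $\mathcal H_{-p}$ is the dual of $\mathcal H_p$ with respect to $\mathcal H$, and $\mathcal N'=\bigcup_p\mathcal H_{-p}$ is the dual of $\mathcal N$, equipped with the inductive limit topology (the finest locally convex topology making all inclusions $\mathcal H_{-p}\subset\mathcal N'$ continuous); $\langle\cdot,\cdot\rangle$ is the dual pairing between $\mathcal N'$ and $\mathcal N$, with $\langle f,\varphi\rangle=(f,\varphi)$ for $f\in\mathcal H,\varphi\in\mathcal N$. Mittag-Leffler function: $\mathrm E_\beta(z)=\sum_{n\ge0}z^n/\Gamma(\beta n+1)$. For $\beta\in(0,1]$, $\mu_\beta$ is the unique probability measure on $\mathcal N'$ with its cylinder $\sigma$-algebra such that $\int_{\mathcal N'}\exp(i\langle\omega,\varphi\rangle)\,d\mu_\beta(\omega)=\mathrm E_\beta(-\tfrac12\langle\varphi,\varphi\rangle)$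 for all $\varphi\in\mathcal N$. *)

(* Defs.v *)
From HB Require Import structures.
From mathcomp Require Import all_boot all_order all_algebra.
From mathcomp Require Import all_classical all_reals all_analysis.
From mathcomp Require Import complex.

Set Implicit Arguments.
Unset Strict Implicit.
Unset Printing Implicit Defensive.

Import Order.TTheory GRing.Theory Num.Theory.
Import numFieldNormedType.Exports.

Local Open Scope classical_set_scope.
Local Open Scope ring_scope.

(* A real Hilbert space is a complete normed module over [R : realType] whose
   norm comes from an inner product. *)
Definition inner_product (R : realType) (V : normedModType R)
    (dot : V -> V -> R) : Prop :=
  [/\ forall x y, dot x y = dot y x,
      forall (a : R) x y z, dot (a *: x + y) z = a * dot x z + dot y z
    & forall x, dot x x = `|x| ^+ 2].

Definition separable (T : topologicalType) : Prop :=
  exists2 D : set T, countable D & dense D.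

Definition linear_span (R : realType) (V : lmodType R) (B : set V) : set V :=
  [set x | exists n (a : 'I_n -> R) (e : 'I_n -> V),
     (forall i, B (e i)) /\ x = \sum_(i < n) a i *: e i].

Definition orthonormal_basis (R : realType) (V : normedModType R)
    (dot : V -> V -> R) (B : set V) : Prop :=
  (forall e e', B e -> B e' -> dot e e' = (e == e')%:R) /\
  dense (linear_span B).

Definition hilbert_schmidt (R : realType) (V W : normedModType R)
    (dot : V -> V -> R) (T : V -> W) : Prop :=
  exists2 B, orthonormal_basis dot B &
    (\esum_(e in B) (`|T e| ^+ 2)%:E < +oo)%E.

(* The inclusion of H_{p+1} in H_p is an injective linear map [incl]. *)
Record nuclear_triple (R : realType) := NuclearTriple {
  hilb :> nat -> completeNormedModType R ;
  dot : forall p, hilb p -> hilb p -> R ;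
  incl : forall p, {linear hilb p.+1 -> hilb p} ;
  dot_inner : forall p, inner_product (@dot p) ;
  hilb_separable : forall p, separable (hilb p) ;
  incl_inj : forall p, injective (incl p) ;
  incl_dense : forall p, dense (range (incl p)) ;
  incl_hilbert_schmidt : forall p, hilbert_schmidt (@dot p.+1) (incl p) ;
  incl_norm_le : forall p (x : hilb p.+1), `|incl p x| <= `|x| }.

(* The inclusion of H_p in H_0. *)
Fixpoint incl0 (R : realType) (H : nuclear_triple R) (p : nat) :
    {linear H p -> H 0%N} :=
  match p return {linear H p -> H 0%N} with
  | 0 => idfun
  | q.+1 => incl0 H q \o incl H q
  end.

Lemma incl0_inj (R : realType) (H : nuclear_triple R) p :
  injective (incl0 H p).
Proof. by elim: p => [//|p IH] x y /IH /(@incl_inj _ H). Qed.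

Definition in_all_hilb (R : realType) (H : nuclear_triple R) : {pred H 0%N} :=
  fun x => `[< forall p, range (incl0 H p) x >].

Arguments in_all_hilb {R} H _.

Lemma in_all_hilb_submod (R : realType) (H : nuclear_triple R) :
  GRing.submod_closed (in_all_hilb H).
Proof.
split; first by apply/asboolP => p; exists 0 => //; rewrite linear0.
move=> a x y /asboolP xN /asboolP yN; apply/asboolP => p.
have [u _ <-] := xN p; have [v _ <-] := yN p.
by exists (a *: u + v) => //; rewrite linearP.
Qed.

HB.instance Definition _ (R : realType) (H : nuclear_triple R) :=
  GRing.isSubmodClosed.Build R (H 0%N) (in_all_hilb H) (in_all_hilb_submod H).

(* The nuclear space N is the intersection of the H_p, taken inside H_0. *)
Record nuclear (R : realType) (H : nuclear_triple R) := Nuclear {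
  nuclear_val :> H 0%N ;
  nuclear_valP : nuclear_val \in in_all_hilb H }.

HB.instance Definition _ (R : realType) (H : nuclear_triple R) :=
  [isSub for @nuclear_val R H].
HB.instance Definition _ (R : realType) (H : nuclear_triple R) :=
  [Choice of nuclear H by <:].
HB.instance Definition _ (R : realType) (H : nuclear_triple R) :=
  [SubChoice_isSubLmodule of nuclear H by <:].

Lemma nuclear_compP (R : realType) (H : nuclear_triple R) (p : nat)
    (phi : nuclear H) :
  exists x : H p, incl0 H p x = nuclear_val phi.
Proof. by have /asboolP/(_ p) [x _ <-] := nuclear_valP phi; exists x. Qed.

(* [phi : nuclear H] seen as an element of H_p. *)
Definition nuclear_comp (R : realType) (H : nuclear_triple R) (p : nat)
    (phi : nuclear H) : H p :=
  projT1 (cid (nuclear_compP p phi)).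

Lemma incl0_nuclear_comp (R : realType) (H : nuclear_triple R) (p : nat)
    (phi : nuclear H) : incl0 H p (nuclear_comp p phi) = nuclear_val phi.
Proof. by rewrite /nuclear_comp; case: cid. Qed.

Lemma nuclear_comp_is_linear (R : realType) (H : nuclear_triple R) (p : nat) :
  linear (@nuclear_comp R H p).
Proof.
move=> a x y; apply: (@incl0_inj _ H p).
by rewrite linearP !incl0_nuclear_comp.
Qed.

HB.instance Definition _ (R : realType) (H : nuclear_triple R) (p : nat) :=
  GRing.isLinear.Build R (nuclear H) (H p) _ (@nuclear_comp R H p)
    (@nuclear_comp_is_linear R H p).

(* The projective limit topology on N: the coarsest one making all the
   inclusions of N in H_p continuous. *)
Definition nuclear_comps (R : realType) (H : nuclear_triple R)
  (phi : nuclear H) : prod_topology (hilb H) := fun p => nuclear_comp p phi.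

HB.instance Definition _ (R : realType) (H : nuclear_triple R) :=
  Topological.copy (nuclear H) (initial_topology (@nuclear_comps R H)).

Lemma nuclear_comp_continuous (R : realType) (H : nuclear_triple R) (p : nat) :
  continuous (@nuclear_comp R H p).
Proof.
move=> phi; apply: (@continuous_comp _ _ _ (@nuclear_comps R H)
  (fun g : prod_topology (hilb H) => g p)).
  exact: (@initial_continuous _ _ (@nuclear_comps R H)).
exact: (@proj_continuous nat (hilb H) p).
Qed.

Definition linear_continuous_pred (R : realType) (E : preTopologicalLmodType R) :
    {pred E -> R^o} :=
  fun f => `[< linear f /\ continuous f >].

Arguments linear_continuous_pred {R} E _.

Lemma linear_continuous_submod (R : realType) (E : preTopologicalLmodType R) :
  GRing.submod_closed (linear_continuous_pred E).
Proof.
split.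
  apply/asboolP; split; last exact: cst_continuous.
  by move=> a x y; rewrite /= scaler0 addr0.
move=> a f g /asboolP[fl fc] /asboolP[gl gc]; apply/asboolP; split.
  move=> b x y; rewrite !fctE fl gl !scalerDr !scalerA (mulrC a b).
  by rewrite addrACA.
move=> x; apply: (@continuousD _ _ _ (a \*: f) g); last exact: gc.
by apply: continuousZr; exact: fc.
Qed.

HB.instance Definition _ (R : realType) (E : preTopologicalLmodType R) :=
  GRing.isSubmodClosed.Build R (E -> R^o) (linear_continuous_pred E)
    (linear_continuous_submod E).

Record dual (R : realType) (E : preTopologicalLmodType R) := Dual {
  dual_fun :> E -> R^o ;
  dual_funP : dual_fun \in linear_continuous_pred E }.

HB.instance Definition _ (R : realType) (E : preTopologicalLmodType R) :=
  [isSub for @dual_fun R E].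
HB.instance Definition _ (R : realType) (E : preTopologicalLmodType R) :=
  [Choice of dual E by <:].
HB.instance Definition _ (R : realType) (E : preTopologicalLmodType R) :=
  [SubChoice_isSubLmodule of dual E by <:].
HB.instance Definition _ (R : realType) (E : preTopologicalLmodType R) :=
  isPointed.Build (dual E) 0.

Definition dual_norm (R : realType) (V : normedModType R) (f : dual V) : R :=
  sup [set `|f x| | x in [set x | `|x| <= 1]].

Lemma restr_subproof (R : realType) (H : nuclear_triple R) (p : nat)
    (f : dual (H p)) :
  (f \o @nuclear_comp R H p) \in linear_continuous_pred (nuclear H).
Proof.
have /asboolP[fl fc] := dual_funP f; apply/asboolP; split.
  by move=> a x y; rewrite /= linearP fl.
move=> x; apply: continuous_comp; first exact: nuclear_comp_continuous.
exact: fc.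
Qed.

(* The inclusion of H_{-p} in N': the dual norm turns the topological dual of
   H_p into H_{-p}, and restriction to N identifies it with a subspace of N'. *)
Definition restr (R : realType) (H : nuclear_triple R) (p : nat)
  (f : dual (H p)) : dual (nuclear H) := Dual (restr_subproof f).

Definition locally_convex_topology (R : realType) (V : lmodType R)
    (tau : set_system V) : Prop :=
  exists (T : tvsType R) (h : {linear V -> T}),
    bijective h /\ forall U, tau U <-> open (h @` U).

Definition inclusions_continuous (R : realType) (H : nuclear_triple R)
    (tau : set_system (dual (nuclear H))) : Prop :=
  forall p (f : dual (H p)) U, tau U -> U (restr f) ->
    exists2 e : R, 0 < e &
      forall g : dual (H p), dual_norm (g - f) < e -> U (restr g).

(* [tau] is the family of open sets of the finest locally convex topology on N'
   making all the inclusions of the H_{-p} continuous. *)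
Definition inductive_limit_topology (R : realType) (H : nuclear_triple R)
    (tau : set_system (dual (nuclear H))) : Prop :=
  [/\ locally_convex_topology tau,
      inclusions_continuous tau
    & forall tau', locally_convex_topology tau' ->
        inclusions_continuous tau' -> tau' `<=` tau].

Definition cylinders (R : realType) (H : nuclear_triple R) :
    set_system (dual (nuclear H)) :=
  [set C | exists n (phi : n.-tuple (nuclear H)) (B : set (n.-tuple R)),
     measurable B /\
     C = [set w : dual (nuclear H) | B (map_tuple (dual_fun w) phi)]].

(* N' with its cylinder sigma-algebra; open sets of N' belong to it because each
   H_{-p} is a separable Hilbert space. *)
Definition cylinder_space (R : realType) (H : nuclear_triple R) :=
  g_sigma_algebraType (@cylinders R H).

Definition Gamma (R : realType) (x : R) : R :=
  \int[lebesgue_measure]_(t in `]0, +oo[) (t `^ (x - 1) * expR (- t)).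

(* Restricted to real arguments. *)
Definition mittag_leffler (R : realType) (beta z : R) : R :=
  limn (series (fun n => z ^+ n / Gamma (beta * n%:R + 1))).

Definition expi (R : realType) (t : R) : R[i] := (cos t +i* sin t)%C.

(* [Rintegral] only takes real-valued functions, hence the splitting into real
   and imaginary parts. *)
Definition complex_integral d (T : measurableType d) (R : realType)
    (mu : {measure set T -> \bar R}) (f : T -> R[i]) : R[i] :=
  ((\int[mu]_x complex.Re (f x))%R +i* (\int[mu]_x complex.Im (f x))%R)%C.

Definition mittag_leffler_measure (R : realType) (H : nuclear_triple R)
    (beta : R) (mu : probability (cylinder_space H) R) : Prop :=
  forall phi : nuclear H,
    complex_integral mu (fun w => expi (dual_fun w phi)) =
    (mittag_leffler beta
       (- (2^-1 * dot (nuclear_val phi) (nuclear_val phi))))%:C%C.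

(* Main.v *)
From HB Require Import structures.
From mathcomp Require Import all_boot all_order all_algebra.
From mathcomp Require Import all_classical all_reals all_analysis.
From mathcomp Require Import measurable_realfun complex ring lra zify.
(* Imported last, so that [incl] denotes the inclusions of the triple. *)
Require Import Defs.

(** The measure charges every open set because it is, up to a limit, a mixture
    of Gaussian measures, and a Gaussian measure on the dual of a nuclear space
    charges every Hilbert ball that is centred in its Cameron-Martin space.

    Mixture. For [0 < b < 1], [E_b(-s)] is the Laplace transform of a
    probability law on the half line (Pollard). Only a discrete approximation
    of that law is needed. The rising moments of the number of occupied
    tables in the Chinese restaurant process with discount [b] are explicit.
    After division by [N^b], the moments of this number converge to those that
    the coefficients of [E_b] prescribe, and the Laplace transforms of these
    finitely supported laws converge to [E_b(-s)]
    ([crp_laplace_cvg]). The first two moments also show that these laws keep a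
    fixed mass on a fixed compact interval [[t0, t1]] of the open half line
    ([crp_mass]).

    Smoothing. For vectors [e_1, ..., e_n] and a centre [eta], the integral of
    [exp (- 1/2 sum_k (w e_k - (eta, e_k))^2)] depends on the measure only
    through its characteristic function, as one sees by writing every factor
    as an average of cosines over a normal variable. It is thus a limit of
    mixtures of the same integrals for the centred Gaussian measures with
    covariance [t (., .)]. These are computed exactly, by conditioning on one
    [e_k] at a time, and the part [t0 <= t <= t1] of the mixture yields a lower
    bound [A prod_k (1 + t1 |e_k|^2)^-1] with [0 < A] independent of the [e_k]
    ([smoothed_ge]).

    Balls. Let [e_k] be an orthonormal sequence of [H_(q+1)] obtained by
    Gram-Schmidt from a dense sequence of [N]. As the inclusion in [H_q] is
    Hilbert-Schmidt, [sum_k |e_k|_0^2] is finite ([hilbert_schmidt_bound]).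
    Replace [e_k] by [sqrt s e_k]. The lower bound then decays no faster than a
    power of [s] times [exp (- s r^2 / 4)], whereas the integrand is at most
    [exp (- s r^2 / 2)] outside the set [sum_(k < n) (w e_k - (eta, e_k))^2 <=
    r^2]. Hence for [s] large these sets have measure at least [m > 0], the same
    for all [n] ([ellipsoid_ge]). Their intersection over [n] lies in the ball
    of radius [r] of [H_(-q-1)] centred at [eta], which therefore has positive
    measure ([dual_ball_pos]).

    Open sets. An open [U] contains, around each of its points, a ball of some
    [H_(-q-1)]; since [N] is dense in that space, it also contains a ball with
    its centre in a fixed dense sequence of [N] and with radius [1 / (k + 1)].
    So [U] is a countable union of such balls, which are cylinder-measurable:
    [U] is measurable and contains a set of positive measure. *)

Set Implicit Arguments.
Unset Strict Implicit.
Unset Printing Implicit Defensive.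

Import Order.TTheory GRing.Theory Num.Theory.
Import numFieldNormedType.Exports.

Local Open Scope classical_set_scope.
Local Open Scope ring_scope.

(** * Integrals of real functions *)
Section integrable_EFin.
Context d (T : measurableType d) (R : realType) (mu : {measure set T -> \bar R}).
Variables (D : set T) (mD : measurable D).
Implicit Types f g : T -> R.

Lemma integrable_EFinD f g : mu.-integrable D (EFin \o f) ->
  mu.-integrable D (EFin \o g) ->
  mu.-integrable D (EFin \o (fun t => f t + g t)).
Proof.
move=> fi gi; rewrite (_ : _ \o _ = (EFin \o f) \+ (EFin \o g))%E //.
exact: integrableD.
Qed.

Lemma integrable_EFinZ f c : mu.-integrable D (EFin \o f) ->
  mu.-integrable D (EFin \o (fun t => c * f t)).
Proof.
move=> fi; rewrite (_ : _ \o _ = fun t => (c%:E * (EFin \o f) t)%E) //.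
exact: integrableZl.
Qed.

Lemma integrable_EFinB f g : mu.-integrable D (EFin \o f) ->
  mu.-integrable D (EFin \o g) ->
  mu.-integrable D (EFin \o (fun t => f t - g t)).
Proof.
move=> fi gi; apply: integrable_EFinD => //.
rewrite (_ : (fun t => - g t) = fun t => (-1) * g t).
  exact: integrable_EFinZ.
by apply/funext => t; rewrite mulN1r.
Qed.

Lemma integrable_EFin_sum n (f : 'I_n -> T -> R) :
  (forall i, mu.-integrable D (EFin \o f i)) ->
  mu.-integrable D (EFin \o (fun t => \sum_(i < n) f i t)).
Proof.
elim: n f => [|n ih] f fi.
  rewrite (_ : _ \o _ = cst 0%E); first exact: integrable0.
  by apply/funext => t; rewrite /= big_ord0.
rewrite (_ : _ \o _ = EFin \o (fun t => \sum_(i < n) f (widen_ord (leqnSn n) i) t + f ord_max t)).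
  by apply: integrable_EFinD => //; exact: ih.
by apply/funext => t; rewrite /= big_ord_recr.
Qed.

Lemma Rintegral_sum n (f : 'I_n -> T -> R) :
  (forall i, mu.-integrable D (EFin \o f i)) ->
  \int[mu]_(t in D) (\sum_(i < n) f i t) = \sum_(i < n) \int[mu]_(t in D) f i t.
Proof.
elim: n f => [|n ih] f fi.
  rewrite big_ord0; under eq_Rintegral do rewrite big_ord0.
  by rewrite Rintegral_cst// mul0r.
rewrite big_ord_recr/= -ih//; under eq_Rintegral do rewrite big_ord_recr/=.
by rewrite RintegralD//; exact: integrable_EFin_sum.
Qed.

End integrable_EFin.

(** * The Gamma function and its product formula *)
Section Gamma.
Context {R : realType}.
Implicit Types x t : R.
Notation leb := (@lebesgue_measure R).

Lemma powR_continuous_at x t : 0 < t -> {for t, continuous (fun t => t `^ x)}.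
Proof.
move=> t0; apply: differentiable_continuous; apply/derivable1_diffP.
by apply: derivable_powR; rewrite in_itv/= t0.
Qed.

Lemma powR_continuous_within x b : 0 <= x -> 0 < b ->
  {within `[0, b], continuous (fun t => t `^ x)}.
Proof.
move=> x0 b0; have [->|xN0] := eqVneq x 0.
  rewrite (_ : (fun t => _) = cst 1); last by apply/funext => t; rewrite powRr0.
  by move=> t; exact: cvg_cst.
have xp : 0 < x by rewrite lt_neqAle eq_sym xN0.
have c := @powR_continuous_at x.
apply/continuous_within_itvP => //; split.
- by move=> t; rewrite in_itv/= => /andP[t0 _]; exact: c.
- by rewrite powR0//; exact: powR_cvg0.
- by apply: cvg_at_left_filter; exact: c.
Qed.

Lemma within_continuousM (D : set R) (f g : R -> R) :
  {within D, continuous f} -> {within D, continuous g} ->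
  {within D, continuous (fun t => f t * g t)}.
Proof.
move=> /subspace_continuousP cf /subspace_continuousP cg.
by apply/subspace_continuousP => t Dt; apply: cvgM; [exact: cf|exact: cg].
Qed.

Definition Gamma_integrand x t := t `^ x * expR (- t).

Lemma measurable_Gamma_integrand x (D : set R) :
  measurable_fun D (Gamma_integrand x).
Proof.
apply: measurable_funTS.
apply: measurable_funM; first exact: measurable_powR.
by apply: measurableT_comp => //; exact: measurable_oppr.
Qed.

Lemma Gamma_integrand_ge0 x t : 0 <= Gamma_integrand x t.
Proof. by rewrite mulr_ge0 ?powR_ge0 ?expR_ge0. Qed.

(** Gamma at [x + 1] as an extended real, so that the recurrence can be proved
    before finiteness is known. *)
Definition eGamma x := (\int[leb]_(t in `[0%R, +oo[) (Gamma_integrand x t)%:E)%E.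

Lemma eGamma_cvg x : (\int[leb]_(t in `[0%R, n%:R]) (Gamma_integrand x t)%:E
   @[n --> \oo] --> eGamma x)%E.
Proof.
apply: (@ge0_cvgn_integral _ leb (Gamma_integrand x)).
  exact: Gamma_integrand_ge0.
exact: measurable_Gamma_integrand.
Qed.

Lemma powR_expRN_cvg0 x : (n%:R `^ x * expR (- n%:R : R)) @[n --> \oo] --> (0 : R).
Proof.
have [m xm] : exists m : nat, x <= m%:R.
  by exists (Num.truncn `|x|).+1; rewrite (le_trans (ler_norm _))// ltW// truncnS_gt.
apply: (@squeeze_cvgr _ _ _ _ (fun=> 0) (fun n => (m.+1)`!%:R / n%:R)).
- near=> n; have n1 : (0 < n)%N by near: n; exact: nbhs_infty_gt.
  rewrite mulr_ge0 ?powR_ge0 ?expR_ge0//=.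
  rewrite ler_pdivlMr ?ltr0n// mulrAC expRN ler_pdivrMr ?expR_gt0//.
  apply: (@le_trans _ _ (n%:R ^+ m.+1)).
    rewrite exprSr ler_wpM2r// -powR_mulrn//.
    by apply: ler_powR => //; rewrite ler1n.
  have := @expR_ge1Dxn R n%:R m (ler0n _ _).
  rewrite -ler_pdivrMl ?ltr0n ?fact_gt0// mulrC.
  by apply: le_trans; rewrite lerDr.
- exact: cvg_cst.
- rewrite -[X in _ --> X](mulr0 (m.+1)`!%:R); apply: cvgMr.
  by rewrite -cvg_shiftS; exact: cvg_harmonic.
Unshelve. all: by end_near. Qed.

(** Integration by parts on [[0, n + 1]]; the boundary term disappears in the
    limit. *)
Lemma eGamma_itv_rec x n : 0 <= x ->
  (\int[leb]_(t in `[0%R, n.+1%:R]) (Gamma_integrand (x + 1) t)%:E =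
   (- (n.+1%:R `^ (x + 1) * expR (- n.+1%:R)))%:E +
   (x + 1)%:E * \int[leb]_(t in `[0%R, n.+1%:R]) (Gamma_integrand x t)%:E)%E.
Proof.
move=> x0; have n0 : (0 : R) < n.+1%:R by rewrite ltr0n.
have x1 : 0 < x + 1 by rewrite ltr_wpDl.
pose F t : R := t `^ (x + 1).
pose f t : R := (x + 1) * t `^ x.
pose G t : R := - expR (- t).
pose g t : R := expR (- t).
have cexpN : continuous (fun t : R => expR (- t)).
  by move=> t; apply: continuous_comp; [exact: opp_continuous|exact: continuous_expR].
have cpow := powR_continuous_within x0 n0.
have := @integration_by_parts R F G f g 0 n.+1%:R n0.
rewrite /F /f /G /g powR0 ?gt_eqF// mul0r subr0 => ibp.
have cwexp : {within `[0, n.+1%:R], continuous (fun t : R => expR (- t))}.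
  exact: continuous_subspaceT.
rewrite [LHS]ibp.
- rewrite mulrN; congr (_ + _)%E.
  under eq_integral do rewrite mulrN -mulrA -mulNr EFinM.
  rewrite integralZl//=; first by rewrite EFinN mulNe oppeK.
  apply: continuous_compact_integrable; first exact: segment_compact.
  exact: within_continuousM.
- by apply: within_continuousM => //; apply: continuous_subspaceT; exact: cst_continuous.
- split.
  + by move=> t; rewrite in_itv/= => /andP[t0 _]; apply: derivable_powR; rewrite in_itv/= t0.
  + by rewrite powR0 ?gt_eqF//; exact: powR_cvg0.
  + by apply: cvg_at_left_filter; exact: powR_continuous_at.
- move=> t; rewrite in_itv/= => /andP[t0 _]; rewrite powR_derive1 ?in_itv/= ?t0//.
  by rewrite addrK.
- exact: cwexp.
- split.
  + by move=> t _; exact: ex_derive.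
  + by apply: cvgN; apply: cvg_at_right_filter; exact: cexpN.
  + by apply: cvgN; apply: cvg_at_left_filter; exact: cexpN.
- move=> t _; rewrite derive1E derive_val.
  by rewrite mulrN1 opprK.
Qed.

Lemma eGammaS x : 0 <= x -> eGamma (x + 1) = ((x + 1)%:E * eGamma x)%E.
Proof.
move=> x0; have := @eGamma_cvg (x + 1); rewrite -cvg_shiftS.
under eq_fun do rewrite eGamma_itv_rec//.
move=> /cvg_lim <-//; apply/cvg_lim => //.
rewrite -[X in _ --> X]add0e; apply: cvgeD.
- rewrite ge0_adde_def// inE// mule_ge0 ?lee_fin ?addr_ge0//.
  by apply: integral_ge0 => t _; rewrite lee_fin Gamma_integrand_ge0.
- apply: cvg_EFin; first exact: nearW.
  rewrite -oppr0; apply: cvgN; have := powR_expRN_cvg0 (x + 1).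
  by rewrite -cvg_shiftS.
- apply: cvgeZl => //; have := @eGamma_cvg x; by rewrite -cvg_shiftS.
Qed.

Lemma eGamma0 : eGamma 0 = 1%E.
Proof.
rewrite /eGamma /Gamma_integrand; under eq_integral do rewrite powRr0 mul1r.
rewrite (@ge0_continuous_FTC2y _ _ (fun t => - expR (- t)) 0 0).
- by rewrite oppr0 expR0 sub0e EFinN oppeK.
- by move=> t _; exact: expR_ge0.
- apply: continuous_subspaceT => t.
  by apply: continuous_comp; [exact: opp_continuous|exact: continuous_expR].
- by rewrite -oppr0; apply: cvgN; exact: cvgr_expR.
- by move=> t _; exact: ex_derive.
- apply: cvgN; apply: cvg_at_right_filter.
  by apply: continuous_comp; [exact: opp_continuous|exact: continuous_expR].
- move=> t _; rewrite derive1E derive_val.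
  by rewrite mulrN1 opprK.
Qed.

Lemma eGamma_ge0 x : (0 <= eGamma x)%E.
Proof. by apply: integral_ge0 => t _; rewrite lee_fin Gamma_integrand_ge0. Qed.

(** For [0 <= y <= 1] the integrand is at most the sum of those of [y = 0] and
    [y = 1], whose integrals are known; the recurrence does the rest. *)
Lemma eGamma_fin_num x : 0 <= x -> eGamma x \is a fin_num.
Proof.
suff H n y : 0 <= y -> y <= 1 -> eGamma (y + n%:R) \is a fin_num.
  move=> x0; have /andP[xn xn1] := truncn_itv x0.
  have := H (Num.truncn x) (x - (Num.truncn x)%:R).
  rewrite subrK; apply; first by rewrite subr_ge0.
  by rewrite lerBlDl natr1 ltW.
move=> y0 y1; elim: n => [|n ih]; last first.
  rewrite -natr1 addrA eGammaS ?addr_ge0//.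
  by rewrite fin_numM.
rewrite addr0 ge0_fin_numE ?eGamma_ge0//.
apply: (@le_lt_trans _ _ (eGamma 0 + eGamma (0 + 1))%E); last first.
  by rewrite eGammaS// eGamma0 add0r mule1 -EFinD ltry.
rewrite /eGamma -ge0_integralD//=.
- apply: ge0_le_integral => //=.
  + by move=> t _; rewrite lee_fin Gamma_integrand_ge0.
  + by apply/measurable_EFinP; exact: measurable_Gamma_integrand.
  + by apply: emeasurable_funD; apply/measurable_EFinP; exact: measurable_Gamma_integrand.
  + move=> t; rewrite in_itv/= andbT => t0; rewrite -EFinD lee_fin.
    rewrite /Gamma_integrand -mulrDl ler_wpM2r ?expR_ge0// powRr0 add0r powRr1//.
    have [t1|t1] := leP t 1.
      rewrite (@le_trans _ _ 1) ?lerDl//.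
      rewrite (_ : 1 = 1 `^ y); first by rewrite ge0_ler_powR ?nnegrE.
      by rewrite powR1.
    by rewrite (le_trans (ler1_powR _ _))// ?lerDr// ltW.
- by move=> t _; rewrite lee_fin Gamma_integrand_ge0.
- by apply/measurable_EFinP; exact: measurable_Gamma_integrand.
- by move=> t _; rewrite lee_fin Gamma_integrand_ge0.
- by apply/measurable_EFinP; exact: measurable_Gamma_integrand.
Qed.

Lemma GammaE x : Gamma (x + 1) = fine (eGamma x).
Proof.
rewrite /Gamma addrK /eGamma /Rintegral integral_itv_obnd_cbnd//.
by apply/measurable_EFinP; exact: measurable_Gamma_integrand.
Qed.

Lemma EFin_Gamma x : 0 <= x -> (Gamma (x + 1))%:E = eGamma x.
Proof. by move=> x0; rewrite GammaE fineK// eGamma_fin_num. Qed.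

Lemma GammaS x : 0 <= x -> Gamma (x + 1 + 1) = (x + 1) * Gamma (x + 1).
Proof.
move=> x0; apply: EFin_inj.
by rewrite EFinM !EFin_Gamma ?addr_ge0// eGammaS.
Qed.

Lemma integrable_Gamma_integrand x : 0 <= x ->
  leb.-integrable `[0, +oo[ (EFin \o Gamma_integrand x).
Proof.
move=> x0; apply/integrableP; split.
  by apply/measurable_EFinP; exact: measurable_Gamma_integrand.
under eq_integral do rewrite /= ger0_norm ?Gamma_integrand_ge0//.
by rewrite ltey_eq (eGamma_fin_num x0).
Qed.

Lemma Gamma_Rintegral x :
  Gamma (x + 1) = \int[leb]_(t in `[0, +oo[) Gamma_integrand x t.
Proof. by rewrite GammaE. Qed.

Lemma Gamma1 : Gamma (0 + 1 : R) = 1.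
Proof. by rewrite GammaE eGamma0. Qed.

(** Euler's formula says that it is equivalent to
    [N `^ x / Gamma (x + 1)]. *)
Definition rising_ratio x N : R := \prod_(i < N) (1 + x / i.+1%:R).

Lemma rising_ratio_recr x N :
  rising_ratio x N.+1 = rising_ratio x N * (1 + x / N.+1%:R).
Proof. by rewrite /rising_ratio big_ord_recr. Qed.

Lemma Gamma_rising_ratio x N : 0 <= x ->
  Gamma (x + N%:R + 1) = N`!%:R * rising_ratio x N * Gamma (x + 1).
Proof.
move=> x0; elim: N => [|N ih].
  by rewrite addr0 /rising_ratio big_ord0 fact0 !mul1r.
have -> : x + N.+1%:R = x + N%:R + 1 by rewrite -natr1 addrA.
rewrite GammaS; last exact: addr_ge0.
rewrite ih rising_ratio_recr factS natrM.
have N0 : N.+1%:R != 0 :> R by rewrite pnatr_eq0.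
have -> : x + N%:R + 1 = N.+1%:R * (1 + x / N.+1%:R).
  by rewrite mulrDr mulr1 mulrCA divff// mulr1 -addrA natr1 addrC.
move: (1 + _) => u; move: N.+1%:R => v; ring.
Qed.

Lemma Gamma_nat N : Gamma (N%:R + 1 : R) = N`!%:R.
Proof.
have := @Gamma_rising_ratio 0 N (lexx _); rewrite add0r Gamma1 mulr1 => ->.
by rewrite /rising_ratio big1 ?mulr1// => i _; rewrite mul0r addr0.
Qed.

(** Weighted arithmetic-geometric mean of [t] and [1]. With [powR_ge_affine]
    it compares [t `^ (N + x)] to combinations of integral powers of [t],
    whose Gamma integrals are factorials. *)
Lemma powR_le_affine x t : 0 <= x <= 1 -> 0 <= t -> t `^ x <= 1 - x + x * t.
Proof.
move=> /andP[]; rewrite le_eqVlt => /predU1P[<- _ t0|x0].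
  by rewrite powRr0 mul0r addr0 subr0.
rewrite le_eqVlt => /predU1P[-> t0|x1 t0]; first by rewrite powRr1// mul1r subrr add0r.
have := @conjugate_powR R (t `^ x) 1 x^-1 (1 - x)^-1 (powR_ge0 _ _) ler01.
rewrite !invr_gt0 subr_gt0 x0 x1 !invrK addrC subrK => /(_ isT isT erefl).
rewrite mulr1 powR1 mul1r -powRrM mulfV ?gt_eqF// powRr1//.
by rewrite addrC mulrC.
Qed.

Lemma powR_ge_affine x t : 0 <= x <= 1 -> 0 < t ->
  1 - (1 - x) * (t - 1) <= t `^ (x - 1).
Proof.
move=> /andP[x0 x1] t0.
rewrite /powR gt_eqF//; apply: le_trans (expR_ge1Dx _).
rewrite lerD2l -mulNr opprB.
rewrite ler_wnM2l ?subr_le0//.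
have := @le_ln1Dx R (t - 1); rewrite addrCA subrr addr0; apply.
by rewrite ltrBrDl subrr.
Qed.

Lemma integrable_Gamma_integrandZ x c : 0 <= x ->
  leb.-integrable `[0, +oo[ (EFin \o (fun t => c * Gamma_integrand x t)).
Proof.
move=> x0; rewrite (_ : _ \o _ = fun t => (c%:E * (EFin \o Gamma_integrand x) t)%E).
  by apply: integrableZl => //; exact: integrable_Gamma_integrand.
by apply/funext => t; rewrite /= EFinM.
Qed.

Lemma Gamma_integrand_natD_le x N t : 0 <= x <= 1 -> (0 < N)%N -> 0 <= t ->
  Gamma_integrand (x + N%:R) t <=
    N%:R `^ x * (1 - x) * Gamma_integrand N%:R t +
    N%:R `^ x * (x / N%:R) * Gamma_integrand N.+1%:R t.
Proof.
move=> /[dup] x01 /andP[x0 x1] N0 t0; have N0' : 0 < N%:R :> R by rewrite ltr0n.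
rewrite /Gamma_integrand !mulrA -mulrDl ler_wpM2r ?expR_ge0//.
rewrite powRD; last by rewrite gt_eqF// ltr_wpDl.
rewrite !powR_mulrn// exprS !mulrA -mulrDl ler_wpM2r ?exprn_ge0//.
have {1}-> : t = N%:R * (t / N%:R) by rewrite mulrCA divff ?mulr1 ?gt_eqF.
rewrite powRM ?(ltW N0')// ?divr_ge0//.
apply: (@le_trans _ _ (N%:R `^ x * (1 - x + x * (t / N%:R)))).
  by rewrite ler_wpM2l ?powR_ge0// powR_le_affine// divr_ge0.
by rewrite le_eqVlt; apply/orP; left; apply/eqP; ring.
Qed.

Lemma Gamma_integrand_natD_ge x N t : 0 <= x <= 1 -> (0 < N)%N -> 0 <= t ->
  N%:R `^ (x - 1) * (2 - x) * Gamma_integrand N.+1%:R t -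
  N%:R `^ (x - 1) * ((1 - x) / N%:R) * Gamma_integrand N.+2%:R t <=
  Gamma_integrand (x + N%:R) t.
Proof.
move=> /[dup] x01 /andP[x0 x1] N0 t0; have N0' : 0 < N%:R :> R by rewrite ltr0n.
rewrite /Gamma_integrand !mulrA -mulrBl ler_wpM2r ?expR_ge0//.
move: t0; rewrite le_eqVlt => /predU1P[<-|t0].
  by rewrite !powR0 ?gt_eqF ?mulr0 ?subr0// ltr_wpDl.
rewrite [t `^ (x + _)]powRD; last by rewrite (gt_eqF t0) implybT.
rewrite !powR_mulrn ?(ltW t0)//.
rewrite -[x in leRHS](addrNK 1) [in leRHS]powRD; last by rewrite (gt_eqF t0) implybT.
rewrite powRr1 ?(ltW t0)//.
apply: (@le_trans _ _ (N%:R `^ (x - 1) * (1 - (1 - x) * (t / N%:R - 1)) * t ^+ N.+1)).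
  rewrite le_eqVlt; apply/orP; left; apply/eqP.
  rewrite [t ^+ N.+2]exprS; field; exact: lt0r_neq0.
rewrite -(mulrA (t `^ _)) -exprS ler_wpM2r ?exprn_ge0 ?(ltW t0)//.
have -> : t `^ (x - 1) = N%:R `^ (x - 1) * (t / N%:R) `^ (x - 1).
  rewrite -powRM ?(ltW N0') ?divr_ge0 ?(ltW t0) ?(ltW N0')//.
  by rewrite mulrCA divff ?mulr1 ?gt_eqF.
by rewrite ler_wpM2l ?powR_ge0// powR_ge_affine// divr_gt0.
Qed.

Lemma Gamma_natD_le x N : 0 <= x <= 1 -> (0 < N)%N ->
  Gamma (x + N%:R + 1) <= N%:R `^ x * N`!%:R * (1 + 1 / N%:R).
Proof.
move=> /[dup] x01 /andP[x0 x1] N0; have N0' : 0 < N%:R :> R by rewrite ltr0n.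
apply: (@le_trans _ _ (N%:R `^ x * (1 - x) * Gamma (N%:R + 1) +
    N%:R `^ x * (x / N%:R) * Gamma (N.+1%:R + 1))).
  rewrite !Gamma_Rintegral -!RintegralZl//; try exact: integrable_Gamma_integrand.
  rewrite -RintegralD//; try exact: integrable_Gamma_integrandZ.
  apply: le_Rintegral => //.
  - by apply: integrable_Gamma_integrand; rewrite addr_ge0.
  - by apply: integrable_EFinD => //; exact: integrable_Gamma_integrandZ.
  move=> t /=; rewrite in_itv/= andbT => t0.
  exact: Gamma_integrand_natD_le.
rewrite !Gamma_nat factS natrM -natr1.
rewrite (_ : _ + _ = N%:R `^ x * N`!%:R * (1 + x / N%:R)); last first.
  by field; rewrite gt_eqF.
rewrite ler_wpM2l ?mulr_ge0 ?powR_ge0// lerD2l ler_wpM2r// invr_ge0 ltW//.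
Qed.

(** [Gamma_natD_le] and [Gamma_natD_ge] are Gautschi's bounds in a weak form:
    [Gamma (N + x + 1)] is equivalent to [N^x N!]. *)
Lemma Gamma_natD_ge x N : 0 <= x <= 1 -> (1 < N)%N ->
  N%:R `^ x * N`!%:R * (1 - 2 / N%:R) <= Gamma (x + N%:R + 1).
Proof.
move=> /[dup] x01 /andP[x0 x1] N1; have N0' : 0 < N%:R :> R by rewrite ltr0n ltnW.
have N2 : 2 <= N%:R :> R by rewrite ler_nat.
apply: (@le_trans _ _ (N%:R `^ (x - 1) * (2 - x) * Gamma (N.+1%:R + 1) -
    N%:R `^ (x - 1) * ((1 - x) / N%:R) * Gamma (N.+2%:R + 1))); last first.
  rewrite !Gamma_Rintegral -!RintegralZl//; try exact: integrable_Gamma_integrand.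
  rewrite -RintegralB//; try exact: integrable_Gamma_integrandZ.
  apply: le_Rintegral => //.
  - by apply: integrable_EFinB => //; exact: integrable_Gamma_integrandZ.
  - by apply: integrable_Gamma_integrand; rewrite addr_ge0.
  move=> t /=; rewrite in_itv/= andbT => t0.
  by apply: Gamma_integrand_natD_ge => //; exact: ltnW.
rewrite powRB; last by rewrite (gt_eqF N0') implybT.
rewrite powRr1 ?(ltW N0')// !Gamma_nat !factS !natrM -(natr1 N.+1) -(natr1 N).
have -> : N%:R `^ x / N%:R * (2 - x) * ((N%:R + 1) * N`!%:R) -
    N%:R `^ x / N%:R * ((1 - x) / N%:R) * ((N%:R + 1 + 1) * ((N%:R + 1) * N`!%:R)) =
    N%:R `^ x * N`!%:R * ((1 + N%:R^-1) * (1 - 2 * (1 - x) / N%:R)).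
  field; exact: lt0r_neq0.
rewrite ler_wpM2l ?mulr_ge0 ?powR_ge0//.
apply: (@le_trans _ _ (1 - 2 * (1 - x) / N%:R)).
  rewrite lerD2l lerN2 ler_wpM2r ?invr_ge0 ?(ltW N0')//; nra.
rewrite ler_peMl ?lerDl ?invr_ge0 ?(ltW N0')//.
rewrite subr_ge0 ler_pdivrMr// mul1r; nra.
Qed.

(** The lower bound [Gamma_natD_ge] is positive for the shift [3], and the
    recurrence brings it back to [x]. *)
Lemma Gamma_gt0 x : 0 <= x -> 0 < Gamma (x + 1).
Proof.
move=> x0.
have G3 (y : R) : 0 <= y <= 1 -> 0 < Gamma (y + 1).
  move=> /[dup] y01 /andP[y0 _].
  have := @Gamma_natD_ge y 3 y01 isT; rewrite Gamma_rising_ratio// => h.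
  have : 0 < 3%:R `^ y * 3`!%:R * (1 - 2 / 3%:R) :> R.
    by rewrite !mulr_gt0 ?powR_gt0// subr_gt0 ltr_pdivrMr// mul1r ltr_nat.
  move=> /lt_le_trans/(_ h); rewrite pmulr_rgt0// mulr_gt0//.
  by apply: prodr_gt0 => i _; rewrite ltr_pwDl// divr_ge0.
have [n xn] : exists n : nat, 0 <= x - n%:R <= 1.
  have /andP[xn xn1] := truncn_itv x0; exists (Num.truncn x).
  by rewrite subr_ge0 xn/= lerBlDl natr1 ltW.
rewrite -(subrK n%:R x) Gamma_rising_ratio; last by case/andP: xn.
rewrite mulr_gt0 ?G3// mulr_gt0// ?ltr0n ?fact_gt0//.
apply: prodr_gt0 => i _; rewrite ltr_pwDl// divr_ge0//.
by case/andP: xn.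
Qed.

Lemma rising_ratioS x N : 0 <= x ->
  rising_ratio (x + 1) N = rising_ratio x N * (x + 1 + N%:R) / (x + 1).
Proof.
move=> x0; have x1 : x + 1 != 0 by rewrite gt_eqF// ltr_wpDl.
elim: N => [|N ih]; first by rewrite /rising_ratio !big_ord0 mul1r addr0 divff.
rewrite !rising_ratio_recr ih.
have N0 : N.+1%:R != 0 :> R by rewrite pnatr_eq0.
rewrite -[N.+1%:R in X in _ = X]natr1; rewrite -natr1 in N0 *; field.
by rewrite x1 N0.
Qed.

(** Euler's product formula. For [0 <= x <= 1] it is the equivalence
    [Gamma (N + x + 1) ~ N^x N!]; the general case follows by adding integers. *)
Lemma rising_ratio_cvg x : 0 <= x ->
  rising_ratio x N / N%:R `^ x @[N --> \oo] --> (Gamma (x + 1))^-1.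
Proof.
suff H n y : 0 <= y <= 1 ->
    rising_ratio (y + n%:R) N / N%:R `^ (y + n%:R) @[N --> \oo] --> (Gamma (y + n%:R + 1))^-1.
  move=> x0; have /andP[xn xn1] := truncn_itv x0.
  have := H (Num.truncn x) (x - (Num.truncn x)%:R).
  rewrite subrK; apply.
  by rewrite subr_ge0 xn/= lerBlDl natr1 ltW.
have cinv c : 1 + c / N%:R @[N --> \oo] --> (1 : R).
  rewrite -[X in _ --> X]addr0; apply: cvgD; first exact: cvg_cst.
  rewrite -[X in _ --> X](mulr0 c); apply: cvgMr.
  by rewrite -cvg_shiftS; exact: cvg_harmonic.
move=> /[dup] y01 /andP[y0 y1]; elim: n => [|n ih].
  rewrite addr0; have G0 := Gamma_gt0 y0.
  apply: (@squeeze_cvgr _ _ _ _ (fun N => (1 + (- 2) / N%:R) / Gamma (y + 1))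
       (fun N => (1 + 1 / N%:R) / Gamma (y + 1))).
  - near=> N; have N1 : (1 < N)%N by near: N; exact: nbhs_infty_gt.
    have NN0 : 0 < N%:R `^ y * N`!%:R.
      by rewrite mulr_gt0 ?powR_gt0 ?ltr0n ?fact_gt0 ?(ltnW N1).
    have e : rising_ratio y N / N%:R `^ y =
        Gamma (y + N%:R + 1) / (N%:R `^ y * N`!%:R) / Gamma (y + 1).
      rewrite Gamma_rising_ratio//; field.
      by rewrite !gt_eqF//= ?powR_gt0 ?ltr0n ?fact_gt0 ?(ltnW N1).
    rewrite e !ler_pM2r ?invr_gt0// ler_pdivlMr// ler_pdivrMr// mulrC.
    by rewrite mulNr Gamma_natD_ge//= mulrC Gamma_natD_le// ltnW.
  - rewrite -[X in _ --> X]mul1r; exact: cvgMl.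
  - rewrite -[X in _ --> X]mul1r; exact: cvgMl.
rewrite -natr1 addrA GammaS ?addr_ge0//.
have z0 : 0 <= y + n%:R by rewrite addr_ge0.
move: ih; set z := y + n%:R in z0 *; move=> ih.
have z1 : 0 < z + 1 by rewrite ltr_wpDl.
rewrite invfM -[X in X / _]mul1r.
have h : (1 + (z + 1) / N%:R) * (z + 1)^-1 * (rising_ratio z N / N%:R `^ z) @[N --> \oo]
    --> 1 * (z + 1)^-1 * (Gamma (z + 1))^-1.
  by apply: cvgM ih; apply: cvgM; [exact: cinv|exact: cvg_cst].
apply: cvg_trans h; apply: near_eq_cvg; near=> N.
have N0 : (0 < N)%N by near: N; exact: nbhs_infty_gt.
rewrite /= rising_ratioS// (@powRD _ _ z 1) ?powRr1//; last first.
  by rewrite pnatr_eq0 -lt0n N0 implybT.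
field.
rewrite !gt_eqF ?powR_gt0 ?ltr0n//.
Unshelve. all: by end_near. Qed.

End Gamma.

(** * Tannery's theorem *)
Section series.
Context {R : realType}.
Implicit Types (u v : R^nat) (w : nat -> R^nat) (C q : R).

Lemma cvg_sum (I : Type) (r : seq I) (P : pred I) (f : I -> R^nat) (l : I -> R) :
  (forall i, P i -> f i @ \oo --> l i) ->
  \sum_(i <- r | P i) f i n @[n --> \oo] --> \sum_(i <- r | P i) l i.
Proof.
move=> fl; elim: r => [|i r ih].
  by rewrite big_nil; under eq_fun do rewrite big_nil; exact: cvg_cst.
rewrite big_cons; under eq_fun do rewrite big_cons.
case: ifPn => // Pi; apply: cvgD => //; exact: fl.
Qed.

Lemma series_geometric_tail u C q K n : 0 <= q < 1 ->
  (forall k, `|u k| <= C * q ^+ k) -> (K <= n)%N ->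
  `|series u n - series u K| <= C * q ^+ K / (1 - q).
Proof.
move=> /andP[q0 q1] uCq Kn; rewrite sub_series_geq//.
have q1' : 0 < 1 - q by rewrite subr_gt0.
apply: le_trans (ler_norm_sum _ _ _) _.
suff : \sum_(K <= k < n) C * q ^+ k <= C * q ^+ K / (1 - q).
  by apply: le_trans; apply: ler_sum => k _; exact: uCq.
have C0 : 0 <= C by have := uCq 0%N; rewrite expr0 mulr1; exact: le_trans.
rewrite -mulr_sumr -mulrA ler_wpM2l// ler_pdivlMr//.
rewrite mulr_suml -[n](subnK Kn) addnC.
elim: (n - K)%N => [|m ih]; first by rewrite addn0 big_geq// exprn_ge0.
suff : \sum_(K <= i < K + m) q ^+ i * (1 - q) = q ^+ K - q ^+ (K + m).
  move=> e; rewrite addnS big_nat_recr ?leq_addr//= e.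
  rewrite -subr_ge0 mulrBr mulr1 -exprSr.
  rewrite (_ : _ - _ = q ^+ (K + m).+1); first exact: exprn_ge0.
  by ring.
elim: m {ih} => [|m ih]; first by rewrite addn0 big_geq// subrr.
rewrite addnS big_nat_recr ?leq_addr//= ih exprS; ring.
Qed.

Lemma series_geometric_tail_lim u l C q K : 0 <= q < 1 ->
  (forall k, `|u k| <= C * q ^+ k) -> series u @ \oo --> l ->
  `|l - series u K| <= C * q ^+ K / (1 - q).
Proof.
move=> q01 uCq ul.
have h : `|series u n - series u K| @[n --> \oo] --> `|l - series u K|.
  by apply: cvg_norm; apply: cvgB => //; exact: cvg_cst.
rewrite -(cvg_lim _ h)//; apply: limr_le; first by apply/cvg_ex; eexists; exact: h.
near=> n; apply: series_geometric_tail => //.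
by near: n; exact: nbhs_infty_ge.
Unshelve. all: by end_near. Qed.

Lemma is_cvg_series_geometric_bound u C q : 0 <= q < 1 ->
  (forall k, `|u k| <= C * q ^+ k) -> cvgn (series u).
Proof.
move=> /andP[q0 q1] uCq; apply: normed_cvg.
apply: (series_le_cvg (v_ := fun k => C * q ^+ k)) => //.
- by move=> k; rewrite normr_ge0.
- by move=> k; exact: le_trans (uCq k).
- by apply: is_cvg_geometric_series; rewrite ger0_norm.
Qed.

(** Dominated convergence for series, with a geometric domination that has to
    hold only for large [N]. *)
Lemma tannery w v (U : R^nat) C q : 0 <= q < 1 ->
  (forall k, w ^~ k @ \oo --> v k) ->
  (\forall N \near \oo, forall k, `|w N k| <= C * q ^+ k) ->
  (forall N, series (w N) @ \oo --> U N) ->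
  U @ \oo --> limn (series v).
Proof.
move=> /[dup] q01 /andP[q0 q1] wv wCq wU.
have q1' : 0 < 1 - q by rewrite subr_gt0.
have vCq k : `|v k| <= C * q ^+ k.
  have h : `|w N k| @[N --> \oo] --> `|v k| by apply: cvg_norm.
  rewrite -(cvg_lim _ h)//; apply: limr_le; first by apply/cvg_ex; eexists; exact: h.
  by near=> N; have := near wCq N; apply.
have vl : series v @ \oo --> limn (series v).
  exact: is_cvg_series_geometric_bound vCq.
apply/cvgrPdist_le => e e0.
have [K Ke] : exists K, C * q ^+ K / (1 - q) <= e / 3.
  have h : C * q ^+ K / (1 - q) @[K --> \oo] --> (0 : R).
    rewrite -[X in _ --> X](mul0r (1 - q)^-1); apply: cvgMl.
    rewrite -[X in _ --> X](mulr0 C); apply: cvgMr.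
    by apply: cvg_expr; rewrite ger0_norm.
  have /cvgrPdist_le/(_ (e / 3)) := h.
  have e3 : 0 < e / 3 by rewrite divr_gt0.
  move=> /(_ e3)[K _ /(_ K (leqnn _))]; rewrite sub0r normrN => hK.
  by exists K; apply: le_trans (ler_norm _) hK.
have sK : series (w N) K @[N --> \oo] --> series v K.
  rewrite /series/=; apply: cvg_sum => k _; exact: wv.
near=> N.
have h1 := series_geometric_tail_lim K q01 vCq vl.
have h2 : `|U N - series (w N) K| <= C * q ^+ K / (1 - q).
  by apply: series_geometric_tail_lim (wU N) => //; near: N.
have h3 : `|series v K - series (w N) K| <= e / 3.
  by near: N; move/cvgrPdist_le : sK; apply; rewrite divr_gt0.
rewrite (_ : _ - _ = (limn (series v) - series v K) + (series v K - series (w N) K)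
   - (U N - series (w N) K)); last by ring.
rewrite (le_trans (ler_normB _ _))// (le_trans (lerD (ler_normD _ _) (lexx _)))//.
rewrite (_ : e = e / 3 + e / 3 + e / 3); last by field.
by rewrite !lerD// (le_trans _ Ke).
Unshelve. all: by end_near. Qed.

End series.

(** * The Chinese restaurant process and the Mittag-Leffler function *)
Section Chinese_restaurant.
Context {R : realType} (b : R).
Hypotheses (b0 : 0 < b) (b1 : b < 1).
Implicit Types (g : nat -> R) (N j k : nat) (s : R).

(** The law of the number of occupied tables when [N + 1] customers are seated
    in the Chinese restaurant process with discount [b] and strength [0]: with
    [j] tables taken, the customer who finds [N] others opens a new one with
    probability [b j / N]. *)
Fixpoint crp N j : R :=
  if N is N'.+1 then
    crp N' j * (1 - b * j%:R / N%:R) + crp N' j.-1 * (b * j.-1%:R / N%:R)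
  else (j == 1)%:R.

Definition crpE N g := \sum_(j < N.+2) crp N j * g j.

Lemma crp_out N j : (N.+1 < j)%N -> crp N j = 0.
Proof.
elim: N j => [|N ih] [|[|j]]//= Nj.
by rewrite ih ?mul0r ?add0r ?ih ?mul0r// ltnW.
Qed.

Lemma crp_ge0 N j : 0 <= crp N j.
Proof.
elim: N j => [|N ih] j //=.
rewrite addr_ge0//; last by rewrite mulr_ge0// divr_ge0// mulr_ge0// ltW.
have [jN|jN] := leqP j N.+1; last by rewrite crp_out// mul0r.
rewrite mulr_ge0// subr_ge0 ler_pdivrMr ?ltr0n// mul1r.
rewrite (@le_trans _ _ (1 * j%:R))// ?ler_wpM2r ?(ltW b1)// mul1r.
by rewrite ler_nat.
Qed.

Lemma crpE0 g : crpE 0 g = g 1%N.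
Proof. by rewrite /crpE !big_ord_recl big_ord0/= mul0r add0r mul1r addr0. Qed.

Lemma crpES N g : crpE N.+1 g =
  crpE N (fun j => (1 - b * j%:R / N.+1%:R) * g j + b * j%:R / N.+1%:R * g j.+1).
Proof.
rewrite /crpE/=.
under eq_bigr do rewrite mulrDl.
under [RHS]eq_bigr do rewrite mulrDr !mulrA.
rewrite !big_split/=; congr (_ + _).
  by rewrite big_ord_recr/= crp_out// !mul0r addr0.
rewrite big_ord_recl/= mulr0 mul0r mulr0 mul0r add0r.
by apply: eq_bigr => j _; rewrite /bump/= add1n !mulrA.
Qed.

Lemma crpE_le N g h : (forall j, g j <= h j) -> crpE N g <= crpE N h.
Proof. by move=> gh; apply: ler_sum => j _; rewrite ler_wpM2l// crp_ge0. Qed.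

Lemma crpE_ge0 N g : (forall j, 0 <= g j) -> 0 <= crpE N g.
Proof. by move=> g0; apply: sumr_ge0 => j _; rewrite mulr_ge0// crp_ge0. Qed.

Lemma crpEZ N c g : crpE N (fun j => c * g j) = c * crpE N g.
Proof. by rewrite /crpE mulr_sumr; apply: eq_bigr => j _; rewrite mulrCA. Qed.

Lemma crpEB N g h : crpE N (fun j => g j - h j) = crpE N g - crpE N h.
Proof. by rewrite /crpE -sumrB; apply: eq_bigr => j _; rewrite mulrBr. Qed.

Definition rising j k : R := \prod_(i < k) (j + i)%:R.

Lemma rising_recr j k : rising j k.+1 = rising j k * (j + k)%:R.
Proof. by rewrite /rising big_ord_recr. Qed.

Lemma rising_recl j k : rising j k.+1 = j%:R * rising j.+1 k.
Proof.
rewrite /rising big_ord_recl/= addn0; congr (_ * _).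
by apply: eq_bigr => i _; rewrite /bump/= add1n addSnnS.
Qed.

Lemma rising_ge0 j k : 0 <= rising j k.
Proof. by apply: prodr_ge0 => i _. Qed.

Lemma rising1 k : rising 1 k = k`!%:R.
Proof.
elim: k => [|k ih]; first by rewrite /rising big_ord0 fact0.
by rewrite rising_recr ih factS natrM mulrC add1n.
Qed.

(** Rising factorials are eigenfunctions of the seating step, with eigenvalue
    [1 + b k / N] when [N] customers are seated. This is what makes all moments
    explicit. *)
Lemma crpE_rising N k : crpE N (rising ^~ k) = k`!%:R * rising_ratio (b * k%:R) N.
Proof.
elim: N => [|N ih]; first by rewrite crpE0 rising1 /rising_ratio big_ord0 mulr1.
rewrite crpES rising_ratio_recr mulrA -ih mulrC -crpEZ; apply: eq_bigr => j _.
congr (_ * _); rewrite -[_ * _ * rising j.+1 k]mulrA.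
rewrite (_ : _ * (_ * _) = b / N.+1%:R * (j%:R * rising j.+1 k)); last by ring.
rewrite -rising_recl rising_recr natrD; ring.
Qed.

Lemma crp_sum1 N : \sum_(j < N.+2) crp N j = 1.
Proof.
have := crpE_rising N 0; rewrite fact0 mul1r mulr0 /rising_ratio.
rewrite [in X in _ = X -> _]big1; last by move=> i _; rewrite mul0r addr0.
move=> <-; apply: eq_bigr => j _; by rewrite /rising big_ord0 mulr1.
Qed.

Lemma exp_le_rising j k : j%:R ^+ k <= rising j k.
Proof.
elim: k => [|k ih]; first by rewrite /rising big_ord0.
by rewrite exprSr rising_recr ler_pM// ?exprn_ge0// ler_nat leq_addr.
Qed.

(** The rising factorial differs from the power by a term of lower degree, so
    both have the same limit after rescaling. *)
Lemma rising_sub_exp j k :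
  rising j k.+1 - j%:R ^+ k.+1 <= (k ^ 2)%:R * rising j k.
Proof.
elim: k => [|k ih].
  by rewrite rising_recr /rising big_ord0 mul1r addn0 expr1 subrr mulr1.
rewrite rising_recr natrD.
rewrite (_ : _ - _ = k.+1%:R * rising j k.+1 +
  j%:R * (rising j k.+1 - j%:R ^+ k.+1)); last by rewrite [in LHS]exprS; ring.
apply: (@le_trans _ _ (k.+1%:R * rising j k.+1 + (k ^ 2)%:R * rising j k.+1)).
  rewrite lerD2l; apply: le_trans (ler_wpM2l _ ih) _ => //.
  rewrite mulrCA ler_wpM2l// rising_recr mulrC ler_wpM2l ?rising_ge0//.
  by rewrite ler_nat leq_addr.
rewrite -mulrDl ler_wpM2r ?rising_ge0// -natrD ler_nat.
by rewrite -[k.+1]addn1 sqrnD; lia.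
Qed.

Lemma powR_succ_ge (x : R) N : 0 <= x -> (0 < N)%N ->
  N%:R `^ x * (1 + x / N.+1%:R) <= N.+1%:R `^ x.
Proof.
move=> x0 N0; have N0' : 0 < N%:R :> R by rewrite ltr0n.
have N1 : 0 < N.+1%:R :> R by rewrite ltr0n.
rewrite mulrC -ler_pdivlMr ?powR_gt0//.
apply: le_trans (expR_ge1Dx _) _.
rewrite /powR !gt_eqF// -expRB ler_expR -mulrBr ler_wpM2l//.
have -> : ln N.+1%:R - ln N%:R = - ln (1 + (- N.+1%:R^-1)) :> R.
  rewrite -[RHS]lnV ?posrE; last by rewrite subr_gt0 invf_lt1// ltr1n.
  rewrite -ln_div ?posrE//; congr ln.
  rewrite -natr1; field.
  by rewrite addrK !gt_eqF// natr1.
by rewrite lerNr le_ln1Dx// ltrN2 invf_lt1// ltr1n.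
Qed.

(** A bound uniform in [N] and explicit in [x]: beyond the index [M] the product
    grows no faster than [N `^ x], and the first [M] factors are bounded
    crudely. *)
Lemma rising_ratio_le (x : R) M N : 0 <= x -> (0 < M <= N)%N ->
  rising_ratio x N <= (1 + x) ^+ M * (N%:R `^ x / M%:R `^ x).
Proof.
move=> x0 /andP[M0 MN]; rewrite -(subnKC MN).
elim: (N - M)%N => [|n ih].
  rewrite addn0 divff ?mulr1; last by rewrite gt_eqF ?powR_gt0 ?ltr0n.
  rewrite /rising_ratio -[in leRHS](card_ord M) -prodr_const.
  apply: ler_prod => i _; rewrite addr_ge0 ?divr_ge0//= lerD2l.
  by rewrite ler_pdivrMr ?ltr0n// ler_peMr// ler1n.
rewrite addnS rising_ratio_recr.
apply: (@le_trans _ _ ((1 + x) ^+ M * ((M + n)%:R `^ x / M%:R `^ x) * (1 + x / (M + n).+1%:R))).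
  by rewrite ler_wpM2r// addr_ge0// divr_ge0.
rewrite -!mulrA ler_wpM2l ?exprn_ge0 ?addr_ge0// mulrCA mulrC ler_wpM2r ?invr_ge0 ?powR_ge0//.
rewrite powR_succ_ge// addn_gt0 M0//.
Qed.

(** With [x = b k] this bounds the first [M] factors of [rising_ratio] by
    something geometric in [k]. *)
Lemma exp1D_le (x : R) M : 0 <= x -> (0 < M)%N -> (1 + x) ^+ M <= M%:R ^+ M * expR x.
Proof.
move=> x0 M0; have M0' : 0 < M%:R :> R by rewrite ltr0n.
have -> : expR x = expR (x / M%:R) ^+ M.
  by rewrite -expRM_natr mulfVK// gt_eqF.
rewrite -exprMn lerXn2r ?nnegrE ?addr_ge0 ?mulr_ge0 ?expR_ge0//.
apply: (@le_trans _ _ (M%:R * (1 + x / M%:R))); last by rewrite ler_wpM2l// expR_ge1Dx.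
by rewrite mulrDr mulr1 mulrCA divff ?gt_eqF// mulr1 lerD2r ler1n.
Qed.

(** The rescaled number of tables plays the role of the random variance. *)
Definition crp_time N j : R := j%:R / N%:R `^ b.

Lemma crp_time_ge0 N j : 0 <= crp_time N j.
Proof. by rewrite divr_ge0// powR_ge0. Qed.

Definition crp_moment N k := crpE N (fun j => crp_time N j ^+ k).

Lemma crp_momentE N k :
  crp_moment N k = crpE N (fun j => j%:R ^+ k) / N%:R `^ (b * k%:R).
Proof.
rewrite mulrC -crpEZ; apply: eq_bigr => j _; congr (_ * _).
by rewrite /crp_time expr_div_n powRrM powR_mulrn ?powR_ge0// mulrC.
Qed.

Lemma crp_moment_ge0 N k : 0 <= crp_moment N k.
Proof. by apply: crpE_ge0 => j; rewrite exprn_ge0// crp_time_ge0. Qed.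

Lemma crp_moment_le N k :
  crp_moment N k <= k`!%:R * (rising_ratio (b * k%:R) N / N%:R `^ (b * k%:R)).
Proof.
rewrite crp_momentE mulrA -crpE_rising ler_wpM2r ?invr_ge0 ?powR_ge0//.
by apply: crpE_le => j; exact: exp_le_rising.
Qed.

(** The limits are the moments of the Mittag-Leffler distribution. By
    [rising_sub_exp] powers may be replaced by rising factorials, whose
    expectations are given by [crpE_rising] and [rising_ratio_cvg]. *)
Lemma crp_moment_cvg k :
  crp_moment N k @[N --> \oo] --> k`!%:R / Gamma (b * k%:R + 1).
Proof.
have lim l : l`!%:R * (rising_ratio (b * l%:R) N / N%:R `^ (b * l%:R)) @[N --> \oo] -->
    l`!%:R / Gamma (b * l%:R + 1).
  by apply: cvgMr; apply: rising_ratio_cvg; rewrite mulr_ge0// ltW.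
case: k => [|k].
  have := lim 0%N; apply: cvg_trans; apply: near_eq_cvg; near=> N.
  rewrite mulr0 powRr0 divr1 -(mulr0 b) -crpE_rising crp_momentE mulr0 powRr0 divr1.
  by apply: eq_bigr => j _; rewrite /rising big_ord0 expr0.
have lim0 : (k ^ 2)%:R * (k`!%:R * (rising_ratio (b * k%:R) N / N%:R `^ (b * k%:R)))
    * N%:R `^ (- b) @[N --> \oo] --> (0 : R).
  rewrite -[X in _ --> X](mulr0 ((k ^ 2)%:R * (k`!%:R / Gamma (b * k%:R + 1)))).
  apply: cvgM; first exact: cvgMr.
  apply/cvgr0Pnorm_le => e e0; exists (Num.truncn ((e^-1) `^ b^-1)).+1 => // N /= eN.
  have e1 : 0 < e^-1 by rewrite invr_gt0.
  rewrite powRN normfV ger0_norm ?powR_ge0// invf_ple ?posrE//; last first.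
    by rewrite powR_gt0// ltr0n (leq_trans _ eN).
  have : ((e^-1) `^ b^-1) `^ b <= N%:R `^ b.
    rewrite ge0_ler_powR ?nnegrE ?powR_ge0 ?(ltW b0)//.
    by rewrite (le_trans (ltW (truncnS_gt _)))// ler_nat.
  by rewrite -powRrM mulVf ?gt_eqF// powRr1// ltW.
apply: (@squeeze_cvgr _ _ _ _ (fun N =>
  k.+1`!%:R * (rising_ratio (b * k.+1%:R) N / N%:R `^ (b * k.+1%:R)) -
  (k ^ 2)%:R * (k`!%:R * (rising_ratio (b * k%:R) N / N%:R `^ (b * k%:R))) * N%:R `^ (- b))
  (fun N => k.+1`!%:R * (rising_ratio (b * k.+1%:R) N / N%:R `^ (b * k.+1%:R)))).
- near=> N; rewrite crp_moment_le andbT.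
  have N0 : (0 < N)%N by near: N; exact: nbhs_infty_gt.
  rewrite lerBlDl -lerBlDr crp_momentE !mulrA -!crpE_rising.
  rewrite -mulrBl -crpEB.
  have -> : N%:R `^ (b * k.+1%:R) = N%:R `^ (b * k%:R) * N%:R `^ b.
    by rewrite -natr1 mulrDr mulr1 powRD// pnatr_eq0 -lt0n N0 implybT.
  rewrite powRN -mulrA -invfM ler_wpM2r ?invr_ge0 ?mulr_ge0 ?powR_ge0//.
  rewrite -mulrA -crpE_rising -crpEZ; apply: crpE_le => j.
  exact: rising_sub_exp.
- rewrite -[X in _ --> X]subr0; apply: cvgB => //.
- exact: lim.
Unshelve. all: by end_near. Qed.

Lemma crp_laplace_series N s :
  series (fun k => (- s) ^+ k / k`!%:R * crp_moment N k) n @[n --> \oo] -->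
  crpE N (fun j => expR (- (s * crp_time N j))).
Proof.
have -> : (fun n => series (fun k => (- s) ^+ k / k`!%:R * crp_moment N k) n) =
    (fun n => crpE N (fun j => series (exp_coeff (- (s * crp_time N j))) n)).
  apply/funext => n; rewrite /series/= /crpE.
  under eq_bigr do rewrite /crp_moment -crpEZ /crpE.
  rewrite exchange_big/=; apply: eq_bigr => j _; rewrite mulr_sumr.
  apply: eq_bigr => k _; congr (_ * _).
  by rewrite /exp_coeff/= -[- (s * _)]mulNr (exprMn k (- s)) mulrAC.
rewrite /crpE; apply: cvg_sum => j _; apply: cvgMr.
exact: is_cvg_series_exp_coeff.
Qed.

(** Each Laplace transform is the power series of its moments, and these
    converge; to exchange the limits, the [k]-th term has to be dominated
    geometrically in [k], uniformly in large [N]. The ratio is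
    [s expR b / M `^ b], which is small when [M] is large. *)
Lemma crp_laplace_cvg s : 0 <= s ->
  crpE N (fun j => expR (- (s * crp_time N j))) @[N --> \oo] --> mittag_leffler b (- s).
Proof.
move=> s0.
have [M [M0 sM]] : exists M, (0 < M)%N /\ s * expR b / M%:R `^ b <= 1 / 2.
  pose a := (2 * (s * expR b)) `^ b^-1.
  exists (Num.truncn a).+1; split => //.
  have aM : a <= (Num.truncn a).+1%:R by rewrite ltW// truncnS_gt.
  rewrite ler_pdivrMr ?powR_gt0 ?ltr0n//.
  have : a `^ b <= (Num.truncn a).+1%:R `^ b.
    by rewrite ge0_ler_powR ?nnegrE ?powR_ge0// ltW.
  rewrite /a -powRrM mulVf ?gt_eqF// powRr1 ?mulr_ge0 ?expR_ge0//.
  lra.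
pose C : R := M%:R ^+ M.
apply: (@tannery R (fun N k => (- s) ^+ k / k`!%:R * crp_moment N k) _ _ C (1 / 2)).
- by apply/andP; split; lra.
- move=> k; rewrite (_ : (- s) ^+ k / Gamma _ = (- s) ^+ k / k`!%:R * (k`!%:R / Gamma (b * k%:R + 1))).
    by apply: cvgMr; exact: crp_moment_cvg.
  by rewrite mulrA divfK// pnatr_eq0 -lt0n fact_gt0.
- near=> N => k.
  have MN : (M <= N)%N by near: N; exact: nbhs_infty_ge.
  have N0 : (0 < N)%N by exact: leq_trans MN.
  have k0 : 0 < k`!%:R :> R by rewrite ltr0n fact_gt0.
  have bk : 0 <= b * k%:R by rewrite mulr_ge0// ltW.
  rewrite !normrM normrX normrN (ger0_norm s0) normfV (gtr0_norm k0) (ger0_norm (crp_moment_ge0 _ _)).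
  apply: (@le_trans _ _ (s ^+ k * (rising_ratio (b * k%:R) N / N%:R `^ (b * k%:R)))).
    by rewrite -mulrA ler_wpM2l ?exprn_ge0// ler_pdivrMl// crp_moment_le.
  apply: (@le_trans _ _ (C * (s * expR b / M%:R `^ b) ^+ k)); last first.
    rewrite ler_wpM2l ?exprn_ge0// lerXn2r ?nnegrE//.
    by rewrite !mulr_ge0 ?expR_ge0// invr_ge0 powR_ge0.
  have -> : C * (s * expR b / M%:R `^ b) ^+ k =
      s ^+ k * (C * expR (b * k%:R) / M%:R `^ (b * k%:R)).
    rewrite !exprMn exprVn powRrM powR_mulrn ?powR_ge0// expRM_natr; ring.
  rewrite ler_wpM2l ?exprn_ge0// ler_pdivrMr ?powR_gt0 ?ltr0n//.
  apply: le_trans (rising_ratio_le (M := M) bk _) _; first by rewrite M0.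
  rewrite mulrA [leRHS]mulrAC.
  rewrite ler_wpM2r ?invr_ge0 ?powR_ge0// ler_wpM2r ?powR_ge0//.
  exact: exp1D_le.
- by move=> N; exact: crp_laplace_series.
Unshelve. all: by end_near. Qed.

(** A nonnegative variable with first moment bounded below and second moment
    bounded above cannot concentrate near [0] and infinity: integrate
    [t <= t0 + t^2 / t1 + t1 1_(t0 <= t <= t1)]. *)
Lemma crp_mass : exists t0 t1 c : R, [/\ 0 < t0, 0 < t1, 0 < c &
  \forall N \near \oo,
    c <= \sum_(j < N.+2 | t0 <= crp_time N j <= t1) crp N j].
Proof.
pose m1 : R := 1`!%:R / Gamma (b * 1%:R + 1).
pose m2 : R := 2`!%:R / Gamma (b * 2%:R + 1).
have m10 : 0 < m1.
  by rewrite divr_gt0// Gamma_gt0// mulr1 ltW.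
have m20 : 0 < m2.
  by rewrite divr_gt0 ?ltr0n// Gamma_gt0// mulr_ge0 ?ltW.
pose t0 := m1 / 8; pose t1 := 8 * (m2 + 1) / m1.
have t00 : 0 < t0 by rewrite divr_gt0.
have t10 : 0 < t1 by rewrite divr_gt0// mulr_gt0// addr_gt0.
have t1E : m1 / 8 * t1 = m2 + 1 by rewrite /t1; field; rewrite gt_eqF.
clearbody t1.
(* The first two terms of the bound below add up to at most [m1 / 4],
   half of the lower bound [m1 / 2] on the first moment. *)
exists t0, t1, (m1 / 4 / t1); split => //.
  by rewrite divr_gt0// divr_gt0.
have h1 : \forall N \near \oo, m1 / 2 <= crp_moment N 1.
  by apply: (cvgr_ge m1); [exact: crp_moment_cvg|lra].
have h2 : \forall N \near \oo, crp_moment N 2 <= m2 + 1.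
  by apply: (cvgr_le m2); [exact: crp_moment_cvg|lra].
near=> N.
rewrite ler_pdivrMr// mulr_suml.
have h (j : nat) : crp_time N j <= t0 + crp_time N j ^+ 2 / t1 +
    (t0 <= crp_time N j <= t1)%R%:R * t1.
  set t := crp_time N j; have tt0 : 0 <= t := crp_time_ge0 N j.
  have [tlt|tge] := ltP t t0.
    apply: (le_trans (ltW tlt)); rewrite -addrA lerDl addr_ge0 ?mulr_ge0 ?(ltW t10)//.
    by rewrite invr_ge0 ltW.
  have [tle|tgt] := leP t t1; rewrite /=.
    by rewrite mul1r ler_wpDl// addr_ge0 ?(ltW t00)// mulr_ge0 ?exprn_ge0// invr_ge0 ltW.
  rewrite mul0r addr0 ler_wpDl ?(ltW t00)// expr2 -mulrA ler_peMr//.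
  by rewrite ler_pdivlMr// mul1r ltW.
have : crp_moment N 1 <= t0 + crp_moment N 2 / t1 +
    \sum_(j < N.+2 | t0 <= crp_time N j <= t1) crp N j * t1.
  apply: (@le_trans _ _ (crpE N (fun j => t0 + crp_time N j ^+ 2 / t1 +
    (t0 <= crp_time N j <= t1)%R%:R * t1))).
    by apply: crpE_le => j; rewrite expr1.
  rewrite /crpE; under eq_bigr do rewrite !mulrDr.
  rewrite !big_split/= -mulr_suml crp_sum1 mul1r; apply: lerD; last first.
    rewrite [leRHS]big_mkcond/=; apply: ler_sum => j _.
    by case: ifP => _; rewrite ?mul1r// mul0r mulr0.
  rewrite lerD2l mulr_suml; apply: ler_sum => j _; by rewrite mulrA.
have h1N : m1 / 2 <= crp_moment N 1 by near: N.
have h2N : crp_moment N 2 <= m2 + 1 by near: N.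
have : crp_moment N 2 / t1 <= m1 / 8.
  by rewrite ler_pdivrMr// t1E.
rewrite /t0; lra.
Unshelve. all: by end_near. Qed.

End Chinese_restaurant.

(** * Gaussian integrals on the line *)
Section Gaussian.
Context {R : realType}.
Notation leb := (@lebesgue_measure R).
Implicit Types (m s y d x a c : R).

Lemma integrable_cvg_itv (f : R -> R) : leb.-integrable setT (EFin \o f) ->
  \int[leb]_(x in `[- n%:R, n%:R]) f x @[n --> \oo] --> \int[leb]_x f x.
Proof.
move=> fi; have mf := measurable_int _ fi.
apply: fine_cvg; rewrite fineK; last exact: integrable_fin_num.
under eq_fun do rewrite integral_mkcond.
apply: (@dominated_cvg _ _ _ leb setT measurableT _ _ (fun x => `|(f x)%:E|%E)) => //.
- move=> n; apply/(measurable_restrictT _ _).1 => //.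
  exact: measurable_funTS.
- move=> x _; apply: (@cvg_near_cst _ _ (f x)%:E).
  exists (Num.truncn `|x|).+1 => // n /= xn; rewrite patchE mem_set//=.
  rewrite in_itv/= -ler_norml (le_trans (ltW (truncnS_gt _)))//.
  by rewrite ler_nat.
- by move: (integrable_abse fi).
- move=> n x _; rewrite patchE; case: ifP => //.
  by rewrite abse0.
Qed.

Definition normal_pdf' m s x := - ((x - m) / s ^+ 2) * normal_pdf m s x.

Lemma is_derive_normal_pdf m s x : s != 0 ->
  is_derive x 1 (normal_pdf m s) (normal_pdf' m s x).
Proof.
move=> s0; rewrite /normal_pdf' normal_pdfE// /normal_fun.
apply: trigger_derive; rewrite /GRing.scale/=.
field.
exact: s0.
Qed.

(** The linear factor is absorbed by widening the variance. *)
Lemma normal_pdf_sqr_le m s x : s != 0 ->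
  `|x - m| * normal_pdf m s x <=
  `|s| * normal_peak s / normal_peak (Num.sqrt 2 * s) * normal_pdf m (Num.sqrt 2 * s) x.
Proof.
move=> s0; have s20 : Num.sqrt 2 * s != 0 by rewrite mulf_neq0// gt_eqF// sqrtr_gt0.
rewrite !normal_pdfE//.
have p0 : normal_peak (Num.sqrt 2 * s) != 0 by rewrite gt_eqF// normal_peak_gt0.
have -> : `|s| * normal_peak s / normal_peak (Num.sqrt 2 * s) *
    (normal_peak (Num.sqrt 2 * s) * normal_fun m (Num.sqrt 2 * s) x) =
    normal_peak s * (`|s| * normal_fun m (Num.sqrt 2 * s) x) by field.
rewrite mulrCA ler_wpM2l ?normal_peak_ge0//.
rewrite /normal_fun exprMn sqr_sqrtr//.
set u := (x - m) / s.
have xmE : x - m = s * u by rewrite /u mulrCA divff ?mulr1.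
have -> : - (x - m) ^+ 2 / (s ^+ 2 *+ 2) = - (u ^+ 2 / 4) + - (u ^+ 2 / 4).
  rewrite xmE; field; exact: s0.
have -> : - (x - m) ^+ 2 / ((2 * s ^+ 2) *+ 2) = - (u ^+ 2 / 4).
  rewrite xmE; field; exact: s0.
rewrite xmE normrM -mulrA ler_wpM2l// expRD mulrA ler_piMl ?expR_ge0//.
rewrite expRN ler_pdivrMr ?expR_gt0// mul1r.
apply: le_trans (expR_ge1Dx _).
rewrite -[u ^+ 2]real_normK ?num_real//; move: `|u| => v.
have := sqr_ge0 (v / 2 - 1); rewrite -subr_ge0; nra.
Qed.

Lemma integrable_normal_pdf1 m s : s != 0 ->
  leb.-integrable setT (EFin \o (fun x => `|x - m| * normal_pdf m s x)).
Proof.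
move=> s0.
apply: (@le_integrable _ _ _ leb setT measurableT _ (EFin \o (fun x =>
  `|s| * normal_peak s / normal_peak (Num.sqrt 2 * s) * normal_pdf m (Num.sqrt 2 * s) x))).
- apply/measurable_EFinP; apply: measurable_funM; last exact: measurable_normal_pdf.
  by apply: measurableT_comp => //; exact: measurable_funB.
- move=> x _ /=; rewrite lee_fin ger0_norm ?mulr_ge0 ?normal_pdf_ge0//.
  by rewrite (le_trans (normal_pdf_sqr_le _ _ _))// ler_norm.
- by apply: integrable_EFinZ => //; exact: integrable_normal_pdf.
Qed.

Lemma integrable_bounded_normal_pdf m s (f : R -> R) c : measurable_fun setT f ->
  (forall x, `|f x| <= c) ->
  leb.-integrable setT (EFin \o (fun x => f x * normal_pdf m s x)).
Proof.
move=> mf fc.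
apply: (@le_integrable _ _ _ leb setT measurableT _ (EFin \o (fun x =>
  c * normal_pdf m s x))).
- by apply/measurable_EFinP; apply: measurable_funM => //; exact: measurable_normal_pdf.
- move=> x _ /=; rewrite lee_fin normrM (ger0_norm (normal_pdf_ge0 _ _ _)).
  rewrite [leRHS]ger0_norm ?ler_wpM2r ?normal_pdf_ge0//.
  by rewrite mulr_ge0 ?normal_pdf_ge0// (le_trans _ (fc x)).
- by apply: integrable_EFinZ => //; exact: integrable_normal_pdf.
Qed.

Lemma Rintegral_normal_pdf m s : \int[leb]_x normal_pdf m s x = 1.
Proof. by rewrite /Rintegral integral_normal_pdf. Qed.

(** The hypothesis on [g] holds for [n] and for [- n], the two boundary terms
    of the integration by parts. *)
Lemma normal_pdf_cvg0 m s (g : nat -> R) : s != 0 ->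
  (forall n, n%:R - `|m| <= `|g n - m|) -> normal_pdf m s (g n) @[n --> \oo] --> (0 : R).
Proof.
move=> s0 gm; apply/cvgr0Pnorm_le => e e0.
have s20 : 0 < s ^+ 2 by rewrite exprn_even_gt0.
pose c := normal_peak s * (s ^+ 2 *+ 2) / e.
have c0 : 0 <= c by rewrite divr_ge0 ?(ltW e0)// mulr_ge0 ?normal_peak_ge0// mulrn_wge0// ltW.
exists (Num.truncn (c + 1 + `|m|)).+1 => // n /= cn.
have hn : c + 1 <= `|g n - m|.
  apply: le_trans (gm n); rewrite lerBrDr.
  by apply: (le_trans (ltW (truncnS_gt _))); rewrite ler_nat.
have gn1 : 1 <= `|g n - m| by apply: le_trans hn; rewrite lerDr.
have g20 : 0 < (g n - m) ^+ 2 by rewrite -real_normK ?num_real// exprn_gt0// (lt_le_trans ltr01).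
rewrite ger0_norm ?normal_pdf_ge0// normal_pdfE//.
apply: (@le_trans _ _ (normal_peak s * ((s ^+ 2 *+ 2) / (g n - m) ^+ 2))).
  rewrite ler_wpM2l ?normal_peak_ge0// /normal_fun mulNr expRN -[leRHS]invf_div lef_pV2 ?posrE ?expR_gt0//.
    by apply: le_trans (expR_ge1Dx _); rewrite lerDr.
  by rewrite divr_gt0// pmulrn_lgt0.
rewrite mulrA ler_pdivrMr// -ler_pdivrMl// mulrC -/c.
apply: (@le_trans _ _ `|g n - m|); first by apply: le_trans hn; rewrite lerDl.
by rewrite -[leRHS]real_normK ?num_real// expr2 ler_peMl.
Qed.

Lemma is_derive_cos_normal_pdf m s y x d : is_derive d 1 (fun d => cos (y + d * (x - m)) * normal_pdf m s x)
   (- ((x - m) * sin (y + d * (x - m)) * normal_pdf m s x)).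
Proof.
apply: trigger_derive; rewrite /GRing.scale/=.
ring.
Qed.

Lemma is_derive_sin_normal_pdf m s y x d : s != 0 -> is_derive x 1 (fun x => sin (y + d * (x - m)) * normal_pdf m s x)
   (d * cos (y + d * (x - m)) * normal_pdf m s x + sin (y + d * (x - m)) * normal_pdf' m s x).
Proof.
move=> s0; have ? := is_derive_normal_pdf m x s0.
apply: trigger_derive; rewrite /GRing.scale/=.
ring.
Qed.

(** The characteristic function of the normal law, with a phase [y]. As a
    function of [d], the integral satisfies [k' d = - s^2 d k d]: differentiate
    under the integral sign, then integrate by parts. *)
Lemma normal_charE m s y d : s != 0 ->
  \int[leb]_x (cos (y + d * (x - m)) * normal_pdf m s x) = expR (- (s ^+ 2 * d ^+ 2 / 2)) * cos y.
Proof.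
move=> s0.
pose k d := \int[leb]_x (cos (y + d * (x - m)) * normal_pdf m s x).
have mcos e : measurable_fun setT (fun x => cos (y + e * (x - m))).
  apply: measurableT_comp; first (apply: continuous_measurable_fun; exact: continuous_cos).
  by apply: measurable_funD => //; apply: measurable_funM => //; exact: measurable_funB.
have msin e : measurable_fun setT (fun x => sin (y + e * (x - m))).
  apply: measurableT_comp; first (apply: continuous_measurable_fun; exact: continuous_sin).
  by apply: measurable_funD => //; apply: measurable_funM => //; exact: measurable_funB.
have icos e : leb.-integrable setT (EFin \o (fun x => cos (y + e * (x - m)) * normal_pdf m s x)).
  by apply: (@integrable_bounded_normal_pdf _ _ _ 1) => // x; exact: cos_max.
have isin e : leb.-integrable setT
    (EFin \o (fun x => (x - m) * sin (y + e * (x - m)) * normal_pdf m s x)).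
  apply: (@le_integrable _ _ _ leb setT measurableT _ _ _ _ (integrable_normal_pdf1 m s0)).
    apply/measurable_EFinP; apply: measurable_funM; last exact: measurable_normal_pdf.
    by apply: measurable_funM; [exact: measurable_funB|exact: msin].
  move=> x _ /=; rewrite lee_fin !normrM normr_id ler_wpM2r//.
  by rewrite ler_piMr// sin_max.
have dk (e : R) : is_derive e 1 k (- \int[leb]_x ((x - m) * sin (y + e * (x - m)) * normal_pdf m s x)).
  pose f e x := cos (y + e * (x - m)) * normal_pdf m s x.
  have d1E t x : partial1of2 f t x = - ((x - m) * sin (y + t * (x - m)) * normal_pdf m s x).
    rewrite partial1of2E; have [_ h] := is_derive_cos_normal_pdf m s y x t; exact: h.
  have eI : `]e - 1, e + 1[%classic e by rewrite /= in_itv/=; apply/andP; split; lra.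
  have G0 x : 0 <= `|x - m| * normal_pdf m s x by rewrite mulr_ge0 ?normal_pdf_ge0.
  have der t x : `]e - 1, e + 1[%classic t -> setT x -> derivable (f ^~ x) t 1.
    by move=> _ _; have [] := is_derive_cos_normal_pdf m s y x t.
  have Gub t x : `]e - 1, e + 1[%classic t -> setT x -> `|partial1of2 f t x| <= `|x - m| * normal_pdf m s x.
    move=> _ _; rewrite d1E normrN !normrM (ger0_norm (normal_pdf_ge0 _ _ _)).
    by rewrite ler_wpM2r ?normal_pdf_ge0// ler_piMr// sin_max.
  have iG := integrable_normal_pdf1 m s0.
  have h1 := @derivable_under_integral R _ _ leb f setT measurableT e (e - 1) (e + 1) eI
    (fun t _ => icos t) der _ G0 iG Gub.
  have h2 := @differentiation_under_integral R _ _ leb f setT measurableT e (e - 1) (e + 1) eI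
    (fun t _ => icos t) der _ G0 iG Gub.
  apply: DeriveDef; first exact: h1.
  rewrite -derive1E h2 -[RHS]mulN1r -RintegralZl//.
  by apply: eq_Rintegral => x _; rewrite d1E mulN1r.
have ibp e : \int[leb]_x ((x - m) * sin (y + e * (x - m)) * normal_pdf m s x) = s ^+ 2 * e * k e.
  pose F x := sin (y + e * (x - m)) * normal_pdf m s x.
  pose f x := e * cos (y + e * (x - m)) * normal_pdf m s x + sin (y + e * (x - m)) * normal_pdf' m s x.
  have fE x : f x = e * (cos (y + e * (x - m)) * normal_pdf m s x) -
      s ^- 2 * ((x - m) * sin (y + e * (x - m)) * normal_pdf m s x).
    by rewrite /f /normal_pdf'; field.
  have fi : leb.-integrable setT (EFin \o f).
    rewrite (_ : f = fun x => e * (cos (y + e * (x - m)) * normal_pdf m s x) -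
      s ^- 2 * ((x - m) * sin (y + e * (x - m)) * normal_pdf m s x)); last exact/funext.
    by apply: integrable_EFinB => //; exact: integrable_EFinZ.
  have f0 : \int[leb]_x f x = 0.
    have := integrable_cvg_itv fi; move=> /cvg_lim <-//; apply/cvg_lim => //.
    have Fcvg (g : nat -> R) : (forall n, n%:R - `|m| <= `|g n - m|) -> F (g n) @[n --> \oo] --> (0 : R).
      move=> gm; apply: norm_cvg0.
      apply: (@squeeze_cvgr _ _ _ _ (fun=> 0) (fun n => normal_pdf m s (g n))).
      - near=> n; rewrite normr_ge0/= /F normrM (ger0_norm (normal_pdf_ge0 _ _ _)).
        by rewrite ler_piMl ?normal_pdf_ge0// sin_max.
      - exact: cvg_cst.
      - exact: normal_pdf_cvg0.
    rewrite -(subr0 0).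
    have h : F n%:R - F (- n%:R) @[n --> \oo] --> (0 - 0 : R).
      apply: cvgB.
        by apply: (Fcvg (fun n => n%:R)) => n; rewrite -{1}(normr_nat _ n) lerB_dist.
      apply: (Fcvg (fun n => - n%:R)) => n; rewrite -{1}(normr_nat _ n) -normrN.
      exact: lerB_dist.
    apply: cvg_trans h; apply: near_eq_cvg; near=> n; rewrite /=.
    have n0 : (0 < n)%N by near: n; exact: nbhs_infty_gt.
    have dF x : is_derive x 1 F (f x) by exact: is_derive_sin_normal_pdf.
    have cF : continuous F.
      by move=> x; apply: differentiable_continuous; apply/derivable1_diffP; have [] := dF x.
    have cf : continuous f.
      have cpdf := @continuous_normal_pdf _ m _ s0.
      have cphi : continuous (fun x : R => y + e * (x - m)).
        by move=> x; apply: cvgD; [exact: cvg_cst|apply: cvgMr; apply: cvgB; [exact: cvg_id|exact: cvg_cst]].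
      have cc : continuous (fun x : R => cos (y + e * (x - m))).
        by move=> x; apply: continuous_comp; [exact: cphi|exact: continuous_cos].
      have cs : continuous (fun x : R => sin (y + e * (x - m))).
        by move=> x; apply: continuous_comp; [exact: cphi|exact: continuous_sin].
      move=> x; apply: cvgD; apply: cvgM.
      - by apply: cvgMr; exact: cc.
      - exact: cpdf.
      - exact: cs.
      - apply: cvgM; last exact: cpdf.
        apply: cvgN; apply: cvgMl.
        by apply: cvgB; [exact: cvg_id|exact: cvg_cst].
    rewrite /Rintegral (@continuous_FTC2 _ f F)//=.
    - by rewrite gtrN// ltr0n.
    - exact: continuous_subspaceT.
    - split; first by move=> x _; have [] := dF x.
      + by apply: cvg_at_right_filter; exact: cF.
      + by apply: cvg_at_left_filter; exact: cF.
    - by move=> x _; rewrite derive1E; have [] := dF x.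
  move: f0; under eq_Rintegral do rewrite fE.
  rewrite RintegralB//; try exact: integrable_EFinZ.
  rewrite !RintegralZl// -/(k e) => /eqP; rewrite subr_eq0 => /eqP e1.
  rewrite -mulrA e1 mulrA mulfV ?mul1r// expf_neq0//.
pose K d := k d * expR (s ^+ 2 * d ^+ 2 / 2).
have : K d = K 0.
  apply: is_derive_0_is_cst => e; have ? := dk e.
  apply: trigger_derive; rewrite /GRing.scale/= ibp.
  by field.
rewrite /K expr0n/= mulr0 mul0r expR0 mulr1 => kd.
move: kd; have -> : k 0 = cos y.
  rewrite /k; under eq_Rintegral do rewrite mul0r addr0.
  rewrite RintegralZl//; last exact: integrable_normal_pdf.
  by rewrite Rintegral_normal_pdf mulr1.
by move=> <-; rewrite mulrCA -expRD addNr expR0 mulr1.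
Unshelve. all: by end_near. Qed.

Lemma normal_peakV s : 0 < s -> normal_peak s^-1 = s * normal_peak 1.
Proof.
move=> s0; rewrite /normal_peak expr1n -mulrnAr mul1r sqrtrM ?sqr_ge0//.
by rewrite sqrtr_sqr invfM ger0_norm ?invr_ge0 ?(ltW s0)// invrK.
Qed.

(** Completing the square: a normal density times a Gaussian factor is a
    multiple of another normal density. *)
Lemma normal_pdf_tilt a b x : 0 <= a ->
  expR (- (a * x ^+ 2 / 2) - b * x) * normal_pdf 0 1 x =
  (Num.sqrt (1 + a))^-1 * expR (b ^+ 2 / (2 * (1 + a))) *
  normal_pdf (- (b / (1 + a))) (Num.sqrt (1 + a))^-1 x.
Proof.
move=> a0; have a1 : 0 < 1 + a by rewrite ltr_pwDl.
have s0 : 0 < Num.sqrt (1 + a) by rewrite sqrtr_gt0.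
rewrite !normal_pdfE ?oner_eq0 ?invr_eq0 ?(gt_eqF s0)// normal_peakV// /normal_fun.
rewrite [LHS]mulrCA -expRD.
rewrite (_ : (Num.sqrt (1 + a))^-1 * _ * _ = normal_peak 1 *
  (expR (b ^+ 2 / (2 * (1 + a))) * expR (- (x - - (b / (1 + a))) ^+ 2 / ((Num.sqrt (1 + a))^-1 ^+ 2 *+ 2)))).
  rewrite -expRD exprVn sqr_sqrtr ?(ltW a1)//; congr (_ * expR _).
  by field; rewrite gt_eqF.
by field; rewrite gt_eqF.
Qed.

Lemma integrable_normal_quad a b y d : 0 <= a ->
  leb.-integrable setT
    (EFin \o (fun x => expR (- (a * x ^+ 2 / 2) - b * x) * cos (y + d * x) * normal_pdf 0 1 x)).
Proof.
move=> a0.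
rewrite (_ : (fun x => _) = fun x => (Num.sqrt (1 + a))^-1 * expR (b ^+ 2 / (2 * (1 + a))) *
  (cos (y + d * x) * normal_pdf (- (b / (1 + a))) (Num.sqrt (1 + a))^-1 x)); last first.
  by apply/funext => x; rewrite mulrAC normal_pdf_tilt// mulrAC mulrA.
apply: integrable_EFinZ => //.
apply: (@integrable_bounded_normal_pdf _ _ _ 1); last by move=> x; exact: cos_max.
apply: measurableT_comp; first (apply: continuous_measurable_fun; exact: continuous_cos).
by apply: measurable_funD => //; exact: measurable_funM.
Qed.

(** One step of Gaussian conditioning: the integral met when a coordinate is
    averaged over a normal variable. *)
Lemma normal_integral_quad a b y d : 0 <= a ->
  \int[leb]_x (expR (- (a * x ^+ 2 / 2) - b * x) * cos (y + d * x) * normal_pdf 0 1 x) =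
  (Num.sqrt (1 + a))^-1 * expR ((b ^+ 2 - d ^+ 2) / (2 * (1 + a))) *
  cos (y - b * d / (1 + a)).
Proof.
move=> a0; have a1 : 0 < 1 + a by rewrite ltr_pwDl.
have s0 : 0 < Num.sqrt (1 + a) by rewrite sqrtr_gt0.
pose m := - (b / (1 + a)); pose s := (Num.sqrt (1 + a))^-1.
have sN0 : s != 0 by rewrite invr_eq0 gt_eqF.
transitivity (\int[leb]_x (s * expR (b ^+ 2 / (2 * (1 + a))) *
    (cos (y + d * m + d * (x - m)) * normal_pdf m s x))).
  apply: eq_Rintegral => x _; rewrite mulrAC normal_pdf_tilt// -/s -/m.
  rewrite [LHS]mulrAC -mulrA; congr (_ * (cos _ * _)); ring.
rewrite RintegralZl//; last first.
  apply: (@integrable_bounded_normal_pdf _ _ _ 1); last by move=> x; exact: cos_max.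
  apply: measurableT_comp; first (apply: continuous_measurable_fun; exact: continuous_cos).
  by apply: measurable_funD => //; apply: measurable_funM => //; exact: measurable_funB.
rewrite normal_charE// mulrA -[s * _ * _]mulrA -expRD.
congr (_ * expR _ * cos _).
  by rewrite /s exprVn sqr_sqrtr ?(ltW a1)//; field; rewrite gt_eqF.
by rewrite /m; ring.
Qed.

End Gaussian.

Lemma sqrt_ge1 (R : realType) (u : R) : 1 <= u -> 1 <= Num.sqrt u.
Proof. by move=> u1; rewrite -[X in X <= _]sqrtr1 ler_wsqrtr. Qed.

(** * Semi-definite forms and Gaussian conditioning *)
Section form.
Context {R : realType} {V : lmodType R}.
Implicit Types (Q B : V -> V -> R) (x y z e : V) (t : R) (es : seq V).

Definition psd_form Q := [/\ forall x y, Q x y = Q y x,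
  forall a x y z, Q (a *: x + y) z = a * Q x z + Q y z & forall x, 0 <= Q x x].

Section psd.
Context (Q : V -> V -> R) (Qpsd : psd_form Q).

Lemma formC x y : Q x y = Q y x. Proof. by case: Qpsd. Qed.

Lemma form_ge0 x : 0 <= Q x x. Proof. by case: Qpsd. Qed.

Lemma form_linearl a x y z : Q (a *: x + y) z = a * Q x z + Q y z.
Proof. by case: Qpsd. Qed.

Lemma form_linearr a x y z : Q z (a *: x + y) = a * Q z x + Q z y.
Proof. by rewrite formC form_linearl !(formC _ z). Qed.

Lemma formDl x y z : Q (x + y) z = Q x z + Q y z.
Proof. by have := form_linearl 1 x y z; rewrite scale1r mul1r. Qed.

Lemma form0l z : Q 0 z = 0.
Proof. by have := formDl 0 0 z; rewrite addr0 => /eqP; rewrite -subr_eq0 opprD addNKr oppr_eq0 => /eqP. Qed.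

Lemma form0r z : Q z 0 = 0. Proof. by rewrite formC form0l. Qed.

Lemma formZl a x z : Q (a *: x) z = a * Q x z.
Proof. by have := form_linearl a x 0 z; rewrite addr0 form0l addr0. Qed.

Lemma formZr a x z : Q z (a *: x) = a * Q z x.
Proof. by rewrite formC formZl formC. Qed.

Lemma formDr x y z : Q z (x + y) = Q z x + Q z y.
Proof. by rewrite formC formDl !(formC _ z). Qed.

Lemma formBr x y z : Q z (x - y) = Q z x - Q z y.
Proof. by rewrite -scaleN1r formDr formZr mulN1r. Qed.

Lemma formBl x y z : Q (x - y) z = Q x z - Q y z.
Proof. by rewrite formC formBr !(formC z). Qed.

Lemma form_sqrD a x y : Q (y + a *: x) (y + a *: x) =
  Q y y + 2 * a * Q y x + a ^+ 2 * Q x x.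
Proof. by rewrite addrC !form_linearl !form_linearr (formC x y); ring. Qed.

Lemma form_CauchySchwarz x y : Q x y ^+ 2 <= Q x x * Q y y.
Proof.
have h a : 0 <= Q y y + 2 * a * Q y x + a ^+ 2 * Q x x.
  by rewrite -form_sqrD form_ge0.
have [Q0|Qx0] := eqVneq (Q x x) 0.
  rewrite Q0 mul0r.
  have := h (- (Q y y + 1) / (2 * Q y x)).
  have [yx0|yx0] := eqVneq (Q y x) 0; first by rewrite (formC x y) yx0 expr0n.
  rewrite Q0 mulr0 addr0 (_ : 2 * _ * _ = - (Q y y + 1)).
    by rewrite opprD addNKr oppr_ge0 ler10.
  by field.
have Qx : 0 < Q x x by rewrite lt_neqAle eq_sym Qx0 form_ge0.
have := h (- Q y x / Q x x).
rewrite (_ : _ + _ = (Q x x * Q y y - Q x y ^+ 2) / Q x x); last first.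
  by rewrite (formC x y); field.
by rewrite pmulr_lge0 ?invr_gt0// subr_ge0.
Qed.

End psd.

(** [t * schur t e Q] is the covariance of a centred Gaussian with covariance
    [t * Q] given its coordinate along [e], observed with an independent error
    of variance [1]. *)
Definition schur t e Q x y := Q x y - t * Q x e * Q y e / (1 + t * Q e e).

Section schur.
Variables (Q : V -> V -> R) (Qpsd : psd_form Q) (t : R) (t0 : 0 <= t) (e : V).

Lemma schur_den_gt0 : 0 < 1 + t * Q e e.
Proof. by rewrite ltr_pwDl// mulr_ge0// form_ge0. Qed.

Lemma schur_le x : schur t e Q x x <= Q x x.
Proof.
rewrite /schur gerBl divr_ge0 ?(ltW schur_den_gt0)// -mulrA mulr_ge0//.
by rewrite -expr2 sqr_ge0.
Qed.

Lemma schur_psd : psd_form (schur t e Q).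
Proof.
have d0 := schur_den_gt0; split.
- by move=> x y; rewrite /schur (formC Qpsd x y) -!mulrA (mulrCA (Q x e)).
- by move=> a x y z; rewrite /schur !(form_linearl Qpsd); ring.
- move=> x; rewrite /schur subr_ge0 ler_pdivrMr// -mulrA -expr2 mulrDr mulr1.
  rewrite (@le_trans _ _ (t * (Q x x * Q e e)))//.
    by rewrite ler_wpM2l//; exact: form_CauchySchwarz.
  by rewrite (mulrCA (Q x x)) lerDr form_ge0.
Qed.

End schur.

(** Covariance, up to the factor [t], after observing all the coordinates
    [es]. *)
Fixpoint conditioned t B es : V -> V -> R :=
  if es is e :: es' then schur t e (conditioned t B es') else B.

(** The integral of [gauss_weight es] for the centred Gaussian of covariance
    [t * B]. When the observations agree with the centre [eta], the conditional
    mean differs from [B eta] by [- conditioned t B es eta]; hence the form of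
    the exponent. *)
Fixpoint gauss_factor t B eta es : R :=
  if es is e :: es' then
    let Q := conditioned t B es' in
    gauss_factor t B eta es' * ((Num.sqrt (1 + t * Q e e))^-1 *
      expR (- (Q eta e ^+ 2 / (2 * (1 + t * Q e e)))))
  else 1.

Variables (B : V -> V -> R) (Bpsd : psd_form B).

Lemma conditioned_psd t es : 0 <= t -> psd_form (conditioned t B es).
Proof. by move=> t0; elim: es => [//|e es ih] /=; exact: schur_psd. Qed.

Lemma conditioned_le t es x : 0 <= t -> conditioned t B es x x <= B x x.
Proof.
move=> t0; elim: es => [//|e es ih] /=; apply: le_trans ih.
by apply: schur_le => //; exact: conditioned_psd.
Qed.

Lemma gauss_factor_ge0 t eta es : 0 <= gauss_factor t B eta es.
Proof.
elim: es => [|e es ih] /=; first exact: ler01.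
by rewrite !mulr_ge0 ?expR_ge0// invr_ge0 sqrtr_ge0.
Qed.

Lemma gauss_factor_le1 t eta es : 0 <= t -> gauss_factor t B eta es <= 1.
Proof.
move=> t0; elim: es => [//|e es ih] /=.
have Qpsd := conditioned_psd es t0.
have d1 : 1 <= 1 + t * conditioned t B es e e by rewrite lerDl mulr_ge0// form_ge0.
rewrite mulr_ile1 ?gauss_factor_ge0 ?mulr_ge0 ?invr_ge0 ?sqrtr_ge0 ?expR_ge0//.
rewrite mulr_ile1 ?invr_ge0 ?sqrtr_ge0 ?expR_ge0//.
  by rewrite invf_le1 ?sqrt_ge1// (lt_le_trans ltr01)// sqrt_ge1.
rewrite -[X in _ <= X]expR0 ler_expR oppr_le0 divr_ge0 ?sqr_ge0// mulr_ge0//.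
exact: le_trans d1.
Qed.

(** The exponents telescope: each is the decrease of [Q eta eta] in one
    conditioning step divided by [2 t], so that their sum is at most
    [B eta eta / (2 t)], whatever the number of observations. *)
Lemma gauss_factor_ge t eta es : 0 < t ->
  expR (- (B eta eta / (2 * t))) * \prod_(e <- es) (1 + t * B e e)^-1 <=
  gauss_factor t B eta es.
Proof.
move=> t0; have t0' := ltW t0.
suff : expR (- ((B eta eta - conditioned t B es eta eta) / (2 * t))) *
    \prod_(e <- es) (1 + t * B e e)^-1 <= gauss_factor t B eta es.
  apply: le_trans; rewrite ler_wpM2r//.
    by rewrite prodr_ge0// => e _; rewrite invr_ge0 addr_ge0// mulr_ge0// form_ge0.
  rewrite ler_expR lerN2 ler_wpM2r ?invr_ge0 ?mulr_ge0// gerBl.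
  by rewrite form_ge0//; exact: conditioned_psd.
elim: es => [|e es ih] /=.
  by rewrite big_nil subrr mul0r oppr0 expR0 mulr1.
have Qpsd := conditioned_psd es t0'; set Q := conditioned t B es in ih Qpsd *.
have d0 := schur_den_gt0 Qpsd t0' e.
rewrite big_cons [X in expR X](_ : _ = - ((B eta eta - Q eta eta) / (2 * t)) +
    - (Q eta e ^+ 2 / (2 * (1 + t * Q e e)))); last first.
  by rewrite /schur; field; rewrite !gt_eqF.
rewrite expRD [leLHS](_ : _ = (expR (- ((B eta eta - Q eta eta) / (2 * t))) *
    \prod_(e0 <- es) (1 + t * B e0 e0)^-1) * ((1 + t * B e e)^-1 *
    expR (- (Q eta e ^+ 2 / (2 * (1 + t * Q e e)))))); last by ring.
apply: ler_pM => //.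
- rewrite mulr_ge0 ?expR_ge0// prodr_ge0// => e0 _.
  by rewrite invr_ge0 addr_ge0// mulr_ge0// form_ge0.
- by rewrite mulr_ge0 ?expR_ge0// invr_ge0 addr_ge0// mulr_ge0// form_ge0.
rewrite ler_wpM2r ?expR_ge0// lef_pV2 ?posrE ?sqrtr_gt0//; last first.
  by rewrite ltr_pwDl// mulr_ge0// form_ge0.
apply: (@le_trans _ _ (1 + t * Q e e)); last first.
  by rewrite lerD2l ler_wpM2l// conditioned_le.
have d1 : 1 <= 1 + t * Q e e by rewrite lerDl mulr_ge0// form_ge0.
rewrite -[leRHS]sqr_sqrtr ?(ltW d0)// expr2 ler_peMl ?sqrtr_ge0//.
exact: sqrt_ge1.
Qed.

End form.

(** * Gaussian smoothing of a mixture *)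
Section Gaussian_smoothing.
Context {R : realType} {V : lmodType R} {d} {T : measurableType d}.
Variables (mu : probability T R) (X : V -> T -> R) (B : V -> V -> R).
Hypothesis mX : forall v, measurable_fun setT (X v).
Hypothesis X_linear : forall a u v w, X (a *: u + v) w = a * X u w + X v w.
Hypothesis Bpsd : psd_form B.
Notation leb := (@lebesgue_measure R).
Variables (n : nat -> nat) (wt tm : nat -> nat -> R) (F : R -> R).
Hypothesis wt_ge0 : forall N j, 0 <= wt N j.
Hypothesis tm_ge0 : forall N j, 0 <= tm N j.
Hypothesis wt_sum1 : forall N, \sum_(j < n N) wt N j = 1.
Hypothesis mixture_cvg : forall s, 0 <= s ->
  \sum_(j < n N) wt N j * expR (- (s * tm N j)) @[N --> \oo] --> F s.
Hypothesis muX : forall v c,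
  \int[mu]_w cos (X v w - c) = cos c * F (B v v / 2).

Let mu1 : mu setT = 1%E. Proof. exact: probability_setT. Qed.

Variable eta : V.
Implicit Types (es : seq V) (v : V) (c t : R).

Definition gauss_weight es (w : T) :=
  \prod_(e <- es) expR (- ((X e w - B eta e) ^+ 2 / 2)).

Lemma measurable_gauss_weight es : measurable_fun setT (gauss_weight es).
Proof.
elim: es => [|e es ih].
  by rewrite /gauss_weight; under eq_fun do rewrite big_nil; exact: measurable_cst.
rewrite (_ : gauss_weight _ = fun w => expR (- ((X e w - B eta e) ^+ 2 / 2)) * gauss_weight es w).
  apply: measurable_funM => //; apply: measurableT_comp => //.
  apply: measurableT_comp => //; apply: measurable_funM => //.
  by apply: measurable_funX; exact: measurable_funB.
by apply/funext => w; rewrite /gauss_weight big_cons.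
Qed.

Lemma gauss_weight_ge0 es w : 0 <= gauss_weight es w.
Proof. by apply: prodr_ge0 => e _; exact: expR_ge0. Qed.

Lemma gauss_weight_le1 es w : gauss_weight es w <= 1.
Proof.
rewrite /gauss_weight; elim: es => [|e es ih]; first by rewrite big_nil.
rewrite big_cons mulr_ile1 ?expR_ge0 ?gauss_weight_ge0//.
by rewrite -expR0 ler_expR oppr_le0 divr_ge0 ?sqr_ge0.
Qed.

Lemma integrable_bounded (f : T -> R) c : measurable_fun setT f ->
  (forall w, `|f w| <= c) -> mu.-integrable setT (EFin \o f).
Proof.
move=> mf fc; apply: measurable_bounded_integrable => //.
  by rewrite [X in (X < _)%E]mu1 ltry.
exists c; split; first exact: num_real.
by move=> x cx w _ /=; rewrite (le_trans (fc w))// ltW.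
Qed.

Lemma measurable_cos_pairing v c : measurable_fun setT (fun w => cos (X v w - c)).
Proof.
apply: measurableT_comp; first (apply: continuous_measurable_fun; exact: continuous_cos).
exact: measurable_funB.
Qed.

Definition smoothed es v c := \int[mu]_w (gauss_weight es w * cos (X v w - c)).

Lemma smoothed_le1 es v c : `|smoothed es v c| <= 1.
Proof.
have b w : `|gauss_weight es w * cos (X v w - c)| <= 1.
  rewrite normrM mulr_ile1// ?cos_max//.
  by rewrite ger0_norm ?gauss_weight_ge0// gauss_weight_le1.
have m : measurable_fun setT (fun w => gauss_weight es w * cos (X v w - c)).
  by apply: measurable_funM; [exact: measurable_gauss_weight|exact: measurable_cos_pairing].
apply: le_trans (le_normr_Rintegral _ _) _ => //; first exact: integrable_bounded b.
apply: (@le_trans _ _ (\int[mu]_w 1)).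
  apply: le_Rintegral => //.
  - apply: (@integrable_bounded _ 1); first exact: measurableT_comp.
    by move=> w; rewrite normr_id.
  - by apply: (@integrable_bounded _ 1) => // w; rewrite normr1.
by rewrite Rintegral_cst// [X in fine X]mu1 mul1r.
Qed.

Lemma gauss_cos (u y : R) :
  \int[leb]_x (cos (y + u * x) * normal_pdf 0 1 x) = expR (- (u ^+ 2 / 2)) * cos y.
Proof.
have := @normal_charE R 0 1 y u (oner_neq0 _); rewrite expr1n mul1r => <-.
by apply: eq_Rintegral => x _; rewrite subr0.
Qed.

(** The factor of [e] is the characteristic function of a normal variable [x]
    at [X e w - B eta e]. The phase that it adds to the cosine is a shift of
    [v] and [c], and Fubini's theorem exchanges the two integrals. *)
Lemma smoothed_cons e es v c : smoothed (e :: es) v c =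
  \int[leb]_x (smoothed es (v + x *: e) (c + x * B eta e) * normal_pdf 0 1 x).
Proof.
pose h (w : T) (x : R) := gauss_weight es w * cos (X v w - c + (X e w - B eta e) * x) * normal_pdf 0 1 x.
have mp : measurable_fun setT (@normal_pdf R 0 1) by exact: measurable_normal_pdf.
have mh : measurable_fun setT (fun z : T * R => h z.1 z.2).
  apply: measurable_funM; last exact: measurableT_comp.
  apply: measurable_funM; first by apply: measurableT_comp => //; exact: measurable_gauss_weight.
  apply: measurableT_comp; first (apply: continuous_measurable_fun; exact: continuous_cos).
  apply: measurable_funD.
    by apply: measurable_funB => //; exact: measurableT_comp.
  by apply: measurable_funM => //; apply: measurable_funB => //; exact: measurableT_comp.
have hle w x : `|h w x| <= normal_pdf 0 1 x.
  rewrite !normrM (ger0_norm (normal_pdf_ge0 _ _ _)) ler_piMl ?normal_pdf_ge0//.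
  rewrite mulr_ile1// ?cos_max// ger0_norm ?gauss_weight_ge0//.
  exact: gauss_weight_le1.
have mhw w : measurable_fun setT (h w).
  apply: measurable_funM => //; apply: measurable_funM => //.
  apply: measurableT_comp; first (apply: continuous_measurable_fun; exact: continuous_cos).
  by apply: measurable_funD => //; exact: measurable_funM.
have mhx x : measurable_fun setT (h ^~ x).
  apply: measurable_funM => //; apply: measurable_funM; first exact: measurable_gauss_weight.
  apply: measurableT_comp; first (apply: continuous_measurable_fun; exact: continuous_cos).
  apply: measurable_funD; first exact: measurable_funB.
  by apply: measurable_funM => //; exact: measurable_funB.
have ih : (mu \x leb)%E.-integrable setT (fun z : T * R => (h z.1 z.2)%:E).
  apply/integrable12ltyP => /=; first exact/measurable_EFinP.
  apply: (@le_lt_trans _ _ (\int[mu]_w 1)%E); last first.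
    by rewrite integral_cst// [X in (_ * X)%E]mu1 mule1 ltry.
  apply: ge0_le_integral => //.
  - by move=> w _; apply: integral_ge0.
  - apply: (@measurable_fun_fubini_tonelli_F _ _ _ _ _ leb (fun z : T * R => `|(h z.1 z.2)%:E|%E)) => //.
    by apply: measurableT_comp => //; exact/measurable_EFinP.
  move=> w _; rewrite -(integral_normal_pdf 0 1); apply: ge0_le_integral => //.
  - by apply/measurable_EFinP; apply: measurableT_comp => //; exact: mhw.
  - exact/measurable_EFinP.
  - by move=> x _; rewrite lee_fin.
have := Fubini ih => /=.
under eq_integral.
  move=> w _.
  have -> : (\int[leb]_x (h w x)%:E = (\int[leb]_x h w x)%:E)%E.
    rewrite fineK//; apply: integrable_fin_num => //.
    apply: (@le_integrable _ _ _ leb setT measurableT _ _ _ _ (integrable_normal_pdf 0 1)).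
      by apply/measurable_EFinP; exact: mhw.
    by move=> x _; rewrite lee_fin (le_trans (hle w x))// ler_norm.
  have -> : \int[leb]_x h w x = gauss_weight (e :: es) w * cos (X v w - c).
    rewrite /h; under eq_Rintegral do rewrite -mulrA.
    rewrite RintegralZl//; last first.
      apply: (@integrable_bounded_normal_pdf _ _ _ _ 1); last by move=> x; exact: cos_max.
      apply: measurableT_comp; first (apply: continuous_measurable_fun; exact: continuous_cos).
      by apply: measurable_funD => //; exact: measurable_funM.
    by rewrite gauss_cos /gauss_weight big_cons mulrCA mulrA.
  over.
under [RHS]eq_integral.
  move=> x _.
  have -> : (\int[mu]_w (h w x)%:E = (\int[mu]_w h w x)%:E)%E.
    rewrite fineK//; apply: integrable_fin_num => //.
    by apply: (@integrable_bounded _ (normal_pdf 0 1 x)) => // w; exact: mhx.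
  have -> : \int[mu]_w h w x = smoothed es (v + x *: e) (c + x * B eta e) * normal_pdf 0 1 x.
    rewrite /h RintegralZr//; last first.
      apply: (@integrable_bounded _ 1).
        apply: measurable_funM; first exact: measurable_gauss_weight.
        apply: measurableT_comp; first (apply: continuous_measurable_fun; exact: continuous_cos).
        apply: measurable_funD; first exact: measurable_funB.
        by apply: measurable_funM => //; exact: measurable_funB.
      move=> w; rewrite normrM mulr_ile1// ?cos_max// ger0_norm ?gauss_weight_ge0//.
      exact: gauss_weight_le1.
    congr (_ * _); apply: eq_Rintegral => w _; congr (_ * cos _).
    rewrite (addrC v) X_linear; ring.
  over.
by rewrite /smoothed /Rintegral => ->.
Qed.

(** The value of [smoothed] for the centred Gaussian of covariance [t * B]: the
    law conditioned by [es] has covariance [t * conditioned t B es] and mean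
    [B eta - conditioned t B es eta]. *)
Definition mixed t es v c : R := gauss_factor t B eta es *
  expR (- (conditioned t B es v v / 2 * t)) *
  cos (c - B eta v + conditioned t B es eta v).

Lemma mixed00 t es : 0 <= t -> mixed t es 0 0 = gauss_factor t B eta es.
Proof.
move=> t0; have Qpsd := conditioned_psd Bpsd es t0.
by rewrite /mixed !(form0r Qpsd) (form0r Bpsd) subrr addr0 cos0 !mul0r oppr0 expR0 !mulr1.
Qed.

Lemma mixed_cons t e es v c : 0 <= t ->
  \int[leb]_x (mixed t es (v + x *: e) (c + x * B eta e) * normal_pdf 0 1 x) =
  mixed t (e :: es) v c.
Proof.
move=> t0; have Qpsd := conditioned_psd Bpsd es t0.
rewrite /mixed/=; set Q := conditioned t B es in Qpsd *; set A := gauss_factor t B eta es.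
have Qe := form_ge0 Qpsd e.
transitivity (\int[leb]_x (A * expR (- (Q v v / 2 * t)) *
  (expR (- (t * Q e e * x ^+ 2 / 2) - t * Q v e * x) *
   cos (c - B eta v + Q eta v + Q eta e * x) * normal_pdf 0 1 x))).
  apply: eq_Rintegral => x _; rewrite (form_sqrD Qpsd) !(formDr Bpsd) !(formDr Qpsd)
    !(formZr Bpsd) !(formZr Qpsd).
  rewrite !mulrA; congr (_ * _).
  rewrite -[in RHS](mulrA A) -expRD; congr (_ * expR _ * cos _); first by field.
  by ring.
rewrite RintegralZl//; last first.
  by apply: integrable_normal_quad; rewrite mulr_ge0.
rewrite normal_integral_quad ?mulr_ge0// /schur.
rewrite (_ : A * _ * _ = A * (Num.sqrt (1 + t * Q e e))^-1 * (expR (- (Q v v / 2 * t)) *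
   expR (((t * Q v e) ^+ 2 - Q eta e ^+ 2) / (2 * (1 + t * Q e e)))) *
   cos (c - B eta v + Q eta v - t * Q v e * Q eta e / (1 + t * Q e e))); last by ring.
rewrite [RHS](_ : _ = A * (Num.sqrt (1 + t * Q e e))^-1 *
   (expR (- (Q eta e ^+ 2 / (2 * (1 + t * Q e e)))) *
    expR (- ((Q v v - t * Q v e * Q v e / (1 + t * Q e e)) / 2 * t))) *
   cos (c - B eta v + (Q eta v - t * Q eta e * Q v e / (1 + t * Q e e)))); last by ring.
rewrite -!expRD; congr (_ * expR _ * cos _); last by ring.
field.
by rewrite gt_eqF// ltr_pwDl// mulr_ge0.
Qed.

Lemma mixed_le1 t es v c : 0 <= t -> `|mixed t es v c| <= 1.
Proof.
move=> t0; rewrite /mixed !normrM mulr_ile1 ?mulr_ge0 ?cos_max//.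
rewrite mulr_ile1//; first by rewrite ger0_norm ?gauss_factor_ge0 ?gauss_factor_le1.
rewrite ger0_norm ?expR_ge0// -expR0 ler_expR oppr_le0 mulr_ge0// divr_ge0//.
by apply: form_ge0; exact: conditioned_psd.
Qed.

Lemma mixed_measurable t es v e c b : 0 <= t ->
  measurable_fun setT (fun x : R => mixed t es (v + x *: e) (c + x * b)).
Proof.
move=> t0; have Qpsd := conditioned_psd Bpsd es t0.
rewrite /mixed; apply: measurable_funM.
  apply: measurable_funM => //; apply: measurableT_comp => //; apply: measurableT_comp => //.
  apply: measurable_funM => //; apply: measurable_funM => //.
  under eq_fun do rewrite (form_sqrD Qpsd).
  apply: measurable_funD; last by apply: measurable_funM => //; exact: measurable_funX.
  apply: measurable_funD => //; apply: measurable_funM => //; exact: measurable_funM.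
apply: measurableT_comp; first (apply: continuous_measurable_fun; exact: continuous_cos).
under eq_fun do rewrite !(formDr Bpsd) !(formDr Qpsd) !(formZr Bpsd) !(formZr Qpsd).
apply: measurable_funD.
  apply: measurable_funB; first by apply: measurable_funD => //; exact: measurable_funM.
  by apply: measurable_funD => //; exact: measurable_funM.
by apply: measurable_funD => //; exact: measurable_funM.
Qed.

(** By induction on [es]: [smoothed] and the mixtures of [mixed] satisfy the
    same recurrence, an average over a normal variable, to which dominated
    convergence applies. The base case is the hypothesis on the cosine
    transform of [mu]. *)
Lemma smoothed_cvg es v c :
  \sum_(j < n N) wt N j * mixed (tm N j) es v c @[N --> \oo] --> smoothed es v c.
Proof.
elim: es v c => [|e es ih] v c.
  rewrite /smoothed; under eq_Rintegral do rewrite /gauss_weight big_nil mul1r.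
  rewrite muX mulrC.
  have h : (\sum_(j < n N) wt N j * expR (- (B v v / 2 * tm N j))) * cos c @[N --> \oo] -->
      F (B v v / 2) * cos c.
    by apply: cvgMl; apply: mixture_cvg; rewrite divr_ge0// form_ge0.
  apply: cvg_trans h; apply: near_eq_cvg; near=> N.
  rewrite mulr_suml; apply: eq_bigr => j _.
  by rewrite /mixed/= mul1r subrK mulrA.
rewrite smoothed_cons.
pose g N x := \sum_(j < n N) wt N j * mixed (tm N j) es (v + x *: e) (c + x * B eta e).
have g1 N x : `|g N x| <= 1.
  rewrite (le_trans (ler_norm_sum _ _ _))// -(wt_sum1 N); apply: ler_sum => j _.
  by rewrite normrM (ger0_norm (wt_ge0 _ _)) ler_piMr// mixed_le1.
have mm N j : measurable_fun setT (fun x : R => mixed (tm N j) es (v + x *: e) (c + x * B eta e)).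
  exact: mixed_measurable.
have mg N : measurable_fun setT (g N).
  by apply: measurable_sum => j; exact: measurable_funM.
have mp : measurable_fun setT (@normal_pdf R 0 1) by exact: measurable_normal_pdf.
have -> : (fun N => \sum_(j < n N) wt N j * mixed (tm N j) (e :: es) v c) =
  (fun N => \int[leb]_x (g N x * normal_pdf 0 1 x)).
  apply/funext => N; rewrite /g.
  under eq_Rintegral do rewrite mulr_suml.
  rewrite Rintegral_sum//; last first.
    move=> j; under eq_fun do rewrite -mulrA.
    apply: integrable_EFinZ => //.
    by apply: (@integrable_bounded_normal_pdf _ _ _ _ 1) => // x; exact: mixed_le1.
  apply: eq_bigr => j _; under eq_Rintegral do rewrite -mulrA.
  rewrite RintegralZl ?mixed_cons//.
  by apply: (@integrable_bounded_normal_pdf _ _ _ _ 1) => // x; exact: mixed_le1.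
have ip := integrable_normal_pdf (0 : R) 1.
have msm : measurable_fun setT
    (fun x : R => smoothed es (v + x *: e) (c + x * B eta e) * normal_pdf 0 1 x).
  apply: measurable_funM => //.
  apply: (@measurable_fun_cvg _ _ _ _ g) => // x _; exact: ih.
have sle x : `|smoothed es (v + x *: e) (c + x * B eta e) * normal_pdf 0 1 x| <= normal_pdf 0 1 x.
  by rewrite normrM (ger0_norm (normal_pdf_ge0 _ _ _)) ler_piMl ?normal_pdf_ge0// smoothed_le1.
apply: fine_cvg; rewrite fineK; last first.
  apply: integrable_fin_num => //.
  apply: (@le_integrable _ _ _ leb setT measurableT _ _ _ _ ip); first exact/measurable_EFinP.
  by move=> x _; rewrite lee_fin (le_trans (sle x))// ler_norm.
apply: (@dominated_cvg _ _ _ leb setT measurableT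
  (fun N x => (g N x * normal_pdf 0 1 x)%:E) _ (fun x => (normal_pdf 0 1 x)%:E)) => //.
- by move=> N; apply/measurable_EFinP; apply: measurable_funM; [exact: mg|exact: mp].
- by move=> x _; apply: cvg_EFin; [exact: nearW|apply: cvgMl; exact: ih].
- move=> N x _; rewrite lee_fin normrM (ger0_norm (normal_pdf_ge0 _ _ _)).
  by rewrite ler_piMl ?normal_pdf_ge0// g1.
Unshelve. all: by end_near. Qed.

(** Keep only the terms [t0 <= tm N j <= t1] of the mixture and bound
    [gauss_factor] on this interval, where its worst values are at the ends. *)
Lemma smoothed_ge es t0 t1 k : 0 < t0 -> 0 < t1 -> 0 <= k ->
  (\forall N \near \oo, k <= \sum_(j < n N | t0 <= tm N j <= t1) wt N j) ->
  k * (expR (- (B eta eta / (2 * t0))) * \prod_(e <- es) (1 + t1 * B e e)^-1) <=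
  \int[mu]_w gauss_weight es w.
Proof.
move=> t00 t10 k0 hk.
have := @smoothed_cvg es 0 0; rewrite /smoothed.
have X0 w : X 0 w = 0.
  have := X_linear 1 0 0 w; rewrite scale1r addr0 mul1r => /eqP.
  by rewrite -subr_eq0 opprD addNKr oppr_eq0 => /eqP.
under eq_Rintegral do rewrite X0 subr0 cos0 mulr1.
move=> h; rewrite -(cvg_lim _ h)//; apply: limr_ge; first by apply/cvg_ex; eexists; exact: h.
near=> N.
have hkN : k <= \sum_(j < n N | t0 <= tm N j <= t1) wt N j by near: N.
set L := expR _ * _.
have L0 : 0 <= L.
  rewrite mulr_ge0 ?expR_ge0// prodr_ge0// => e _.
  by rewrite invr_ge0 addr_ge0// mulr_ge0 ?(ltW t10)// form_ge0.
apply: (@le_trans _ _ (\sum_(j < n N | t0 <= tm N j <= t1) wt N j * L)).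
  by rewrite -mulr_suml ler_wpM2r.
rewrite big_mkcond/=; apply: ler_sum => j _; case: ifPn => [/andP[tt0 tt1]|_]; last first.
  by rewrite mulr_ge0// mixed00// gauss_factor_ge0.
rewrite ler_wpM2l//.
have tp : 0 < tm N j by rewrite (lt_le_trans t00).
rewrite mixed00//; apply: le_trans (gauss_factor_ge Bpsd eta es tp); rewrite ler_pM ?expR_ge0//.
- rewrite prodr_ge0// => e _.
  by rewrite invr_ge0 addr_ge0// mulr_ge0 ?(ltW t10)// form_ge0.
- rewrite ler_expR lerN2 ler_wpM2l ?form_ge0// lef_pV2 ?posrE ?mulr_gt0//.
  by rewrite ler_wpM2l.
- apply: ler_prod => e _; rewrite invr_ge0 addr_ge0 ?mulr_ge0 ?(ltW t10) ?form_ge0//=.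
  rewrite lef_pV2 ?posrE ?ltr_pwDl ?mulr_ge0 ?(ltW t10) ?(ltW tp) ?form_ge0//.
  by rewrite lerD2l ler_wpM2r// form_ge0.
Unshelve. all: by end_near. Qed.

End Gaussian_smoothing.

(** * Orthonormal systems and Gram-Schmidt *)
Section orthosystem.
Context {R : realType} {V : lmodType R} (Q : V -> V -> R) (Qpsd : psd_form Q).
Implicit Types (x y : V) (e : nat -> V) (a : nat -> R) (n : nat).

Lemma form_suml (I : Type) (r : seq I) (P : pred I) (f : I -> V) y :
  Q (\sum_(i <- r | P i) f i) y = \sum_(i <- r | P i) Q (f i) y.
Proof.
elim: r => [|i r ih]; first by rewrite !big_nil (form0l Qpsd).
by rewrite !big_cons; case: ifP => // _; rewrite (formDl Qpsd) ih.
Qed.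

Lemma form_sumr (I : Type) (r : seq I) (P : pred I) (f : I -> V) y :
  Q y (\sum_(i <- r | P i) f i) = \sum_(i <- r | P i) Q y (f i).
Proof. by rewrite (formC Qpsd) form_suml; apply: eq_bigr => i _; rewrite (formC Qpsd). Qed.

Lemma form_sqrB x y : Q (x - y) (x - y) = Q x x - 2 * Q x y + Q y y.
Proof. by rewrite -scaleN1r (form_sqrD Qpsd); ring. Qed.

(** Zero vectors are allowed, so that Gram-Schmidt may be applied to families
    that are not free without discarding indices. *)
Definition orthosystem e :=
  (forall i j, i != j -> Q (e i) (e j) = 0) /\
  (forall i, Q (e i) (e i) = 1 \/ e i = 0).

Definition lincomb e a n := \sum_(k < n) a k *: e k.

Section bessel.
Variables (e : nat -> V) (oe : orthosystem e).

Lemma orthosystem_le1 i : Q (e i) (e i) <= 1.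
Proof. by case: (oe.2 i) => ->; rewrite ?(form0l Qpsd). Qed.

Lemma orthosystem_mulr x i : Q x (e i) * Q (e i) (e i) = Q x (e i).
Proof. by case: (oe.2 i) => ->; rewrite ?mulr1// (form0r Qpsd) mul0r. Qed.

Lemma form_lincomb x a n : Q x (lincomb e a n) = \sum_(k < n) a k * Q x (e k).
Proof. by rewrite /lincomb form_sumr; apply: eq_bigr => k _; rewrite (formZr Qpsd). Qed.

Lemma lincomb_form a n k : (k < n)%N -> Q (lincomb e a n) (e k) = a k * Q (e k) (e k).
Proof.
move=> kn; rewrite (formC Qpsd) form_lincomb (bigD1 (Ordinal kn))//=.
rewrite big1 ?addr0// => j jk; rewrite oe.1 ?mulr0//.
by apply: contra jk => /eqP kj; apply/eqP/val_inj.
Qed.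

Lemma lincomb_sqr a n : Q (lincomb e a n) (lincomb e a n) =
  \sum_(k < n) a k ^+ 2 * Q (e k) (e k).
Proof.
rewrite form_lincomb; apply: eq_bigr => k _.
by rewrite lincomb_form// mulrA -expr2.
Qed.

Lemma lincomb_sqr_le a n : Q (lincomb e a n) (lincomb e a n) <= \sum_(k < n) a k ^+ 2.
Proof.
by rewrite lincomb_sqr; apply: ler_sum => k _; rewrite ler_piMr ?sqr_ge0// orthosystem_le1.
Qed.

Lemma orthosystem_residual x n :
  let p := lincomb e (fun k => Q x (e k)) n in
  Q (x - p) (x - p) = Q x x - \sum_(k < n) Q x (e k) ^+ 2.
Proof.
move=> p; rewrite form_sqrB /p lincomb_sqr form_lincomb.
rewrite (eq_bigr (fun k : 'I_n => Q x (e k) ^+ 2)); last by move=> k _; rewrite expr2.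
rewrite [X in _ + X](eq_bigr (fun k : 'I_n => Q x (e k) ^+ 2)).
  by ring.
by move=> k _; rewrite expr2 -mulrA orthosystem_mulr.
Qed.

Lemma Bessel x n : \sum_(k < n) Q x (e k) ^+ 2 <= Q x x.
Proof. by rewrite -subr_ge0 -orthosystem_residual (form_ge0 Qpsd). Qed.

Lemma orthosystem_best x a n :
  let p := lincomb e (fun k => Q x (e k)) n in
  Q (x - p) (x - p) <= Q (x - lincomb e a n) (x - lincomb e a n).
Proof.
rewrite /= orthosystem_residual form_sqrB lincomb_sqr form_lincomb.
rewrite -subr_ge0.
rewrite (_ : _ - _ = \sum_(k < n) (Q x (e k) ^+ 2 - 2 * (a k * Q x (e k)) + a k ^+ 2 * Q (e k) (e k))).
  apply: sumr_ge0 => k _; case: (oe.2 k) => ek; last first.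
    by rewrite ek !(form0r Qpsd) !mulr0 expr0n/= subr0 addr0.
  rewrite ek mulr1 (_ : _ + _ = (Q x (e k) - a k) ^+ 2) ?sqr_ge0//; ring.
rewrite big_split/= sumrB mulr_sumr; ring.
Qed.

End bessel.

Section Gram_Schmidt.
Hypothesis Qdef : forall x, Q x x = 0 -> x = 0.
Variable phi : nat -> V.

Definition normalize x := (Num.sqrt (Q x x))^-1 *: x.

Fixpoint gs_seq n : seq V :=
  if n is n'.+1 then
    rcons (gs_seq n') (normalize (phi n' - \sum_(v <- gs_seq n') Q (phi n') v *: v))
  else [::].

Definition gs n := normalize (phi n - \sum_(v <- gs_seq n) Q (phi n) v *: v).

Lemma gs_seqE n : gs_seq n = mkseq gs n.
Proof. by elim: n => [//|n ih]; rewrite mkseqS -ih. Qed.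

Definition gs_residual n := phi n - lincomb gs (fun k => Q (phi n) (gs k)) n.

Lemma gsE n : gs n = normalize (gs_residual n).
Proof.
rewrite /gs gs_seqE /mkseq big_map; congr (normalize (_ - _)).
by rewrite /lincomb -(big_mkord xpredT (fun k => Q (phi n) (gs k) *: gs k)) /index_iota subn0.
Qed.

Lemma normalize_sqr x : Q (normalize x) (normalize x) = 1 \/ normalize x = 0.
Proof.
rewrite /normalize; have [Q0|Q0] := eqVneq (Q x x) 0.
  by right; rewrite Q0 sqrtr0 invr0 scale0r.
left; rewrite (formZl Qpsd) (formZr Qpsd) mulrA -invfM -expr2 sqr_sqrtr ?(form_ge0 Qpsd)//.
by rewrite mulVf.
Qed.

Lemma gs_orthosystem : orthosystem gs.
Proof.
have n1 i : Q (gs i) (gs i) = 1 \/ gs i = 0 by rewrite gsE; exact: normalize_sqr.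
split => //.
suff H n : forall i j, (i < n)%N -> (j < i)%N -> Q (gs i) (gs j) = 0.
  move=> i j; rewrite neq_ltn => /orP[ij|ji].
    by rewrite (formC Qpsd) (H j.+1).
  by rewrite (H i.+1).
elim: n => [//|n ih] i j; rewrite ltnS leq_eqVlt => /predU1P[->|]; last exact: ih.
move=> jn; rewrite [gs n]gsE /normalize (formZl Qpsd).
have -> : Q (gs_residual n) (gs j) = 0; last by rewrite mulr0.
rewrite /gs_residual -scaleN1r (formDl Qpsd) (formZl Qpsd) (formC Qpsd (lincomb _ _ _)).
rewrite form_lincomb (bigD1 (Ordinal jn))//= big1 ?addr0; last first.
  move=> k kj.
  have : k != j :> nat by apply: contra kj => /eqP kj; apply/eqP/val_inj.
  rewrite neq_ltn => /orP[kj'|jk]; first by rewrite ih ?mulr0.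
  by rewrite (formC Qpsd (gs j)) ih ?mulr0.
case: (n1 j) => ->; first by rewrite mulr1 mulN1r subrr.
by rewrite !(form0r Qpsd) !mulr0 addr0.
Qed.

Lemma gs_expand n : phi n = lincomb gs (fun k => Q (phi n) (gs k)) n.+1.
Proof.
have o := gs_orthosystem.
rewrite /lincomb big_ord_recr/= -/(lincomb gs (fun k => Q (phi n) (gs k)) n).
apply/eqP; rewrite addrC -subr_eq -/(gs_residual n); apply/eqP.
have -> : Q (phi n) (gs n) = Q (gs_residual n) (gs n).
  rewrite /gs_residual -scaleN1r (formDl Qpsd) (formZl Qpsd) (formC Qpsd (lincomb _ _ _)).
  rewrite form_lincomb big1 ?mulr0 ?addr0// => k _.
  by rewrite o.1 ?mulr0// gtn_eqF.
set r := gs_residual n.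
rewrite [gs n]gsE -/r /normalize (formZr Qpsd) scalerA.
have [r0|r0] := eqVneq (Q r r) 0; first by rewrite (Qdef r0) scaler0.
have s0 : Num.sqrt (Q r r) != 0 by rewrite gt_eqF// sqrtr_gt0 lt_neqAle eq_sym r0 (form_ge0 Qpsd).
have {2}-> : Q r r = Num.sqrt (Q r r) ^+ 2 by rewrite sqr_sqrtr// (form_ge0 Qpsd).
rewrite expr2 mulKf// mulfV// scale1r//.
Qed.

Lemma gs_subspace (S : V -> Prop) : (forall (a : R) (x y : V), S x -> S y -> S (a *: x + y)) ->
  S 0 -> (forall n, S (phi n)) -> forall n, S (gs n).
Proof.
move=> Slin S0 Sphi n; elim/ltn_ind: n => n ih.
rewrite gsE /normalize -[_ *: _]addr0; apply: (Slin) => //.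
rewrite /gs_residual addrC -scaleN1r; apply: (Slin) => //.
rewrite /lincomb; elim/big_ind : _ => // [x y Sx Sy|i _].
  by rewrite -[x]scale1r; exact: (Slin).
by rewrite -[_ *: _]addr0; apply: (Slin) => //; exact: ih.
Qed.

Lemma gs_expand_le n m : (n < m)%N -> phi n = lincomb gs (fun k => Q (phi n) (gs k)) m.
Proof.
move=> nm; rewrite {1}gs_expand; rewrite -(subnKC nm) /lincomb big_split_ord/=.
rewrite [X in _ + X]big1 ?addr0// => k _.
rewrite {1}gs_expand (formC Qpsd) form_lincomb big1 ?scale0r// => i _.
by rewrite (gs_orthosystem).1 ?mulr0// gtn_eqF// (leq_trans (ltn_ord i))// leq_addr.
Qed.

End Gram_Schmidt.
End orthosystem.

Section Hilbert_Schmidt_finite.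
Context {R : realType} {V W : lmodType R}.
Variables (Q : V -> V -> R) (Qpsd : psd_form Q).
Variables (P : W -> W -> R) (Ppsd : psd_form P) (Pdef : forall x, P x x = 0 -> x = 0).
Variable J : {linear V -> W}.

(** The vectors on the left are the images by [J] of the projections of the
    [e k] on the span of the [b i]. Expand over an orthonormal system of the
    range of [J]: an operator and its adjoint have the same Hilbert-Schmidt
    norm, and that of the adjoint is bounded in any system by Bessel's
    inequality. *)
Lemma Hilbert_Schmidt_swap (e b : nat -> V) n m :
  orthosystem Q e -> orthosystem Q b ->
  \sum_(k < n) P (J (lincomb b (fun i => Q (e k) (b i)) m))
                 (J (lincomb b (fun i => Q (e k) (b i)) m)) <=
  \sum_(i < m) P (J (b i)) (J (b i)).
Proof.
move=> oe ob; pose h := gs P (J \o b); have oh : orthosystem P h by exact: gs_orthosystem.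
pose c i l := P (J (b i)) (h l).
pose u l := lincomb b (c ^~ l) m.
apply: (@le_trans _ _ (\sum_(k < n) \sum_(l < m) Q (e k) (u l) ^+ 2)).
  apply: ler_sum => k _.
  rewrite (_ : J _ = lincomb h (fun l => Q (e k) (u l)) m).
    exact: lincomb_sqr_le.
  rewrite /lincomb linear_sum/=.
  transitivity (\sum_(i < m) \sum_(l < m) (Q (e k) (b i) * c i l) *: h l).
    apply: eq_bigr => i _; rewrite linearZ/=.
    have /= -> := @gs_expand_le _ _ _ Ppsd Pdef (J \o b) i m (ltn_ord i).
    by rewrite /lincomb scaler_sumr; apply: eq_bigr => l _; rewrite scalerA.
  rewrite exchange_big/=; apply: eq_bigr => l _; rewrite -scaler_suml; congr (_ *: _).
  by rewrite /u form_lincomb//; apply: eq_bigr => i _; rewrite mulrC.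
rewrite exchange_big/=.
apply: (@le_trans _ _ (\sum_(l < m) Q (u l) (u l))).
  apply: ler_sum => l _.
  rewrite (eq_bigr (fun k : 'I_n => Q (u l) (e k) ^+ 2)); last first.
    by move=> k _; rewrite (formC Qpsd).
  exact: (Bessel Qpsd oe).
apply: (@le_trans _ _ (\sum_(l < m) \sum_(i < m) c i l ^+ 2)).
  by apply: ler_sum => l _; exact: (lincomb_sqr_le Qpsd ob).
rewrite exchange_big/=; apply: ler_sum => i _; exact: (Bessel Ppsd oh).
Qed.

End Hilbert_Schmidt_finite.

Lemma cvg_initial_topology (S : choiceType) (T : topologicalType) (f : S -> T)
    (F : set_system S) {FF : Filter F} (s : S) :
  f @ F --> f s -> F --> (s : initial_topology f).
Proof.
move=> fF U; rewrite nbhsE => -[U' [[A oA <-] As] U'U].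
by apply: filterS U'U _; apply: fF; exact: open_nbhs_nbhs.
Qed.

(** * Hilbert spaces *)
Section inner_product.
Context {R : realType} {V : normedModType R} {dot : V -> V -> R}.
Hypothesis idot : inner_product dot.
Implicit Types x y : V.

Lemma inner_product_psd : psd_form dot.
Proof. by case: idot => dC dl dn; split => // x; rewrite dn sqr_ge0. Qed.

Lemma inner_product_sqr x : dot x x = `|x| ^+ 2.
Proof. by case: idot. Qed.

Lemma inner_product_def x : dot x x = 0 -> x = 0.
Proof. by rewrite inner_product_sqr => /eqP; rewrite sqrf_eq0 normr_eq0 => /eqP. Qed.

Lemma inner_product_le x y : `|dot x y| <= `|x| * `|y|.
Proof.
rewrite -(@ler_pXn2r _ 2) ?nnegrE ?mulr_ge0// exprMn real_normK ?num_real//.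
by rewrite -!inner_product_sqr; exact: form_CauchySchwarz inner_product_psd _ _.
Qed.

Lemma lincomb_norm_le (e : nat -> V) (a : nat -> R) n : orthosystem dot e ->
  `|lincomb e a n| ^+ 2 <= \sum_(k < n) a k ^+ 2.
Proof.
by move=> oe; rewrite -inner_product_sqr; apply: lincomb_sqr_le => //; exact: inner_product_psd.
Qed.

End inner_product.

Section orthogonal_series.
Context {R : realType} {V : completeNormedModType R} {dot : V -> V -> R}.
Hypothesis idot : inner_product dot.

Lemma lincomb_series (e : nat -> V) (a : nat -> R) :
  lincomb e a = series (fun k => a k *: e k).
Proof. by apply/funext => n; rewrite /series/= big_mkord. Qed.

Lemma lincomb_cvg (e : nat -> V) (a : nat -> R) C : orthosystem dot e ->
  (forall n, \sum_(k < n) a k ^+ 2 <= C) -> cvgn (lincomb e a).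
Proof.
move=> oe aC; rewrite lincomb_series; apply/cauchy_cvgP/cauchy_seriesP => eps e0.
have : cvgn (series (fun k => a k ^+ 2)).
  apply: nondecreasing_is_cvgn.
    by apply: nondecreasing_series => n _ _; exact: sqr_ge0.
  by exists C => _ [n _ <-]; rewrite /series/= big_mkord.
move=> /cauchy_cvgP/cauchy_seriesP/(_ _ (exprn_gt0 2 e0)).
apply: filterS => -[m n] /=.
have [nm|mn] := leqP n m; first by rewrite !big_geq// !normr0.
move=> h; rewrite -(@ltr_pXn2r _ 2) ?nnegrE ?(ltW e0)//.
apply: le_lt_trans h; rewrite ger0_norm; last by apply: sumr_ge0 => k _; exact: sqr_ge0.
pose a' k := if (m <= k)%N then a k else 0.
have E (W : zmodType) (f : nat -> W) : \sum_(m <= k < n) f k =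
    \sum_(k < n) (if (m <= k)%N then f k else 0).
  rewrite -(big_mkord xpredT (fun k => if (m <= k)%N then f k else 0)).
  rewrite (big_cat_nat (leq0n m) (ltnW mn))/= [X in _ = X + _]big_nat [X in _ = X + _]big1 ?add0r; last first.
    by move=> k /andP[_ km]; rewrite leqNgt km.
  by rewrite !big_nat; apply: eq_bigr => k /andP[-> _].
rewrite !E.
have -> : \sum_(k < n) (if (m <= k)%N then a k *: e k else 0) = lincomb e a' n.
  by apply: eq_bigr => k _; rewrite /a'; case: ifP => // _; rewrite scale0r.
apply: le_trans (lincomb_norm_le idot a' n oe) _; apply: ler_sum => k _.
by rewrite /a'; case: ifP => // _; rewrite expr0n.
Qed.

Lemma inner_productr_cvg (T : Type) (F : set_system T) {FF : Filter F}
    (u : T -> V) x l : u @ F --> l -> dot x (u t) @[t --> F] --> dot x l.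
Proof.
move=> ul; have psd := inner_product_psd idot.
apply/cvgrPdist_le => eps e0.
have x1 : 0 < `|x| + 1 by rewrite ltr_wpDl.
move/cvgrPdist_le : ul => /(_ (eps / (`|x| + 1))).
rewrite divr_gt0// => /(_ isT); apply: filterS => n h.
have -> : dot x l - dot x (u n) = dot x (l - u n).
  by rewrite (formBr psd).
apply: le_trans (inner_product_le idot _ _) _.
apply: (@le_trans _ _ ((`|x| + 1) * (eps / (`|x| + 1)))).
  by rewrite ler_pM// lerDl.
by rewrite mulrCA divff ?mulr1// gt_eqF.
Qed.

Lemma lincomb_lim_form (e : nat -> V) (a : nat -> R) y k : orthosystem dot e ->
  lincomb e a @ \oo --> y -> dot y (e k) = a k * dot (e k) (e k).
Proof.
move=> oe /(@inner_productr_cvg _ _ _ _ (e k)) h.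
have psd := inner_product_psd idot.
rewrite (formC psd); rewrite -(cvg_lim _ h)//; apply/cvg_lim => //.
apply: (cvg_trans _ (@cvg_cst _ (a k * dot (e k) (e k)) _ \oo _)).
apply: near_eq_cvg; near=> n.
rewrite (formC psd) lincomb_form//.
by near: n; exact: nbhs_infty_gt.
Unshelve. all: by end_near. Qed.

Lemma norm_lim_le (u : nat -> V) y C : u @ \oo --> y -> (forall n, `|u n| <= C) -> `|y| <= C.
Proof.
move=> uy uC; have h : `|u n| @[n --> \oo] --> `|y| by apply: cvg_norm.
rewrite -(cvg_lim _ h)//; apply: limr_le; first by apply/cvg_ex; eexists; exact: h.
by near=> n; exact: uC.
Unshelve. all: by end_near. Qed.

End orthogonal_series.

(** * The nuclear space and its dual *)
Section nuclear.
Context {R : realType} (H : nuclear_triple R).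
Implicit Types (phi psi eta : nuclear H) (p q n : nat) (w : dual (nuclear H)).

Definition pnorm p phi := `|nuclear_comp p phi|.

Definition pform p phi psi := dot (nuclear_comp p phi) (nuclear_comp p psi).

Lemma nuclear_compS p phi : incl H p (nuclear_comp p.+1 phi) = nuclear_comp p phi.
Proof. by apply: (@incl0_inj _ H p); rewrite incl0_nuclear_comp -[LHS]/(incl0 H p.+1 _) incl0_nuclear_comp. Qed.

Lemma pnorm_le p q phi : (p <= q)%N -> pnorm p phi <= pnorm q phi.
Proof.
elim: q => [|q ih]; first by rewrite leqn0 => /eqP ->.
rewrite leq_eqVlt => /predU1P[->//|]; rewrite ltnS => /ih /le_trans; apply.
by rewrite /pnorm -nuclear_compS incl_norm_le.
Qed.

Lemma pnorm_ge0 p phi : 0 <= pnorm p phi. Proof. exact: normr_ge0. Qed.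

Lemma pnormD p phi psi : pnorm p (phi + psi) <= pnorm p phi + pnorm p psi.
Proof. by rewrite /pnorm linearD ler_normD. Qed.

Lemma pnormZ p a phi : pnorm p (a *: phi) = `|a| * pnorm p phi.
Proof. by rewrite /pnorm linearZ normrZ. Qed.

Lemma pnormN p phi : pnorm p (- phi) = pnorm p phi.
Proof. by rewrite /pnorm linearN normrN. Qed.

Lemma pform_psd p : psd_form (pform p).
Proof.
have psd := inner_product_psd (dot_inner H p); split.
- by move=> x y; rewrite /pform (formC psd).
- by move=> a x y z; rewrite /pform linearP (form_linearl psd).
- by move=> x; exact: (form_ge0 psd).
Qed.

Lemma pform_sqr p phi : pform p phi phi = pnorm p phi ^+ 2.
Proof. exact: (inner_product_sqr (dot_inner H p)). Qed.

Lemma pform_le p phi psi : `|pform p phi psi| <= pnorm p phi * pnorm p psi.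
Proof. exact: (inner_product_le (dot_inner H p)). Qed.

Lemma nuclear_comp_inj p : injective (@nuclear_comp R H p).
Proof.
move=> x y xy; apply: val_inj => /=.
by rewrite -(incl0_nuclear_comp p x) xy incl0_nuclear_comp.
Qed.

Lemma pform_def p phi : pform p phi phi = 0 -> phi = 0.
Proof.
move=> /(inner_product_def (dot_inner H p)) h; apply: (@nuclear_comp_inj p).
by rewrite h linear0.
Qed.

Lemma nuclear_cvg (u : nat -> nuclear H) :
  (forall p, pnorm p (u n) @[n --> \oo] --> (0 : R)) -> u @ \oo --> (0 : nuclear H).
Proof.
move=> u0; apply: (@cvg_initial_topology _ _ (@nuclear_comps R H)).
apply/cvg_sup => p.
apply: (@cvg_initial_topology _ _ (fun g : prod_topology (hilb H) => g p)).
rewrite /nuclear_comps/= linear0.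
apply: norm_cvg0; exact: u0.
Qed.

Lemma dual_linear w : linear (dual_fun w).
Proof. by have /asboolP[] := dual_funP w. Qed.

Lemma dualD w phi psi : w (phi + psi) = w phi + w psi.
Proof. by have := dual_linear w 1 phi psi; rewrite !scale1r. Qed.

Lemma dual0 w : w 0 = 0.
Proof. by have := dualD w 0 0; rewrite addr0 => /eqP; rewrite -subr_eq0 opprD addNKr oppr_eq0 => /eqP. Qed.

Lemma dualZ w a phi : w (a *: phi) = a * w phi.
Proof. by have := dual_linear w a phi 0; rewrite addr0 dual0 addr0. Qed.

Lemma dualB w phi psi : w (phi - psi) = w phi - w psi.
Proof. by rewrite -scaleN1r dualD dualZ mulN1r. Qed.

(** Otherwise there would be vectors [u n] with [(n+1) pnorm n (u n) < |w (u n)|];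
    divided by [|w (u n)|], they tend to [0] in every norm whereas [w] has
    absolute value [1] on them. *)
Lemma dual_bounded w : exists p C, 0 <= C /\ forall phi, `|w phi| <= C * pnorm p phi.
Proof.
apply: contrapT => /forallNP wb.
have wb' p : exists phi, p.+1%:R * pnorm p phi < `|w phi|.
  apply: contrapT => /forallNP h; apply: (wb p); exists p.+1%:R; split => // phi.
  by rewrite leNgt; apply/negP/h.
have [u hu] := choice wb'.
have w0 n : 0 < `|w (u n)| by rewrite (le_lt_trans _ (hu n))// mulr_ge0// pnorm_ge0.
pose v n := `|w (u n)|^-1 *: u n.
have v0 : v @ \oo --> (0 : nuclear H).
  apply: nuclear_cvg => p.
  apply: (@squeeze_cvgr _ _ _ _ (fun=> 0) (@harmonic R)).
  - near=> n; rewrite pnorm_ge0/= /v pnormZ ger0_norm ?invr_ge0 ?(ltW (w0 n))//.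
    rewrite /harmonic/= ler_pdivrMl// mulrC ler_pdivlMl ?ltr0n//.
    apply: (@le_trans _ _ (n.+1%:R * pnorm n (u n))); last exact: ltW.
    rewrite ler_wpM2l// pnorm_le//.
    by near: n; exact: nbhs_infty_ge.
  - exact: cvg_cst.
  - exact: cvg_harmonic.
have /asboolP[_ wc] := dual_funP w.
have /cvgrPdist_lt/(_ _ ltr01)[n _ /(_ n (leqnn _))] : (w \o v) n @[n --> \oo] --> (w 0 : R).
  by apply: cvg_comp v0 _; exact: wc.
rewrite /= dual0 sub0r normrN /v dualZ normrM ger0_norm ?invr_ge0 ?(ltW (w0 n))//.
by rewrite mulVf ?ltxx// gt_eqF.
Unshelve. all: by end_near. Qed.

Definition dense_sequence (phi : nat -> nuclear H) :=
  forall p psi (eps : R), 0 < eps -> exists n, pnorm p (psi - phi n) < eps.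

Lemma countable_dense_sequence (T : topologicalType) (x0 : T) : separable T ->
  exists d : nat -> T, dense (range d).
Proof.
move=> [D cD dD].
have [d hd] : exists d : nat -> T, D `<=` range d.
  have /pfcard_geP[->|[f]] := cD; first by exists (fun=> x0); exact: sub0set.
  by exists f; exact: ('surj_f).
exists d => U U0 oU; have [x [Ux Dx]] := dD U U0 oU.
by exists x; split => //; exact: hd.
Qed.

(** A countable dense subset of [H p] may contain no element of [N]: for every
    [p], [i] and precision, pick instead in [N] a point that is close to its
    [i]-th element, whenever there is one. *)
Lemma nuclear_dense_sequence : exists phi : nat -> nuclear H, dense_sequence phi.
Proof.
have [d dd] : exists d : forall p, nat -> H p, forall p, dense (range (d p)).
  have h p : exists d : nat -> H p, dense (range d).
    by apply: (@countable_dense_sequence (H p) 0); exact: hilb_separable.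
  exists (fun p => projT1 (cid (h p))) => p; by case: cid.
pose P (pik : nat * nat * nat) phi := let: (p, i, k) := pik in
  `|nuclear_comp p phi - d p i| < k.+1%:R^-1.
have hP pik : exists phi, (exists psi, P pik psi) -> P pik phi.
  by have [[psi h]|h] := pselect (exists psi, P pik psi); [exists psi|exists 0 => /h].
have [f hf] := choice hP.
exists (fun n => f (odflt (0%N, 0%N, 0%N) (unpickle n))) => p psi eps e0.
have [k ke] : exists k : nat, k.+1%:R^-1 < eps / 2.
  exists (Num.truncn (eps / 2)^-1); rewrite invf_plt ?posrE ?ltr0n ?divr_gt0//.
  exact: truncnS_gt.
have k0 : (0 : R) < k.+1%:R^-1 by rewrite invr_gt0 ltr0n.
have [x [/= bx [i _ xi]]] := dd p (ball (nuclear_comp p psi) k.+1%:R^-1)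
  (ex_intro _ _ (ballxx (nuclear_comp p psi) k0)) (ball_open _ _).
move: bx; rewrite -xi -ball_normE/= => bx.
have fh : `|nuclear_comp p (f (p, i, k)) - d p i| < k.+1%:R^-1.
  by apply: (hf (p, i, k)); exists psi.
exists (pickle (p, i, k)); rewrite pickleK/=.
rewrite /pnorm linearB/= -(subrK (d p i) (nuclear_comp p psi)) -addrA.
apply: le_lt_trans (ler_normD _ _) _.
rewrite (distrC (d p i)) (_ : eps = eps / 2 + eps / 2); last by field.
by rewrite ltrD// (lt_trans _ ke).
Qed.

Lemma pform_gs_orthosystem p (phi : nat -> nuclear H) :
  orthosystem (@dot _ H p) (nuclear_comp p \o gs (pform p) phi).
Proof.
have [h1 h2] := gs_orthosystem (pform_psd p) phi; split => //.
by move=> i; have [h|h] := h2 i; [left|right; rewrite /= h linear0].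
Qed.

Lemma dual_span_le p w C (e : nat -> nuclear H) n : orthosystem (pform p) e -> 0 <= C ->
  (forall phi, `|w phi| <= C * pnorm p phi) ->
  \sum_(k < n) w (e k) ^+ 2 <= C ^+ 2.
Proof.
move=> oe C0 wC; set S := \sum_(k < n) _.
have S0 : 0 <= S by apply: sumr_ge0 => k _; exact: sqr_ge0.
have wS : w (lincomb e (fun k => w (e k)) n) = S.
  rewrite /lincomb /S; elim: n {S S0} => [|n ih]; first by rewrite !big_ord0 dual0.
  by rewrite !big_ord_recr/= dualD dualZ ih expr2.
have := wC (lincomb e (fun k => w (e k)) n); rewrite wS ger0_norm// => h.
have : S ^+ 2 <= C ^+ 2 * S.
  apply: (@le_trans _ _ ((C * pnorm p (lincomb e (fun k => w (e k)) n)) ^+ 2)).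
    by rewrite ler_pXn2r ?nnegrE ?mulr_ge0 ?pnorm_ge0.
  rewrite exprMn ler_wpM2l ?sqr_ge0// -pform_sqr.
  exact: (@lincomb_sqr_le _ _ _ (pform_psd p) e oe (fun k => w (e k)) n).
move: S0; rewrite le_eqVlt => /predU1P[<-|S0]; first by rewrite sqr_ge0.
by rewrite expr2 ler_pM2r.
Qed.

(** The representing vector is the sum of [w (e k) e k] over a system obtained
    from a dense sequence of [N]. It is a limit of elements of [N], which
    [nuclear_approx_ortho0] requires to identify it. *)
Lemma nuclear_dual_Riesz p w C (phi : nat -> nuclear H) : dense_sequence phi -> 0 <= C ->
  (forall psi, `|w psi| <= C * pnorm p psi) ->
  exists y : H p, [/\ `|y| <= C, forall psi, w psi = dot y (nuclear_comp p psi) &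
    forall eps, 0 < eps -> exists psi, `|y - nuclear_comp p psi| < eps].
Proof.
move=> dphi C0 wC; pose e := gs (pform p) phi.
have psd := inner_product_psd (dot_inner H p).
have oe : orthosystem (pform p) e by exact: gs_orthosystem (pform_psd p) _.
have oe' : orthosystem (@dot _ H p) (nuclear_comp p \o e) by exact: pform_gs_orthosystem.
have wsum n := dual_span_le n oe C0 wC.
pose a k := w (e k).
have := @lincomb_cvg _ _ _ (dot_inner H p) (nuclear_comp p \o e) a _ oe' wsum.
set u := lincomb _ _ => ucvg; pose y := limn u.
have uy : u @ \oo --> y by [].
have uE n : u n = nuclear_comp p (lincomb e a n).
  by rewrite /u /lincomb linear_sum; apply: eq_bigr => k _; rewrite linearZ.
have yC : `|y| <= C.
  apply: norm_lim_le uy _ => n; rewrite -(@ler_pXn2r _ 2) ?nnegrE//.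
  exact: le_trans (lincomb_norm_le (dot_inner H p) _ _ oe') (wsum n).
exists y; split => //; last first.
  move=> eps e0; have /cvgrPdist_lt/(_ _ e0)[n _ /(_ n (leqnn _))] := uy.
  by rewrite uE => h; exists (lincomb e a n).
have ye k : dot y (nuclear_comp p (e k)) = a k.
  rewrite (lincomb_lim_form (dot_inner H p) k oe' uy)/=.
  have [->|ek] := oe'.2 k; first by rewrite mulr1.
  rewrite /a (_ : e k = 0) ?dual0 ?mul0r//.
  by apply: (@nuclear_comp_inj p); rewrite [LHS]ek linear0.
have yphi n : w (phi n) = dot y (nuclear_comp p (phi n)).
  rewrite (gs_expand (pform_psd p) (@pform_def p) phi n) -/e.
  set b := fun k => _; elim: n.+1 => [|m ih].
    by rewrite /lincomb big_ord0 dual0 linear0 (form0r psd).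
  rewrite /lincomb big_ord_recr/= -/(lincomb e b m) dualD dualZ ih linearD linearZ/=.
  by rewrite (formDr psd) (formZr psd) ye.
move=> psi; apply/eqP; rewrite -subr_eq0 -normr_le0; apply/ler_addgt0Pl => eps e0.
rewrite addr0.
have CC : 0 < C + C + 1 by rewrite ltr_wpDl// addr_ge0.
have [n hn] := dphi p psi (eps / (C + C + 1)) (divr_gt0 e0 CC).
have -> : w psi - dot y (nuclear_comp p psi) =
    w (psi - phi n) - dot y (nuclear_comp p (psi - phi n)).
  rewrite dualB linearB (formBr psd) yphi; ring.
apply: le_trans (ler_normB _ _) _.
apply: (@le_trans _ _ ((C + C) * pnorm p (psi - phi n))).
  rewrite mulrDl lerD// (le_trans (inner_product_le (dot_inner H p) _ _))//.
  by rewrite ler_wpM2r.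
apply: (@le_trans _ _ ((C + C + 1) * (eps / (C + C + 1)))).
  by rewrite ler_pM ?addr_ge0 ?pnorm_ge0 ?lerDl// ltW.
by rewrite mulrCA divff ?mulr1// gt_eqF.
Qed.

End nuclear.

Lemma le0_eps (R : realType) (x K : R) : 0 <= K ->
  (forall eps, 0 < eps < 1 -> x <= K * eps) -> x <= 0.
Proof.
move=> K0 h; rewrite leNgt; apply/negP => x0.
have D0 : 0 < K + x + 1 by rewrite ltr_wpDl// addr_ge0// ltW.
have : x <= K * (x / (K + x + 1)).
  apply: h; rewrite divr_gt0//= ltr_pdivrMr// mul1r; lra.
rewrite mulrA ler_pdivlMr// mulrC; nra.
Qed.

(** * Hilbert-Schmidt operators *)
Section Hilbert_Schmidt.
Context {R : realType} {V W : normedModType R}.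
Variables (dotV : V -> V -> R) (dotW : W -> W -> R).
Hypotheses (iV : inner_product dotV) (iW : inner_product dotW).
Variable T : {linear V -> W}.
Hypothesis Tle : forall x, `|T x| <= `|x|.

Lemma seq_orthosystem (B : set V) (F : seq V) :
  (forall e e', B e -> B e' -> dotV e e' = (e == e')%:R) ->
  uniq F -> (forall v, v \in F -> B v) -> orthosystem dotV (nth 0 F).
Proof.
have psd := inner_product_psd iV.
move=> oB uF FB; split=> [i j ij|i].
  have [iF|iF] := ltnP i (size F); last by rewrite (nth_default _ iF) (form0l psd).
  have [jF|jF] := ltnP j (size F); last by rewrite (nth_default _ jF) (form0r psd).
  by rewrite oB ?nth_uniq ?(negbTE ij)//; apply: FB; exact: mem_nth.
have [iF|iF] := ltnP i (size F); last by right; rewrite nth_default.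
by left; rewrite oB ?eqxx//; apply: FB; exact: mem_nth.
Qed.

Lemma seq_span (F : seq V) m (a : 'I_m -> R) (b : 'I_m -> V) :
  uniq F -> (forall i, b i \in F) ->
  exists c : nat -> R, \sum_(i < m) a i *: b i = lincomb (nth 0 F) c (size F).
Proof.
move=> uF bF; exists (fun k => \sum_(i < m | b i == nth 0 F k) a i).
rewrite /lincomb -(big_mkord xpredT (fun k => (\sum_(i < m | b i == nth 0 F k) a i) *: nth 0 F k)).
rewrite -(big_nth 0 xpredT (fun v => (\sum_(i < m | b i == v) a i) *: v)).
under [RHS]eq_bigr => v _ do rewrite scaler_suml big_mkcond/=.
rewrite exchange_big/=; apply: eq_bigr => i _.
rewrite -big_mkcond/= (big_rem (b i))//= eqxx big_seq_cond big1 ?addr0// => v /andP[vF /eqP bv].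
by move: vF; rewrite mem_rem_uniq// inE bv eqxx.
Qed.

(** The definition gives one basis of [V] with finite sum; the sum over any
    other system is bounded by it. Since the basis only spans a dense subspace,
    the vectors [e k] are first replaced by projections on the span of finitely
    many basis vectors, up to an error that tends to [0]. *)
Lemma hilbert_schmidt_bound : hilbert_schmidt dotV T ->
  exists S : R, forall (e : nat -> V) n, orthosystem dotV e ->
    \sum_(k < n) `|T (e k)| ^+ 2 <= S.
Proof.
move=> [B [oB dB] sB]; pose S := fine (\esum_(e in B) (`|T e| ^+ 2)%:E).
have psd := inner_product_psd iV.
have ST (F : seq V) : uniq F -> (forall v, v \in F -> B v) ->
    \sum_(i < size F) `|T (nth 0 F i)| ^+ 2 <= S.
  move=> uF FB; rewrite -lee_fin /S fineK; last first.
    rewrite ge0_fin_numE//; apply: esum_ge0 => x _; by rewrite lee_fin sqr_ge0.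
  apply: esum_ge; exists [set` F].
    by split; [exact: finite_seq|move=> v /= /FB].
  rewrite -fsbig_seq// -sumEFin; rewrite (big_nth 0) big_mkord.
  by [].
exists S => e n oe; rewrite -subr_le0.
(* Each term costs [3 eps], as [(u + eps) ^+ 2 <= u ^+ 2 + 3 * eps] for
   [u <= 1] and [eps < 1]. *)
apply: (@le0_eps _ _ (3 * n%:R)); first by rewrite mulr_ge0.
move=> eps /andP[e0 e1].
have hk k : exists mab : {m : nat & (('I_m -> R) * ('I_m -> V))%type},
    (forall i, B ((projT2 mab).2 i)) /\
    `|e k - \sum_i (projT2 mab).1 i *: (projT2 mab).2 i| < eps.
  have [x [/= bx [m [a [b [hb xE]]]]]] := dB (ball (e k) eps)
    (ex_intro _ _ (ballxx (e k) e0)) (ball_open _ _).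
  exists (existT _ m (a, b)); split => //=.
  by move: bx; rewrite -ball_normE/= xE.
have [f hf] := choice hk.
pose F := undup (flatten [seq [seq (projT2 (f k)).2 i | i <- enum 'I_(projT1 (f k))] | k <- iota 0 n]).
have uF : uniq F by exact: undup_uniq.
have FB v : v \in F -> B v.
  rewrite mem_undup => /flattenP[s /mapP[k _ ->] /mapP[i _ ->]].
  by have [] := hf k.
have fF k i : (k < n)%N -> (projT2 (f k)).2 i \in F.
  move=> kn; rewrite mem_undup; apply/flattenP; eexists.
    by apply/mapP; exists k; [rewrite mem_iota|reflexivity].
  by apply/mapP; exists i => //; rewrite mem_enum.
have oF := seq_orthosystem oB uF FB.
pose p k := lincomb (nth 0 F) (fun i => dotV (e k) (nth 0 F i)) (size F).
have ep k : (k < n)%N -> `|e k - p k| < eps.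
  move=> kn; have [_] := hf k; apply: le_lt_trans.
  have [c ->] := seq_span (projT2 (f k)).1 uF (fun i => fF k i kn).
  rewrite -(@ler_pXn2r _ 2) ?nnegrE// -!(inner_product_sqr iV).
  exact: orthosystem_best.
have Tp1 k : `|T (p k)| <= 1.
  apply: le_trans (Tle _) _; rewrite -(@ler_pXn2r _ 2) ?nnegrE// expr1n.
  apply: le_trans (lincomb_norm_le iV _ _ oF) _.
  exact: le_trans (Bessel psd oF (e k) (size F)) (orthosystem_le1 psd oe k).
apply: (@le_trans _ _ (\sum_(k < n) (`|T (p k)| ^+ 2 + 3 * eps) - S)).
  rewrite lerD2r; apply: ler_sum => k _.
  have h : `|T (e k)| <= `|T (p k)| + eps.
    rewrite -(subrK (p k) (e k)) linearD addrC (le_trans (ler_normD _ _))// lerD2l.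
    by rewrite (le_trans (Tle _))// ltW// ep.
  have h1 := Tp1 k; have h0 := normr_ge0 (T (p k)).
  apply: (@le_trans _ _ ((`|T (p k)| + eps) ^+ 2)).
    by rewrite ler_pXn2r ?nnegrE ?addr_ge0// ltW.
  nra.
have pS : \sum_(k < n) `|T (p k)| ^+ 2 <= S.
  apply: le_trans (ST F uF FB).
  have := @Hilbert_Schmidt_swap R V W dotV psd dotW (inner_product_psd iW) (inner_product_def iW) T e
    (nth 0 F) n (size F) oe oF.
  under eq_bigr do rewrite (inner_product_sqr iW).
  by under [leRHS]eq_bigr do rewrite (inner_product_sqr iW).
rewrite big_split/= sumr_const card_ord -mulr_natl lerBlDr addrC.
rewrite lerD// le_eqVlt; apply/orP; left; apply/eqP; rewrite -mulr_natl; ring.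
Qed.

End Hilbert_Schmidt.

(** * Density of the space in its dual *)
Section pairing.
Context {R : realType} (H : nuclear_triple R).
Implicit Types (phi psi eta : nuclear H) (p q n : nat) (w : dual (nuclear H)).

Lemma riesz_subproof p (y : H p) :
  (fun x : H p => dot y x : R^o) \in linear_continuous_pred (H p).
Proof.
have psd := inner_product_psd (dot_inner H p).
apply/asboolP; split; first by move=> a u v; rewrite (form_linearr psd).
move=> x; exact: (inner_productr_cvg (dot_inner H p)).
Qed.

Definition riesz p (y : H p) : dual (H p) := Dual (riesz_subproof y).

Lemma riesz_dual_norm_le p (y : H p) : dual_norm (riesz y) <= `|y|.
Proof.
apply: sup_le_ub; first by exists (`|dot y 0 : R|), 0 => //=; rewrite normr0.
move=> _ [x /= x1 <-]; apply: le_trans (inner_product_le (dot_inner H p) _ _) _.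
by rewrite ler_piMr.
Qed.

Definition pairing eta : dual (nuclear H) := restr (riesz (nuclear_comp 0 eta)).

Lemma pairing_le eta p psi : `|pairing eta psi| <= pnorm 0 eta * pnorm p psi.
Proof.
apply: (le_trans (@pform_le R H 0 eta psi)).
by rewrite ler_wpM2l ?pnorm_ge0// pnorm_le.
Qed.

Lemma incl0_norm_le p (x : H p) : `|incl0 H p x| <= `|x|.
Proof. by elim: p x => [//|p ih] x /=; apply: le_trans (ih _) _; exact: incl_norm_le. Qed.

Lemma incl0_comp0 p psi : incl0 H p (nuclear_comp p psi) = nuclear_comp 0 psi.
Proof. by rewrite incl0_nuclear_comp -(incl0_nuclear_comp 0). Qed.

Section density.
Variable phi : nat -> nuclear H.
Hypothesis dphi : dense_sequence phi.
Variable p : nat.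
Let psd := inner_product_psd (dot_inner H p).
Let psd0 := inner_product_psd (dot_inner H 0).

Definition nuclear_approx (x : H p) :=
  forall eps : R, 0 < eps -> exists psi, `|x - nuclear_comp p psi| < eps.

Lemma nuclear_approx_lin (a : R) (x y : H p) :
  nuclear_approx x -> nuclear_approx y -> nuclear_approx (a *: x + y).
Proof.
move=> hx hy eps e0; have a1 : 0 < `|a| + 1 by rewrite ltr_wpDl.
have [u hu] := hx (eps / 2 / (`|a| + 1)) (divr_gt0 (divr_gt0 e0 (ltr0n R 2)) a1).
have [v hv] := hy (eps / 2) (divr_gt0 e0 (ltr0n R 2)).
exists (a *: u + v); rewrite linearP opprD addrACA -scalerBr.
apply: le_lt_trans (ler_normD _ _) _; rewrite normrZ (_ : eps = eps / 2 + eps / 2); last by field.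
apply: ler_ltD => //; apply: (@le_trans _ _ ((`|a| + 1) * (eps / 2 / (`|a| + 1)))).
  by rewrite ler_pM// ?lerDl// ltW.
by rewrite mulrCA divff ?mulr1// gt_eqF.
Qed.

Lemma nuclear_approx_comp psi : nuclear_approx (nuclear_comp p psi).
Proof. by move=> eps e0; exists psi; rewrite subrr normr0. Qed.

Lemma nuclear_approx_lim (u : nat -> H p) y :
  (forall n, nuclear_approx (u n)) -> u @ \oo --> y -> nuclear_approx y.
Proof.
move=> hu uy eps e0; have e2 : 0 < eps / 2 by rewrite divr_gt0.
have /cvgrPdist_lt/(_ _ e2)[n _ /(_ n (leqnn _)) hn] := uy.
have [psi hpsi] := hu n _ e2; exists psi.
rewrite -(subrK (u n) y) -addrA (_ : eps = eps / 2 + eps / 2); last by field.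
by rewrite (le_lt_trans (ler_normD _ _))// ltrD.
Qed.

(** Such a [z] is orthogonal in [H 0] to a sequence that is dense in [N], in
    particular to approximations of [z] itself. *)
Lemma nuclear_approx_ortho0 (z : H p) : nuclear_approx z ->
  (forall i, dot (nuclear_comp 0 (phi i)) (incl0 H p z) = 0) -> z = 0.
Proof.
move=> hz z0; apply: (@incl0_inj _ H p); rewrite linear0.
apply/eqP; rewrite -normr_eq0 -sqrf_eq0 -(inner_product_sqr (dot_inner H 0)).
rewrite eq_le (form_ge0 psd0) andbT.
set x := incl0 H p z.
apply: (@le0_eps _ _ (2 * `|x|)); first by rewrite mulr_ge0.
move=> eps /andP[e0 _]; have [psi hpsi] := hz eps e0.
have [i hi] := dphi p psi e0.
have -> : dot x x = dot (x - nuclear_comp 0 (phi i)) x.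
  by rewrite (formBl psd0) z0 subr0.
apply: le_trans (ler_norm _) _; apply: le_trans (inner_product_le (dot_inner H 0) _ _) _.
rewrite mulrAC ler_wpM2r// -(incl0_comp0 p) /x -linearB.
apply: le_trans (incl0_norm_le _) _.
rewrite -(subrK (nuclear_comp p psi) z) -addrA (le_trans (ler_normD _ _))//.
rewrite mulrDl mul1r lerD// ltW//.
by rewrite -linearB.
Qed.

(** [N], seen in the dual by the pairing of [H 0], is dense in [H_(-p)]. Write
    [w] as the pairing with [y] in [H p], and each [pairing (phi i)] as the
    pairing with [c i] in [H p]. The part of [y] orthogonal to all the [c i] is
    orthogonal to all the [phi i] in [H 0], hence zero by
    [nuclear_approx_ortho0]. *)
Lemma pairing_dense w C : 0 <= C -> (forall psi, `|w psi| <= C * pnorm p psi) ->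
  forall eps : R, 0 < eps -> exists i, forall psi, `|w psi - pairing (phi i) psi| <= eps * pnorm p psi.
Proof.
move=> C0 wC eps e0.
have hc i : exists y : H p, (forall psi, pairing (phi i) psi = dot y (nuclear_comp p psi)) /\
    nuclear_approx y.
  have [y [_ h1 h2]] := nuclear_dual_Riesz dphi (pnorm_ge0 0 (phi i)) (pairing_le (phi i) p).
  by exists y.
have [c hc'] := choice hc.
have [y [_ yw ya]] := nuclear_dual_Riesz dphi C0 wC.
pose g := gs (@dot _ H p) c.
have og : orthosystem (@dot _ H p) g by exact: gs_orthosystem.
pose b k := dot y (g k).
have ucvg : cvgn (lincomb g b).
  apply: (lincomb_cvg (dot_inner H p) og) => n; exact: (Bessel psd og y n).
set u := lincomb g b in ucvg; pose y' := limn u.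
have uy' : u @ \oo --> y' by [].
have ag k : nuclear_approx (g k).
  apply: gs_subspace; first exact: nuclear_approx_lin.
    by rewrite -(linear0 (@nuclear_comp R H p)); exact: nuclear_approx_comp.
  by move=> i; have [] := hc' i.
have au n : nuclear_approx (u n).
  rewrite /u /lincomb; elim/big_ind : _ => [|x1 x2 h1 h2|k _].
  - by rewrite -(linear0 (@nuclear_comp R H p)); exact: nuclear_approx_comp.
  - by rewrite -[x1]scale1r; exact: nuclear_approx_lin.
  - rewrite -[_ *: _]addr0; apply: nuclear_approx_lin => //.
    by rewrite -(linear0 (@nuclear_comp R H p)); exact: nuclear_approx_comp.
have yy' : y = y'.
  apply/eqP; rewrite -subr_eq0; apply/eqP.
  have az : nuclear_approx (y - y').
    by rewrite addrC -scaleN1r; apply: nuclear_approx_lin => //; exact: nuclear_approx_lim uy'.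
  apply: nuclear_approx_ortho0 => // i.
  have gz k : dot (g k) (y - y') = 0.
    rewrite (formBr psd) -/(b k) (formC psd _ y) (formC psd _ y').
    by rewrite (lincomb_lim_form (dot_inner H p) k og uy') /b (orthosystem_mulr psd og) subrr.
  have cz : dot (c i) (y - y') = 0.
    rewrite (gs_expand psd (@inner_product_def _ _ _ (dot_inner H p)) c i) (formC psd).
    by rewrite form_lincomb// big1// => k _; rewrite [dot (y - y') _](formC psd) gz mulr0.
  apply/eqP; rewrite -normr_le0.
  apply: (@le0_eps _ _ (pnorm 0 (phi i) + `|c i|)); first by rewrite addr_ge0// pnorm_ge0.
  move=> d /andP[d0 _]; have [psi hpsi] := az d d0.
  have -> : dot (nuclear_comp 0 (phi i)) (incl0 H p (y - y')) =
      dot (nuclear_comp 0 (phi i)) (incl0 H p (y - y' - nuclear_comp p psi)) -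
      dot (c i) (y - y' - nuclear_comp p psi).
    have -> : incl0 H p (y - y' - nuclear_comp p psi) = incl0 H p (y - y') - nuclear_comp 0 psi.
      by rewrite [LHS]linearB incl0_comp0.
    rewrite (formBr psd0) (formBr psd _ _ (c i)) cz.
    have [/(_ psi) <- _] := hc' i.
    by rewrite sub0r opprK -[pairing _ _]/(dot (nuclear_comp 0 (phi i)) (nuclear_comp 0 psi)) subrK.
  apply: le_trans (ler_normB _ _) _; rewrite mulrDl lerD//.
    apply: le_trans (inner_product_le (dot_inner H 0) _ _) _.
    by rewrite ler_wpM2l// (le_trans (incl0_norm_le _))// ltW.
  apply: le_trans (inner_product_le (dot_inner H p) _ _) _.
  by rewrite ler_wpM2l// ltW.
have e2 : 0 < eps / 2 by rewrite divr_gt0.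
have /cvgrPdist_lt/(_ _ e2)[n _ /(_ n (leqnn _))] := uy'; rewrite -yy' => yun.
pose S (v : H p) := exists eta, forall psi, dot v (nuclear_comp p psi) = pairing eta psi.
have Slin (a : R) (v1 v2 : H p) : S v1 -> S v2 -> S (a *: v1 + v2).
  move=> [n1 h1] [n2 h2]; exists (a *: n1 + n2) => psi.
  rewrite (form_linearl psd) h1 h2 -![pairing _ _]/(dot (nuclear_comp 0 _) (nuclear_comp 0 psi)).
  by rewrite linearP (form_linearl psd0).
have S0 : S 0.
  exists 0 => psi; rewrite (form0l psd) -[RHS]/(dot (nuclear_comp 0 _) (nuclear_comp 0 psi)).
  by rewrite linear0 (form0l psd0).
have Sg k : S (g k).
  apply: gs_subspace => // i; exists (phi i) => psi; have [-> //] := hc' i.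
have [eta heta] : S (u n).
  rewrite /u /lincomb; elim/big_ind : _ => // [v1 v2 h1 h2|k _].
    by rewrite -[v1]scale1r; exact: Slin.
  by rewrite -[_ *: _]addr0; exact: Slin.
have [i hi] := dphi 0 eta e2.
exists i => psi.
have -> : w psi - pairing (phi i) psi =
    dot (y - u n) (nuclear_comp p psi) + pairing (eta - phi i) psi.
  rewrite yw (formBl psd) heta.
  rewrite -![pairing _ _]/(dot (nuclear_comp 0 _) (nuclear_comp 0 psi)) linearB (formBl psd0); ring.
apply: le_trans (ler_normD _ _) _.
rewrite (_ : eps = eps / 2 + eps / 2); last by field.
rewrite mulrDl lerD//.
  apply: le_trans (inner_product_le (dot_inner H p) _ _) _.
  by rewrite ler_wpM2r// ltW.
apply: le_trans (pairing_le _ p _) _; rewrite ler_wpM2r ?pnorm_ge0// ltW//.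
Qed.

End density.
End pairing.

(** * Growth estimates *)
Section growth.
Context {R : realType}.

Lemma tail_sum_le (a : nat -> R) S d : (forall k, 0 <= a k) ->
  (forall n, \sum_(k < n) a k <= S) -> 0 < d ->
  exists N, forall n, \sum_(k < n | (N <= k)%N) a k <= d.
Proof.
move=> a0 aS d0.
have : cvgn (series a).
  apply: nondecreasing_is_cvgn; first exact: nondecreasing_series.
  by exists S => _ [n _ <-]; rewrite /series/= big_mkord.
move=> /cauchy_cvgP/cauchy_seriesP/(_ _ d0) [[P Q] /= [[N1 _ hP] [N2 _ hQ]] PQ].
exists (maxn N1 N2) => n; rewrite -(big_mkord (fun k => maxn N1 N2 <= k)%N).
have [nN|Nn] := leqP n (maxn N1 N2).
  rewrite big_nat_cond big1 ?(ltW d0)// => k /andP[/andP[_ kn] kN].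
  by move: (leq_ltn_trans kN (leq_trans kn nN)); rewrite ltnn.
rewrite (big_cat_nat (leq0n (maxn N1 N2)) (ltnW Nn))/= big_nat_cond big1 ?add0r; last first.
  by move=> k /andP[/andP[_ kn] kN]; move: (leq_ltn_trans kN kn); rewrite ltnn.
rewrite big_mkcond/= big_nat (eq_bigr a) -?big_nat; last by move=> k /andP[->].
apply/ltW/(le_lt_trans (ler_norm _)); apply: (PQ (maxn N1 N2, n)); split.
  by apply: hP; exact: leq_maxl.
by apply: hQ; rewrite /= (leq_trans (leq_maxr N1 N2))// ltnW.
Qed.

(** The first [N] factors are bounded by a power of [s], the others by an
    exponential whose rate is the tail of the series. *)
Lemma prod_inv_ge (a : nat -> R) S N s n : (forall k, 0 <= a k) ->
  (forall k, a k <= S) -> 0 <= s ->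
  (1 + s * S)^-1 ^+ N * expR (- (s * \sum_(k < n | (N <= k)%N) a k)) <=
  \prod_(k < n) (1 + s * a k)^-1.
Proof.
move=> a0 aS s0; have S0 : 0 <= S := le_trans (a0 0%N) (aS 0%N).
have sS : 0 <= s * S by rewrite mulr_ge0.
have q0 : 0 <= (1 + s * S)^-1 by rewrite invr_ge0 addr_ge0.
have q1 : (1 + s * S)^-1 <= 1 by rewrite invf_le1 ?lerDl// ltr_wpDr.
apply: (@le_trans _ _ ((1 + s * S)^-1 ^+ minn n N * expR (- (s * \sum_(k < n | (N <= k)%N) a k)))).
  by rewrite ler_wpM2r ?expR_ge0// ler_wiXn2l// geq_minr.
elim: n => [|n ih]; first by rewrite min0n !big_ord0 mulr0 oppr0 expR0 mulr1.
rewrite big_mkcond !big_ord_recr/= -big_mkcond/=.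
have sa : 0 <= s * a n by rewrite mulr_ge0.
have [Nn|nN] := leqP N n.
  have -> : minn n.+1 N = minn n N by rewrite (minn_idPr Nn) (minn_idPr (leqW Nn)).
  rewrite mulrDr opprD expRD mulrA ler_pM ?mulr_ge0 ?expR_ge0 ?exprn_ge0//.
  rewrite expRN lef_pV2 ?posrE ?expR_gt0 ?ltr_wpDr//; exact: expR_ge1Dx.
have -> : minn n.+1 N = (minn n N).+1 by rewrite (minn_idPl nN) (minn_idPl (ltnW nN)).
rewrite addr0 exprSr mulrAC ler_pM ?mulr_ge0 ?expR_ge0 ?exprn_ge0//.
by rewrite lef_pV2 ?posrE ?ltr_wpDr// lerD2l ler_wpM2l.
Qed.

Lemma expR_beats_power (A D d : R) N : 0 < A -> 0 <= D -> 0 < d ->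
  exists2 s, 0 < s & (1 + D * s) ^+ N < A * expR (d * s).
Proof.
move=> A0 D0 d0; pose L := A * (d ^+ N.+1 / N.+1`!%:R); pose s := 1 + (1 + D) ^+ N / L.
have L0 : 0 < L by rewrite mulr_gt0 ?divr_gt0 ?exprn_gt0 ?ltr0n ?fact_gt0.
have D1 : 0 <= 1 + D by rewrite addr_ge0.
have s1 : 1 <= s by rewrite lerDl divr_ge0 ?exprn_ge0// ltW.
have s0 : 0 < s := lt_le_trans ltr01 s1.
exists s => //; apply: (@le_lt_trans _ _ ((1 + D) ^+ N * s ^+ N)).
  rewrite -exprMn lerXn2r ?nnegrE ?addr_ge0 ?mulr_ge0// ?(ltW s0)//.
  by rewrite mulrDl mul1r lerD2r.
apply: (@lt_le_trans _ _ (A * ((d * s) ^+ N.+1 / N.+1`!%:R))).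
  rewrite exprMn [ltRHS](_ : _ = L * s * s ^+ N); last by rewrite /L [s ^+ N.+1]exprS; ring.
  rewrite ltr_pM2r ?exprn_gt0// mulrDr mulr1 mulrC.
  by rewrite divfK ?gt_eqF// ltrDr.
rewrite ler_pM2l//; apply: le_trans (expR_ge1Dxn N _); last by rewrite mulr_ge0// ltW.
by rewrite lerDr.
Qed.

End growth.

(** * The measure of ellipsoids *)
Section Gaussian_ellipsoid.
Context {R : realType} {V : lmodType R} {d} {T : measurableType d}.
Variables (mu : probability T R) (X : V -> T -> R) (B : V -> V -> R).
Hypothesis mX : forall v, measurable_fun setT (X v).
Hypothesis X_linear : forall a u v w, X (a *: u + v) w = a * X u w + X v w.
Hypothesis Bpsd : psd_form B.
Variables (eta : V) (A t : R).
Hypotheses (A0 : 0 < A) (t0 : 0 < t).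
Hypothesis smooth_ge : forall es : seq V,
  A * \prod_(e <- es) (1 + t * B e e)^-1 <= \int[mu]_w gauss_weight X B eta es w.

Definition ellipsoid (e : nat -> V) r n : set T :=
  [set w | \sum_(k < n) (X (e k) w - B eta (e k)) ^+ 2 <= r ^+ 2].

Lemma measurable_ellipsoid e r n : measurable (ellipsoid e r n).
Proof.
rewrite (_ : ellipsoid e r n = (fun w => \sum_(k < n) (X (e k) w - B eta (e k)) ^+ 2) @^-1` `]-oo, r ^+ 2]%classic).
  rewrite -[X in measurable X]setTI.
  suff : measurable_fun setT (fun w => \sum_(k < n) (X (e k) w - B eta (e k)) ^+ 2).
    by move=> /(_ measurableT `]-oo, r ^+ 2]%classic); apply; exact: measurable_itv.
  apply: measurable_sum => k.
  by apply: measurable_funX; exact: measurable_funB.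
by apply/seteqP; split => w; rewrite /ellipsoid/= in_itv.
Qed.

(** [gauss_weight] for the vectors [sqrt s e_k] is at most the indicator of the
    ellipsoid plus [expR (- (s r^2 / 2))], and for [s] large its integral
    exceeds the latter by [prod_inv_ge] and [expR_beats_power]. *)
Lemma ellipsoid_ge (e : nat -> V) S r : 0 < r ->
  (forall n, \sum_(k < n) B (e k) (e k) <= S) ->
  exists2 m : R, 0 < m & forall n, (m%:E <= mu (ellipsoid e r n))%E.
Proof.
move=> r0 eS; pose a k := B (e k) (e k).
have a0 k : 0 <= a k by exact: form_ge0.
have aS k : a k <= S.
  by apply: le_trans (eS k.+1); rewrite big_ord_recr/= lerDr sumr_ge0// => i _; exact: a0.
have S0 : 0 <= S := le_trans (a0 0%N) (aS 0%N).
(* Half the rate of decay of the weight outside the ellipsoid: the lower bound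
   on the integral, of rate [c] up to a power of [s], then prevails. *)
pose c := r ^+ 2 / 4; have c0 : 0 < c by rewrite divr_gt0 ?exprn_gt0.
have [N hN] := tail_sum_le a0 eS (divr_gt0 c0 t0).
have tS : 0 <= t * S by rewrite mulr_ge0// ltW.
have [s s0 hs] := expR_beats_power N A0 tS c0.
have q0 : 0 < 1 + t * S * s by rewrite ltr_wpDr// mulr_ge0// ltW.
exists (A * (1 + t * S * s)^-1 ^+ N * expR (- (c * s)) - expR (- (2 * (c * s)))).
  rewrite subr_gt0 mulr2n mulrDl !mul1r opprD expRD ltr_pM2r ?expR_gt0//.
  by rewrite exprVn expRN ltr_pdivlMr ?exprn_gt0// mulrC ltr_pdivrMr ?expR_gt0.
move=> n; pose es := [seq Num.sqrt s *: e k | k <- index_iota 0 n].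
have gE w : gauss_weight X B eta es w =
    expR (- (s / 2 * \sum_(k < n) (X (e k) w - B eta (e k)) ^+ 2)).
  rewrite /gauss_weight big_map -(big_mkord xpredT (fun k => (X (e k) w - B eta (e k)) ^+ 2)).
  rewrite -expR_sum; congr expR; rewrite mulr_sumr -sumrN; apply: eq_bigr => k _.
  have XZ : X (Num.sqrt s *: e k) w = Num.sqrt s * X (e k) w.
    have X0 : X 0 w = 0.
      have := X_linear 1 0 0 w; rewrite scale1r addr0 mul1r => /eqP.
      by rewrite -subr_eq0 opprD addNKr oppr_eq0 => /eqP.
    by rewrite -[_ *: _]addr0 X_linear X0 addr0.
  by rewrite XZ (formZr Bpsd) -mulrBr exprMn sqr_sqrtr ?(ltW s0)//; ring.
have lb : A * (1 + t * S * s)^-1 ^+ N * expR (- (c * s)) <= \int[mu]_w gauss_weight X B eta es w.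
  apply: le_trans (smooth_ge es); rewrite -mulrA ler_pM2l//.
  have ts0 : 0 <= t * s by rewrite mulr_ge0// ltW.
  rewrite big_map.
  have -> : \prod_(k <- index_iota 0 n) (1 + t * B (Num.sqrt s *: e k) (Num.sqrt s *: e k))^-1 =
      \prod_(k < n) (1 + t * s * a k)^-1.
    rewrite -(big_mkord xpredT (fun k => (1 + t * s * a k)^-1)).
    apply: eq_bigr => k _; rewrite (formZr Bpsd) (formC Bpsd) (formZr Bpsd) mulrA -expr2.
    by rewrite sqr_sqrtr ?(ltW s0)// mulrA.
  apply: le_trans (prod_inv_ge N n a0 aS ts0).
  rewrite (_ : t * s * S = t * S * s); last by ring.
  rewrite ler_wpM2l ?exprn_ge0 ?invr_ge0 ?(ltW q0)// ler_expR lerN2.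
  apply: (@le_trans _ _ (t * s * (c / t))); first by rewrite ler_wpM2l.
  by rewrite le_eqVlt; apply/orP; left; apply/eqP; field; rewrite gt_eqF.
have mE := measurable_ellipsoid e r n.
have mu1 : mu setT = 1%E by exact: probability_setT.
have ub : \int[mu]_w gauss_weight X B eta es w <= \int[mu]_w (\1_(ellipsoid e r n) w + expR (- (2 * (c * s)))).
  apply: le_Rintegral => //.
  - apply: (@integrable_bounded _ _ _ mu _ 1); first exact: measurable_gauss_weight.
    by move=> w; rewrite ger0_norm ?gauss_weight_le1// gauss_weight_ge0.
  - apply: (@integrable_bounded _ _ _ mu _ 2).
      by apply: measurable_funD => //; exact: measurable_indic.
    have c2 : 0 <= 2 * (c * s) by rewrite mulr_ge0// ltW// mulr_gt0.
    move=> w; rewrite ger0_norm ?addr_ge0 ?expR_ge0 ?indicE// -[2]/(1 + 1) lerD//.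
      by case: (_ \in _).
    by rewrite -[leRHS]expR0 ler_expR oppr_le0.
  - move=> w _; rewrite gE indicE; case: (boolP (w \in _)) => [_|].
      apply: (@le_trans _ _ 1); last by rewrite lerDl expR_ge0.
      by rewrite -expR0 ler_expR oppr_le0 mulr_ge0 ?divr_ge0 ?(ltW s0)// sumr_ge0// => k _; exact: sqr_ge0.
    rewrite notin_setE /ellipsoid/= => /negP; rewrite -ltNge => h.
    rewrite add0r ler_expR lerN2 /c (_ : 2 * _ = s / 2 * r ^+ 2); last by field.
    by rewrite ler_wpM2l ?divr_ge0 ?ltW.
have fE : mu (ellipsoid e r n) = (\int[mu]_w \1_(ellipsoid e r n) w)%:E.
  rewrite /Rintegral integral_indic// setIT fineK// fin_num_measure//.
rewrite fE lee_fin lerBlDr; apply: le_trans lb _; apply: le_trans ub _.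
rewrite RintegralD//.
- by rewrite Rintegral_cst// [X in fine X]mu1 mulr1.
- apply: (@integrable_bounded _ _ _ mu _ 1); first exact: measurable_indic.
  by move=> w; rewrite indicE; case: (_ \in _); rewrite ?normr1 ?normr0.
- by apply: (@integrable_bounded _ _ _ mu _ `|expR (- (2 * (c * s)))|).
Qed.

End Gaussian_ellipsoid.

(** * Balls of the dual *)
Section dual_balls.
Context {R : realType} (H : nuclear_triple R).
Implicit Types (phi : nat -> nuclear H) (psi eta : nuclear H) (p q n : nat) (w c : dual (nuclear H)).

(** The estimate passes to all of [N] since [w] is continuous for some
    norm, possibly stronger than the one of the estimate. *)
Lemma dense_bound phi w p r : dense_sequence phi -> 0 <= r ->
  (forall i, `|w (phi i)| <= r * pnorm p (phi i)) ->
  forall psi, `|w psi| <= r * pnorm p psi.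
Proof.
move=> dphi r0 h psi; have [q [C [C0 wC]]] := dual_bounded w.
rewrite -subr_le0; apply: (@le0_eps _ _ (C + r)); first by rewrite addr_ge0.
move=> eps /andP[e0 _]; have [i hi] := dphi (maxn p q) psi eps e0.
have wi := h i; have wd := wC (psi - phi i); rewrite dualB in wd.
have pi : pnorm p (psi - phi i) <= eps.
  by apply: le_trans (ltW hi); rewrite pnorm_le// leq_maxl.
have qi : pnorm q (psi - phi i) <= eps.
  by apply: le_trans (ltW hi); rewrite pnorm_le// leq_maxr.
have pp : pnorm p (phi i) <= pnorm p psi + eps.
  rewrite -(subrK psi (phi i)) addrC (le_trans (pnormD _ _ _))// lerD2l.
  by rewrite -pnormN opprB.
rewrite lerBlDr -(subrK (w (phi i)) (w psi)) (le_trans (ler_normD _ _))//.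
apply: (@le_trans _ _ (C * eps + r * (pnorm p psi + eps))); last first.
  by rewrite le_eqVlt; apply/orP; left; apply/eqP; ring.
apply: lerD; first by apply: le_trans wd _; rewrite ler_wpM2l.
by apply: le_trans wi _; rewrite ler_wpM2l.
Qed.

(** The ball of [H_(-p)] with centre [c], with no reference to the dual norm:
    [w - c] belongs to [H_(-p)] if [w] is in the set. *)
Definition dual_ball p c r : set (dual (nuclear H)) :=
  [set w | forall psi, `|w psi - c psi| <= r * pnorm p psi].

Lemma measurable_eval psi :
  measurable_fun setT (fun w : cylinder_space H => dual_fun w psi : R).
Proof.
move=> _ Y mY; rewrite setTI; apply: sub_sigma_algebra.
exists 1%N, [tuple psi], [set t : 1.-tuple R | Y (tnth t ord0)]; split.
  by rewrite -[X in measurable X]setTI; exact: (measurable_tnth ord0).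
by apply/seteqP; split => w /=; rewrite tnth_map.
Qed.

Lemma dual_ball_dense phi p c r : dense_sequence phi -> 0 <= r ->
  dual_ball p c r =
  \bigcap_i [set w | `|w (phi i) - c (phi i)| <= r * pnorm p (phi i)].
Proof.
move=> dphi r0; apply/seteqP; split => w h; first by move=> i _; exact: h.
by move=> psi; apply: (@dense_bound phi (w - c) p r dphi r0) => i; exact: h.
Qed.

Lemma dual_lincomb w (e : nat -> nuclear H) (a : nat -> R) n :
  w (lincomb e a n) = \sum_(k < n) a k * w (e k).
Proof.
rewrite /lincomb; elim: n => [|n ih]; first by rewrite !big_ord0 dual0.
by rewrite !big_ord_recr/= dualD dualZ ih.
Qed.

Lemma measurable_dual_ball p c r : 0 <= r ->
  measurable (dual_ball p c r : set (cylinder_space H)).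
Proof.
move=> r0; have [phi dphi] := nuclear_dense_sequence H.
rewrite (dual_ball_dense p c dphi r0); apply: bigcap_measurable => // i _.
rewrite [X in measurable X](_ : _ = (fun w : cylinder_space H =>
    `|dual_fun w (phi i) - c (phi i)|) @^-1` `]-oo, r * pnorm p (phi i)]%classic); last first.
  by apply/seteqP; split => w /=; rewrite in_itv.
rewrite -[X in measurable X]setTI.
suff : measurable_fun setT (fun w : cylinder_space H => `|dual_fun w (phi i) - c (phi i)|).
  by move=> /(_ measurableT `]-oo, r * pnorm p (phi i)]%classic); apply; exact: measurable_itv.
by apply: measurableT_comp => //; apply: measurable_funB => //; exact: measurable_eval.
Qed.

Lemma sum_CauchySchwarz (a b : nat -> R) n :
  (\sum_(k < n) a k * b k) ^+ 2 <= (\sum_(k < n) a k ^+ 2) * \sum_(k < n) b k ^+ 2.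
Proof.
pose Q (f g : nat -> R^o) : R := \sum_(k < n) f k * g k.
have Qpsd : psd_form Q.
  split=> [x y|x y z w|x].
  - by apply: eq_bigr => k _; rewrite mulrC.
  - by rewrite /Q mulr_sumr -big_split/=; apply: eq_bigr => k _; rewrite mulrDl mulrA.
  - by apply: sumr_ge0 => k _; rewrite -expr2 sqr_ge0.
exact: (form_CauchySchwarz Qpsd a b).
Qed.

(** [phi i] is a finite combination of the [e_k], with coefficients bounded by
    Bessel's inequality; Cauchy-Schwarz then bounds [w - pairing eta] on it. *)
Lemma ellipsoid_sub_dual_ball phi p eta r : dense_sequence phi -> 0 <= r ->
  \bigcap_n ellipsoid (fun psi (w : cylinder_space H) => dual_fun w psi) (pform 0) eta
    (gs (pform p) phi) r n `<=` dual_ball p (pairing eta) r.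
Proof.
move=> dphi r0 w hw psi; apply: (@dense_bound phi (w - pairing eta) p r dphi r0) => i.
set e := gs (pform p) phi in hw; pose a k := pform p (phi i) (e k).
have psd := pform_psd H p.
rewrite -(@ler_pXn2r _ 2) ?nnegrE ?mulr_ge0 ?pnorm_ge0// real_normK ?num_real//.
rewrite [in leLHS](gs_expand psd (@pform_def _ _ p) phi i) dual_lincomb.
apply: le_trans (sum_CauchySchwarz a (fun k => (w - pairing eta) (e k)) i.+1) _; rewrite exprMn mulrC ler_pM ?sumr_ge0//.
- by move=> k _; exact: sqr_ge0.
- by move=> k _; exact: sqr_ge0.
- exact: (hw i.+1).
- rewrite -pform_sqr; apply: Bessel => //; exact: gs_orthosystem.
Qed.

End dual_balls.

(** * Open sets of the dual *)
Section open_sets.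
Context {R : realType} (H : nuclear_triple R).
Variable phi : nat -> nuclear H.
Hypothesis dphi : dense_sequence phi.

(** Continuity of the inclusion of [H_(-q-1)] at [w] gives a ball around [w] in
    [U]; a ball of less than half its radius, centred at a point of the dense
    sequence close to [w], contains [w] and stays in [U]. *)
Lemma open_contains_dual_ball (tau : set_system (dual (nuclear H))) U w :
  inclusions_continuous tau -> tau U -> U w ->
  exists q i k, dual_ball q.+1 (pairing (phi i)) k.+1%:R^-1 w /\
    dual_ball q.+1 (pairing (phi i)) k.+1%:R^-1 `<=` U.
Proof.
move=> tauc tU Uw; have [q [C [C0 wC]]] := dual_bounded w.
have wC' psi : `|w psi| <= C * pnorm q.+1 psi.
  by apply: le_trans (wC psi) _; rewrite ler_wpM2l// pnorm_le.
have [y [_ wy _]] := nuclear_dual_Riesz dphi C0 wC'.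
have wE : w = restr (riesz y) by apply: val_inj; apply/funext => psi; exact: wy.
rewrite wE in Uw; have [e e0 he] := tauc q.+1 (riesz y) U tU Uw.
have [k ke] : exists k : nat, k.+1%:R^-1 < e / 2.
  exists (Num.truncn (e / 2)^-1); rewrite invf_plt ?posrE ?ltr0n ?divr_gt0//.
  exact: truncnS_gt.
have k0 : (0 : R) < k.+1%:R^-1 by rewrite invr_gt0 ltr0n.
have [i hi] := pairing_dense dphi C0 wC' k0.
exists q, i, k; split => // w' hw'.
have w'C psi : `|(w' - w) psi| <= (k.+1%:R^-1 + k.+1%:R^-1) * pnorm q.+1 psi.
  rewrite -[(w' - w) psi]/(w' psi - w psi) -(subrK (pairing (phi i) psi) (w' psi)) -addrA.
  rewrite mulrDl (le_trans (ler_normD _ _))// lerD ?hw'//.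
  by rewrite distrC hi.
have [y' [y'le wy' _]] := nuclear_dual_Riesz dphi (addr_ge0 (ltW k0) (ltW k0)) w'C.
have -> : w' = restr (riesz y + riesz y').
  apply: val_inj; apply/funext => psi.
  rewrite -[RHS]/(dot y (nuclear_comp q.+1 psi) + dot y' (nuclear_comp q.+1 psi)) -wy -wy'.
  by rewrite -[(w' - w) psi]/(w' psi - w psi) addrC subrK.
apply: he; rewrite addrC addKr.
apply: le_lt_trans (riesz_dual_norm_le _) _; apply: le_lt_trans y'le _.
by rewrite (_ : e = e / 2 + e / 2) ?ltrD//; field.
Qed.

Lemma open_measurable (tau : set_system (dual (nuclear H))) U :
  inclusions_continuous tau -> tau U -> measurable (U : set (cylinder_space H)).
Proof.
move=> tauc tU.
pose b (x : nat * nat * nat) := dual_ball x.1.1.+1 (pairing (phi x.1.2)) x.2.+1%:R^-1.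
have -> : U = \bigcup_(x in [set x | b x `<=` U]) b x.
  apply/seteqP; split => [w Uw|w [x xU] /xU//].
  have [q [i [k [bw bU]]]] := open_contains_dual_ball tauc tU Uw.
  by exists (q, i, k).
rewrite bigcup_mkcond; apply: countable_bigcupT_measurable => [|x]; first exact: countableP.
case: ifP => _; last exact: measurable0.
by apply: measurable_dual_ball; rewrite invr_ge0.
Qed.

End open_sets.

(** * Positivity *)
Section positivity.
Context {R : realType} (H : nuclear_triple R) (beta : R).
Variable mu : probability (cylinder_space H) R.
Hypothesis beta01 : 0 < beta < 1.
Hypothesis hmu : mittag_leffler_measure beta mu.

Let ev (psi : nuclear H) (w : cylinder_space H) : R := dual_fun w psi.

Lemma mittag_leffler_cos psi c :
  \int[mu]_w cos (ev psi w - c) =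
  cos c * mittag_leffler beta (- (pform 0 psi psi / 2)).
Proof.
have [hc hs] := hmu psi.
have mc (f : R -> R) : continuous f -> measurable_fun setT (fun w : cylinder_space H => f (ev psi w)).
  move=> cf; apply: measurableT_comp; first exact: continuous_measurable_fun.
  exact: measurable_eval.
have ic : mu.-integrable setT (EFin \o (fun w => cos (ev psi w))).
  by apply: (@integrable_bounded _ _ _ mu _ 1) => [|w]; [apply: mc; exact: continuous_cos|exact: cos_max].
have isn : mu.-integrable setT (EFin \o (fun w => sin (ev psi w))).
  by apply: (@integrable_bounded _ _ _ mu _ 1) => [|w]; [apply: mc; exact: continuous_sin|exact: sin_max].
under eq_Rintegral do rewrite cosB mulrC [X in _ + X]mulrC.
rewrite RintegralD//; first last.
- rewrite (_ : _ \o _ = fun w => ((sin c)%:E * (sin (ev psi w))%:E)%E) ?integrableZl//.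
- rewrite (_ : _ \o _ = fun w => ((cos c)%:E * (cos (ev psi w))%:E)%E) ?integrableZl//.
rewrite !RintegralZl// [X in sin c * X]hs mulr0 addr0 [X in cos c * X]hc.
congr (_ * mittag_leffler beta (- _)); rewrite mulrC /pform.
by have -> : nuclear_comp 0 psi = nuclear_val psi by exact: (incl0_nuclear_comp 0).
Qed.

(** The lower bound [m] does not depend on the number of coordinates, so it
    survives the passage to the intersection of the decreasing ellipsoids. *)
Lemma dual_ball_pos q eta r : 0 < r ->
  (0 < mu (dual_ball q.+1 (pairing eta) r : set (cylinder_space H)))%E.
Proof.
move=> r0; have [b0 b1] := andP beta01.
have [phi dphi] := nuclear_dense_sequence H.
pose e := gs (pform q.+1) phi.
have [S hS] := hilbert_schmidt_bound (dot_inner H q.+1) (dot_inner H q) (@incl_norm_le _ H q)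
  (@incl_hilbert_schmidt _ H q).
have eS n : \sum_(k < n) pform 0 (e k) (e k) <= S.
  apply: le_trans (hS (nuclear_comp q.+1 \o e) n (pform_gs_orthosystem _ _)).
  apply: ler_sum => k _; rewrite pform_sqr /= nuclear_compS.
  by rewrite ler_pXn2r ?nnegrE ?pnorm_ge0//; apply: pnorm_le.
have [t0 [t1 [c [t00 t10 c0 hc]]]] := crp_mass b0 b1.
have mev psi : measurable_fun setT (ev psi) by exact: measurable_eval.
have evl (a : R) (u v : nuclear H) (w : cylinder_space H) :
    ev (a *: u + v) w = a * ev u w + ev v w by rewrite /ev dualD dualZ.
have A0 : 0 < c * expR (- (pform 0 eta eta / (2 * t0))) by rewrite mulr_gt0// expR_gt0.
have sm es : c * expR (- (pform 0 eta eta / (2 * t0))) * \prod_(v <- es) (1 + t1 * pform 0 v v)^-1 <=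
    \int[mu]_w gauss_weight ev (pform 0) eta es w.
  rewrite -mulrA.
  apply: (smoothed_ge mev evl (pform_psd H 0) (crp_ge0 b0 b1) (crp_time_ge0 beta)
    (crp_sum1 beta) (crp_laplace_cvg b0 b1)) => //; last exact: ltW.
  exact: mittag_leffler_cos.
have [m m0 hm] := ellipsoid_ge mev evl (pform_psd H 0) A0 t10 sm r0 eS.
have mE n := measurable_ellipsoid (pform 0) mev eta e r n.
have mI : measurable (\bigcap_n ellipsoid ev (pform 0) eta e r n) by apply: bigcap_measurable.
apply: (@lt_le_trans _ _ (mu (\bigcap_n ellipsoid ev (pform 0) eta e r n))); last first.
  apply: le_measure; rewrite ?inE//; first by apply: measurable_dual_ball; exact: ltW.
  by apply: ellipsoid_sub_dual_ball => //; exact: ltW.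
apply: (@lt_le_trans _ _ m%:E); first by rewrite lte_fin.
have cv : (mu \o ellipsoid ev (pform 0) eta e r) n @[n --> \oo] --> mu (\bigcap_n ellipsoid ev (pform 0) eta e r n).
  apply: nonincreasing_cvg_mu => //.
    by rewrite (le_lt_trans (probability_le1 mu (mE 0%N)))// ltry.
  move=> n n' nn'; rewrite subsetEset => w; apply: le_trans.
  rewrite /ellipsoid/= -!(big_mkord xpredT (fun k => (ev (e k) w - pform 0 eta (e k)) ^+ 2)).
  by rewrite (big_cat_nat (leq0n n) nn')/= lerDl sumr_ge0// => k _; exact: sqr_ge0.
rewrite -(cvg_lim _ cv)//; apply: lime_ge; first by apply/cvg_ex; eexists; exact: cv.
by near=> n; exact: hm.
Unshelve. all: by end_near. Qed.

End positivity.

Theorem theorem4p5 (R : realType) (H : nuclear_triple R)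
  (tau : set_system (dual (nuclear H))) (htau : inductive_limit_topology tau)
  (beta : R) (hbeta : 0 < beta < 1)
  (mu : probability (cylinder_space H) R)
  (hmu : mittag_leffler_measure beta mu)
  (U : set (dual (nuclear H))) (hU : tau U) (hU0 : U !=set0) :
  (0 < mu U)%E.
Proof.
have [_ tauc _] := htau; have [w Uw] := hU0.
have [phi dphi] := nuclear_dense_sequence H.
have [q [i [k [_ bU]]]] := open_contains_dual_ball dphi tauc hU Uw.
have k0 : (0 : R) < k.+1%:R^-1 by rewrite invr_gt0 ltr0n.
apply: lt_le_trans (dual_ball_pos hbeta hmu q (phi i) k0) _.
apply: le_measure => //; rewrite inE.
  by apply: measurable_dual_ball; exact: ltW.
exact: (open_measurable dphi tauc).
Qed.
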